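(* Let $1<s\leqslant\infty$, $s'=s/(s-1)$, $k\in(1,2-1/s)$, and let $\Phi_{k,s}:=\left\|\varphi_{k,s}''\right\|_{L_s(\mathbb{R})}^{-1}\cdot\varphi_{k,s}$, where $\varphi_{k,s}$ is the function defined in the context. Then for every $f\in L^2_{\infty,s}(\mathbb{R})$, there holds the sharp inequality $$\left\|D^k_-f\right\|_{L_\infty(\mathbb{R})}\leqslant\frac{\left\|D^k_-\Phi_{k,s}\right\|_{L_\infty(\mathbb{R})}}{\left\|\Phi_{k,s}\right\|_{L_\infty(\mathbb{R})}^{1-\lambda}}\,\|f\|_{L_\infty(\mathbb{R})}^{1-\lambda}\,\|f''\|_{L_s(\mathbb{R})}^{\lambda},\qquad\lambda=\frac{k}{2-1/s}.$$
   Context: $L^2_{\infty,s}(\mathbb{R})$ is the space of $f\in L_\infty(\mathbb{R})$ such that $f'$ is locally absolutely continuous and $f''\in L_s(\mathbb{R})$. For $s=\infty$, $s'=1$ and $1/s=0$. Let $S=\{(a,b,p): (a,b)\in(0,1)^2,\ a\leqslant b,\ p\in[0,+\infty)\}$. For $(a,b,p)\in S$ let $\omega(a,b,p;x)=0$ for $x\leqslant-p$; $\omega(a,b,p;x)=\frac{1-b+(1-b^{1-k})(a-1)}{(1-b)(a+p)}$ for $x\in(-p,a]$; $\omega(a,b,p;x)=(1-b)^{-1}(1-b^{1-k})$ for $x\in(a,1)$; $\omega(a,b,p;x)=(1-k)x^{-k}$ for $x\geqslant1$. Let $\tau(a,b,p;x)=\rho(x)-\int_{-\infty}^x\omega(a,b,p;t)\,dt$,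 where $\rho(x)=x^{1-k}$ for $x>0$ and $\rho(x)=0$ for $x\leqslant0$. Write $g_{(s')}:=|g|^{s'-1}\mathrm{sign}\,g$, and put $$\varphi(a,b,p;x)=\frac12\int_{-p}^a t\,\tau_{(s')}(a,b,p;t)\,dt+\int_{-p}^x(x-t)\,\tau_{(s')}(a,b,p;t)\,dt,$$ where, since $\tau(a,b,p;t)=0$ for $t\leqslant-p$, the last integral is $0$ for $x\leqslant-p$. The system $\int_{-p}^a\tau_{(s')}(a,b,p;t)\,dt=0$, $\int_a^1\tau_{(s')}(a,b,p;t)\,dt=0$, $\int_{-p}^1t\,\tau_{(s')}(a,b,p;t)\,dt=0$ has at least one solution in $S$; let $(a_{k,s},b_{k,s},p_{k,s})$ be one of its solutions and $\varphi_{k,s}:=\varphi(a_{k,s},b_{k,s},p_{k,s};\cdot)$. Marchaud derivative: for $k>0$, $k\notin\mathbb{N}$, $f:\mathbb{R}\to\mathbb{R}$, $x\in\mathbb{R}$, $D^k_-f(x)=\frac{1}{\varkappa(k,n)}\int_0^{+\infty}\frac{(\Delta^n_{-t}f)(x)}{t^{1+k}}\,dt$, where $n\in\mathbb{N}$, $n>k$ (the definition does not depend on $n$), $(\Delta^n_{-t}f)(x)=\sum_{m=0}^n(-1)^m\binom{n}{m}f(x+mt)$ and $\varkappa(k,n)=\Gamma(-k)\sum_{m=0}^n(-1)^m\binom{n}{m}m^k$. ''Sharp'' means that the constant on the right-hand side cannot be replaced by a smaller one. *)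

(* Defs.v *)
(* MathComp-Analysis *)
From HB Require Import structures.
From mathcomp Require Import all_boot all_order all_algebra.
From mathcomp Require Import all_classical all_reals all_analysis.

Set Implicit Arguments.
Unset Strict Implicit.
Unset Printing Implicit Defensive.

Import Order.TTheory GRing.Theory Num.Theory.
Import numFieldNormedType.Exports.

Local Open Scope classical_set_scope.
Local Open Scope ring_scope.

Definition abs_continuous_on (R : realType) (u v : R) (g : R -> R) : Prop :=
  forall e : R, 0 < e -> exists2 d : R, 0 < d &
    forall (N : nat) (l r : 'I_N -> R),
      (forall i, u <= l i /\ l i <= r i /\ r i <= v) ->
      trivIset [set: 'I_N] (fun i => `]l i, r i[%classic) ->
      \sum_(i < N) (r i - l i) < d ->
      \sum_(i < N) `|g (r i) - g (l i)| < e.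

Definition loc_abs_continuous (R : realType) (g : R -> R) : Prop :=
  forall u v : R, u < v -> abs_continuous_on u v g.

(* L^2_{oo,s}(R). The derivative of a locally absolutely continuous f' exists
   almost everywhere; where it does not, derive1n 2 f takes a fixed default value,
   which affects neither measurability nor the norm. *)
Definition L2space (R : realType) (s : \bar R) (f : R -> R) : Prop :=
  [/\ f \in Lfun (@lebesgue_measure R) +oo%E,
      forall x, derivable f x 1,
      loc_abs_continuous (derive1 f) &
      derive1n 2 f \in Lfun (@lebesgue_measure R) s].

Definition enorm (R : realType) (s : \bar R) (f : R -> R) : \bar R :=
  ('N[@lebesgue_measure R]_s[EFin \o f])%E.

Definition rnorm (R : realType) (s : \bar R) (f : R -> R) : R :=
  fine (enorm s f).

Definition Gamma_pos (R : realType) (x : R) : R :=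
  \int[@lebesgue_measure R]_(t in `]0, +oo[) (t `^ (x - 1) * expR (- t)).

(* Gamma(x) = Gamma(x + N) / (x (x + 1) ... (x + N - 1)) with N the least
   natural number such that x + N > 0; truncn is 0 on negative numbers, so
   N = 0 when x > 0. *)
Definition Gamma (R : realType) (x : R) : R :=
  let N := Num.truncn (1 - x) in
  Gamma_pos (x + N%:R) / \prod_(i < N) (x + i%:R).

Definition finite_diff (R : realType) (n : nat) (t : R) (f : R -> R) (x : R) : R :=
  \sum_(m < n.+1) (-1) ^+ m * 'C(n, m)%:R * f (x + m%:R * t).

Definition marchaud_cst (R : realType) (k : R) (n : nat) : R :=
  Gamma (- k) * \sum_(m < n.+1) (-1) ^+ m * 'C(n, m)%:R * (m%:R `^ k).

(* D^k_- f, for a non-integer k > 0, computed with differences of order n > k *)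
Definition marchaud (R : realType) (n : nat) (k : R) (f : R -> R) (x : R) : R :=
  (marchaud_cst k n)^-1 *
  \int[@lebesgue_measure R]_(t in `]0, +oo[) (finite_diff n t f x / t `^ (1 + k)).

Definition in_S (R : realType) (a b p : R) : Prop :=
  [/\ 0 < a < 1, 0 < b < 1, a <= b & 0 <= p].

Definition omega (R : realType) (k a b p x : R) : R :=
  if x <= - p then 0
  else if x <= a then
    (1 - b + (1 - b `^ (1 - k)) * (a - 1)) / ((1 - b) * (a + p))
  else if x < 1 then (1 - b)^-1 * (1 - b `^ (1 - k))
  else (1 - k) * x `^ (- k).

Definition rho (R : realType) (k x : R) : R :=
  if 0 < x then x `^ (1 - k) else 0.

Definition tau (R : realType) (k a b p x : R) : R :=
  rho k x - \int[@lebesgue_measure R]_(t in `]-oo, x]) omega k a b p t.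

Definition signed_pow (R : realType) (q : R) (y : R) : R :=
  `|y| `^ (q - 1) * Num.sg y.

(* In the following, q stands for the conjugate exponent s'. *)

Definition tau_pow (R : realType) (k q a b p t : R) : R :=
  signed_pow q (tau k a b p t).

Definition phi_system (R : realType) (k q a b p : R) : Prop :=
  [/\ \int[@lebesgue_measure R]_(t in `[- p, a]) tau_pow k q a b p t = 0,
      \int[@lebesgue_measure R]_(t in `[a, 1]) tau_pow k q a b p t = 0 &
      \int[@lebesgue_measure R]_(t in `[- p, 1]) (t * tau_pow k q a b p t) = 0].

(* For x < - p the interval of the last integral is empty. *)
Definition phi (R : realType) (k q a b p x : R) : R :=
  2^-1 * \int[@lebesgue_measure R]_(t in `[- p, a]) (t * tau_pow k q a b p t)
  + \int[@lebesgue_measure R]_(t in `[- p, x]) ((x - t) * tau_pow k q a b p t).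

Definition conj_exp (R : realType) (s : \bar R) : R := fine (hoelder_conjugate s).

Definition inv_exp (R : realType) (s : \bar R) : R := fine (s^-1)%E.

Definition Phi (R : realType) (k : R) (s : \bar R) (a b p : R) : R -> R :=
  let ph := phi k (conj_exp s) a b p in
  fun x => (rnorm s (derive1n 2 ph))^-1 * ph x.

(* Main.v *)
(* The alternating sums in [finite_diff] kill affine functions, so after scaling
   each term the Marchaud derivative at [x] is a constant multiple, not depending
   on [f], of [int_0^oo (f (x + t) - f x - t f' x) / t^(1+k) dt]; the value of that
   constant is irrelevant, since it occurs on both sides.  Integrating by parts
   against the piecewise linear interpolation of [rho] whose slope is [omega],
   [k (k - 1)] times the remainder integral at the origin becomes
     [int f'' tau + s1 f(-p) - (s1 - s2) f(a) + (1 - k - s2) f(1)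
        + k (k - 1) int_1^oo f t^(-1-k) dt]
   with slopes [s1 > 0 > s2] and [s2 <= 1 - k], and Hoelder's inequality bounds it by
   [2 (s1 - s2) |f|_oo + |f''|_s |tau|_s'].  The function phi attains equality: phi
   is its maximal value [M] on [x <= -p] and on [x >= 1], [-M] at [a], and its second
   derivative is the Hoelder extremizer of tau.  Applying the bound to
   [t |-> f (x + h t)] and optimizing over [h] gives the multiplicative inequality;
   equality for Phi at the point 0 transfers to the essential supremum because
   [D^k_- Phi] is continuous. *)
Require Import Defs.
From HB Require Import structures.
From mathcomp Require Import all_boot all_order all_algebra.
From mathcomp Require Import all_classical all_reals all_analysis.
From mathcomp Require Import measurable_realfun ess_sup_inf.
From mathcomp Require Import ring lra.

Set Implicit Arguments.
Unset Strict Implicit.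
Unset Printing Implicit Defensive.

Import Order.TTheory GRing.Theory Num.Theory.
Import numFieldNormedType.Exports.

Local Open Scope classical_set_scope.
Local Open Scope ring_scope.

(** * Absolutely continuous functions and the fundamental theorem of calculus *)

(** [omega] is built from the convexity of [x^(1-k)]: on []a, 1[] its primitive is the line through
    the points of the graph over [b] and 1, which makes [tau] negative on []-p, 0]], positive on
    []0, b[], negative on []b, 1[] and zero elsewhere. The equations of the system say that phi'
    vanishes at [a] and at 1 and that [phi 1 = phi (- p)]; with the signs of [tau] they force phi to
    fall from M to -M and to climb back. The condition [k < 2 - 1/s] is the integrability of
    [t^((1-k)s')] at 0. The obstacle is regularity. A second derivative exists only almost
    everywhere, with default values elsewhere; f'' is therefore handled as a density of f', found by
    applying Radon-Nikodym to monotone parts of f', and phi'' is computed only off five breakpoints.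
    For s = oo it is the sign of [tau], which is why strict signs are proved. No minimization over h
    is carried out: h is chosen so that the rescaled f has the same ratio of norms as Phi, and for
    Phi this choice is h = 1. *)

Section abs_continuous_total_variation.
Context {R : realType}.
Implicit Types (g : R -> R) (u v : R) (s t : seq (R * R)) (p q : R * R).

Definition itv_apart p q := (p.2 <= q.1) || (q.2 <= p.1).

Lemma itv_apartC p q : itv_apart p q = itv_apart q p.
Proof. by rewrite /itv_apart orbC. Qed.

(** Lists compared by [pairwise] replace the ordinal-indexed families of [abs_continuous_on],
    because an interval of a list can be refined by concatenation. *)
Definition small_itvs u v (d : R) s :=
  [/\ all (fun p => (u <= p.1) && (p.1 <= p.2) && (p.2 <= v)) s,
      pairwise itv_apart s & \sum_(p <- s) (p.2 - p.1) < d].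

Lemma abs_continuous_seq u v g : abs_continuous_on u v g ->
  forall e : R, 0 < e -> exists2 d, 0 < d & forall s, small_itvs u v d s ->
    \sum_(p <- s) `|g p.2 - g p.1| < e.
Proof.
move=> gac e e0; have [d d0 H] := gac e e0; exists d => // s [sall spw ssum].
have := H (size s) (fun i => (nth (0, 0) s i).1) (fun i => (nth (0, 0) s i).2).
rewrite (big_nth (0, 0)) big_mkord; apply; last first.
- by rewrite (big_nth (0, 0)) big_mkord in ssum.
- have key : forall i j : 'I_(size s), (i < j)%N ->
      `](nth (0, 0) s i).1, (nth (0, 0) s i).2[%classic `&`
      `](nth (0, 0) s j).1, (nth (0, 0) s j).2[%classic = set0.
    move=> i j ij; rewrite -subset0 => x [] /=.
    rewrite !in_itv/= => /andP[x1 x2] /andP[x3 x4].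
    have := (pairwiseP (0, 0) spw) i j (ltn_ord i) (ltn_ord j) ij.
    move=> /orP[h|h].
      by have := lt_trans (lt_le_trans x2 h) x3; rewrite ltxx.
    by have := lt_trans (lt_le_trans x4 h) x1; rewrite ltxx.
  apply/trivIsetP => i j _ _; rewrite neq_ltn => /orP[ij|ij]; first exact: key.
  by rewrite setIC; exact: key.
- move=> i; have /allP/(_ (nth (0,0) s i)) := sall.
  by rewrite mem_nth// => /(_ isT) /andP[/andP[]].
Qed.

Fixpoint links (l : R) (r : seq R) : seq (R * R) :=
  if r is x :: r' then (l, x) :: links x r' else [::].

Lemma variation_links l r g (z : seq R) : itv_partition l r z ->
  variation l r g z = \sum_(p <- links l z) `|g p.2 - g p.1|.
Proof.
move=> /[dup] lz /variation_zip ->; elim: z l lz => [|x z ih] l lz; first by rewrite !big_nil.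
by rewrite /= !big_cons/= ih//; exact: itv_partition_cons lz.
Qed.

Lemma links_ge l (z : seq R) : path <%R l z ->
  all (fun p => (l <= p.1) && (p.1 <= p.2) && (p.2 <= last l z)) (links l z).
Proof.
elim: z l => //= x z ih l /andP[lx xz].
have /allP H := ih _ xz.
rewrite lexx (ltW lx)/=; apply/andP; split; last first.
  apply/allP => p /H /andP[/andP[xp ->] ->].
  by rewrite (le_trans (ltW lx) xp).
move: xz; clear; elim: z x => //= y z ih x /andP[xy yz].
exact: (le_trans (ltW xy) (ih _ yz)).
Qed.

Lemma links_pairwise l (z : seq R) : path <%R l z -> pairwise itv_apart (links l z).
Proof.
elim: z l => //= x z ih l /andP[lx xz]; rewrite ih// andbT.
apply/allP => p /(allP (links_ge xz)) /andP[/andP[xp _] _].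
by rewrite /itv_apart/= xp.
Qed.

Lemma links_sum l (z : seq R) : \sum_(p <- links l z) (p.2 - p.1) = last l z - l.
Proof.
elim: z l => [|x z ih] l /=; first by rewrite big_nil subrr.
by rewrite big_cons/= ih; ring.
Qed.

(** Induction on [s]: a partition of the head interval is moved into [t] as its list of [links],
    which keeps the family small, and the supremum over such partitions is the total variation of
    the head. This is why [t] is general. *)
Lemma small_itvs_total_variation u v g (e d : R) :
  (forall s, small_itvs u v d s -> \sum_(p <- s) `|g p.2 - g p.1| <= e) ->
  forall s t, small_itvs u v d (s ++ t) ->
  (\sum_(p <- s) total_variation p.1 p.2 g +
    (\sum_(p <- t) `|g p.2 - g p.1|)%:E <= e%:E)%E.
Proof.
move=> H; elim=> [|[l r] s ih] t; first by rewrite big_nil add0e lee_fin; exact: H.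
rewrite cat_cons => -[] /= /andP[/andP[/andP[ul lr] rv] sall] /andP[/allP lrs spw].
rewrite big_cons/= => ssum.
have TV0 : (0 <= \sum_(p <- s) total_variation p.1 p.2 g)%E.
  rewrite big_seq; apply: sume_ge0 => p ps.
  apply: total_variation_ge0.
  have := allP sall p; rewrite mem_cat ps => /(_ isT).
  by move=> /andP[/andP[_ ->]].
have step z : itv_partition l r z ->
    ((variation l r g z)%:E + (\sum_(p <- s) total_variation p.1 p.2 g +
    (\sum_(p <- t) `|g p.2 - g p.1|)%:E) <= e%:E)%E.
  move=> lz; have [lpath /eqP lastz] := lz.
  have := ih (links l z ++ t).
  rewrite big_cat/= EFinD -(variation_links _ lz) addeCA; apply; split.
  - have := sall; rewrite !all_cat => /andP[-> ->]; rewrite andbT/=.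
    apply/allP => p /(allP (links_ge lpath)) /andP[/andP[lp ->]].
    by rewrite lastz => pr; rewrite (le_trans ul lp) (le_trans pr rv).
  - have H1 q : q \in s ++ t -> forall p, p \in links l z -> itv_apart p q.
      move=> /lrs; rewrite /itv_apart/= => rl p /(allP (links_ge lpath)).
      rewrite lastz; move: rl; case: (p) (q) => [p1 p2] [q1 q2]/=.
      by move=> /orP[|] h /andP[/andP[? ?] ?]; apply/orP;
        [left; apply: le_trans h|right; apply: le_trans h _].
    move: spw; rewrite !pairwise_cat => /and3P[st -> ->].
    rewrite (links_pairwise lpath) !andbT/= allrel_catr st andbT.
    apply/andP; split; apply/allrelP => p q ps qs.
      by rewrite itv_apartC; apply: H1 => //; rewrite mem_cat ps.
    by apply: H1 => //; rewrite mem_cat qs orbT.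
  - move: ssum; rewrite !big_cat/= links_sum lastz; lra.
(* Only a finite remainder can be moved across the inequality before the supremum over partitions is
   taken. *)
have rest_fin : ((\sum_(p <- s) total_variation p.1 p.2 g +
    (\sum_(p <- t) `|g p.2 - g p.1|)%:E) \is a fin_num)%E.
  rewrite ge0_fin_numE; last by rewrite adde_ge0// lee_fin sumr_ge0.
  apply: le_lt_trans (ltry e); apply: ih; split => //.
  move: ssum; lra.
rewrite big_cons/= -addeA -leeBrDr//.
by apply: ge_ereal_sup => _ [_ [z lz <-] <-]; rewrite leeBrDr//; exact: step.
Qed.

Lemma abs_continuous_total_variation u v g : abs_continuous_on u v g ->
  forall e : R, 0 < e -> exists2 d, 0 < d & forall s, small_itvs u v d s ->
    (\sum_(p <- s) total_variation p.1 p.2 g <= e%:E)%E.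
Proof.
move=> gac e e0; have [d d0 H] := abs_continuous_seq gac e0.
exists d => // s ss; have H' s' : small_itvs u v d s' ->
  \sum_(p <- s') `|g p.2 - g p.1| <= e by move=> /H /ltW.
have := @small_itvs_total_variation u v g e d H' s [::].
by rewrite cats0 big_nil adde0; exact.
Qed.

(** Cutting [[u, v]] into [N.+1] pieces shorter than [d] leaves a variation of at most 1 on each
    piece, and total variation is additive. *)
Lemma abs_continuous_bounded_variation u v g : u <= v ->
  abs_continuous_on u v g -> bounded_variation u v g.
Proof.
move=> uv /abs_continuous_total_variation /(_ 1 ltr01)[d d0 H].
apply/bounded_variationP => //; rewrite ge0_fin_numE; last exact: total_variation_ge0.
pose N := Num.bound ((v - u) / d).
pose h := (v - u) / N.+1%:R.
have h0 : 0 <= h by rewrite divr_ge0// subr_ge0.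
have hd : h < d.
  rewrite /h ltr_pdivrMr// mulrC -ltr_pdivrMr//.
  apply: lt_le_trans (archi_boundP _) _; first by rewrite divr_ge0 ?subr_ge0// ltW.
  by rewrite ler_nat.
have uh : u + N.+1%:R * h = v by rewrite /h mulrC divfK ?pnatr_eq0// addrCA subrr addr0.
suff : forall j, (j <= N.+1)%N -> (total_variation u (u + j%:R * h) g < +oo)%E.
  by move=> /(_ N.+1 (leqnn _)); rewrite uh.
elim=> [|j ih] jN.
  by rewrite mul0r addr0 total_variationxx.
have jv : u + j.+1%:R * h <= v.
  by rewrite -uh lerD2l ler_wpM2r// ler_nat.
have jj : u + j%:R * h <= u + j.+1%:R * h.
  by rewrite lerD2l ler_wpM2r// ler_nat.
have uj : u <= u + j%:R * h by rewrite lerDl mulr_ge0.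
rewrite (total_variationD g uj jj); apply: lte_add_pinfty; first exact: ih (ltnW jN).
apply: le_lt_trans (ltry 1).
have := H [:: (u + j%:R * h, u + j.+1%:R * h)]; rewrite big_seq1/=; apply.
split => //=; first by rewrite uj jj jv.
rewrite big_seq1/= -natr1; apply: le_lt_trans hd; rewrite le_eqVlt; apply/orP; left.
by apply/eqP; ring.
Qed.

End abs_continuous_total_variation.

(** * Radon-Nikodym densities of monotone absolutely continuous functions *)

Section monotone_density.
Context {R : realType}.
Notation mu := (@lebesgue_measure R).
Variables (w : R -> R) (u v : R).
Hypothesis uv : u < v.
Hypothesis ndw : {in `[u, v] &, nondecreasing_fun w}.
Hypothesis acw : forall e : R, 0 < e -> exists2 d, 0 < d &
  forall s, small_itvs u v d s -> \sum_(p <- s) (w p.2 - w p.1) <= e.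

(** The projection onto [[u, v]]. It extends [w] by constants to a monotone function on the whole
    line, as a cumulative function must be; being 1-Lipschitz, it preserves the smallness of
    increments. *)
Let clamp x := Num.min v (Num.max u x).

Let clamp_itv x : clamp x \in `[u, v].
Proof. by rewrite in_itv/= /clamp le_min ge_min le_max (ltW uv) !lexx. Qed.

Let clamp_id x : x \in `[u, v] -> clamp x = x.
Proof.
by rewrite in_itv/= /clamp => /andP[ux xv]; rewrite (max_idPr ux) (min_idPr xv).
Qed.

Let clamp_le x y : x <= y -> clamp x <= clamp y.
Proof. by move=> xy; rewrite /clamp /Num.min /Num.max; do ?case: ifPn; rewrite -?leNgt; move: uv xy; lra. Qed.

Let clamp_dist x y : x <= y -> clamp y - clamp x <= y - x.
Proof.
by rewrite /clamp /Num.min /Num.max; do ?case: ifPn; rewrite -?leNgt; move: uv; lra.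
Qed.

(* The Lebesgue-Stieltjes measure of [W] is dominated by the Lebesgue measure, so
   that Radon-Nikodym applies. *)
Let W := w \o clamp.

Let ndW : {homo W : x y / x <= y}.
Proof. by move=> x y xy; apply: ndw; rewrite ?clamp_itv// clamp_le. Qed.

Let W_small (e : R) : 0 < e -> exists2 d : R, 0 < d &
  forall x y, x <= y -> y - x < d -> W y - W x <= e.
Proof.
move=> e0; have [d d0 H] := acw e0; exists d => // x y xy yxd.
have := H [:: (clamp x, clamp y)]; rewrite big_seq1/=; apply; split => //=.
  have := clamp_itv x; have := clamp_itv y; rewrite !in_itv/= andbT.
  by move=> /andP[_ ->] /andP[-> _]; rewrite clamp_le.
by rewrite big_seq1/= (le_lt_trans (clamp_dist xy)).
Qed.

Let cW : continuous W.
Proof.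
move=> x; apply/cvgrPdist_le => e e0; have [d d0 H] := W_small e0.
apply/nbhs_ballP; exists d => //= y; rewrite /ball/= => xyd; have [xy|/ltW yx] := leP x y.
  rewrite distrC ger0_norm ?subr_ge0 ?ndW//; apply: H => //.
  by rewrite -[ltLHS]ger0_norm ?subr_ge0// distrC.
rewrite ger0_norm ?subr_ge0 ?ndW//; apply: H => //.
by rewrite -[ltLHS]ger0_norm ?subr_ge0.
Qed.

Let W' : cumulative R R :=
  HB.pack W (isCumulative.Build R _ R W ndW (right_continuousW cW)).

Let lsW := lebesgue_stieltjes_measure W'.

Let lsW_oc x y : x <= y -> lsW `]x, y] = (W y - W x)%:E.
Proof.
move=> xy; rewrite /lsW /lebesgue_stieltjes_measure /measure_extension.
by rewrite measurable_mu_extE/= ?wlength_itv_bnd//; exact: is_ocitv.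
Qed.

(** Enlarging the interval to the left by [d / 2] costs at most [e]: the measure has no atoms. *)
Let lsW_cc x y : x <= y -> (lsW `[x, y] <= (W y - W x)%:E)%E.
Proof.
move=> xy; apply/lee_addgt0Pr => e e0; have [d d0 H] := W_small e0.
apply: (@le_trans _ _ (lsW `]x - d / 2, y])).
  apply: le_measure; rewrite ?inE//; apply: subset_itvr; rewrite bnd_simp.
  by rewrite ltrBlDr ltrDl divr_gt0.
rewrite lsW_oc; last by rewrite (le_trans _ xy)// lerBlDr lerDl divr_ge0 ?ltW.
rewrite -EFinD lee_fin.
have : W x - W (x - d / 2) <= e by apply: H; move: d0; lra.
lra.
Qed.

Let nu_fin : (lsW `]u, v] < +oo)%E.
Proof. by rewrite lsW_oc ?ltry// ltW. Qed.

Let muv : measurable (`]u, v]%classic : set (measurableTypeR R)). Proof. exact: measurable_itv. Qed.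

Let nu : {finite_measure set _ -> \bar R} := mfrestr muv nu_fin.

Let nuE A : nu A = lsW (A `&` `]u, v]). Proof. by []. Qed.

(** The components of an open set may leave []u, v]]; absolute continuity is applied to the
    endpoints of their traces. *)
Let hull_bounds (I : set R) : is_interval I -> I `&` `]u, v] !=set0 ->
  let i := inf (I `&` `]u, v]) in let s := sup (I `&` `]u, v]) in
  [/\ u <= i, i <= s, s <= v, `]i, s[ `<=` I & I `&` `]u, v] `<=` `[i, s]].
Proof.
move=> itvI; set J := I `&` _ => J0 /=.
have lbJ : lbound J u by move=> x [_]; rewrite /= in_itv/= => /andP[/ltW].
have ubJ : ubound J v by move=> x [_]; rewrite /= in_itv/= => /andP[].
have hlJ : has_lbound J by exists u.
have huJ : has_ubound J by exists v.
have itvJ : is_interval J.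
  move=> x y [Ix xuv] [Iy yuv] z xzy; split; first exact: itvI Ix Iy _ xzy.
  exact: (@interval_is_interval _ `]u, v]) xuv yuv _ xzy.
split.
- exact: lb_le_inf.
- by have [x Jx] := J0; apply: (@le_trans _ _ x); [exact: ge_inf|exact: ub_le_sup].
- exact: ge_sup.
- rewrite -interval_bounded_interior//.
  by move=> x /interior_subset [].
- move=> x Jx; rewrite /= in_itv/=; apply/andP; split; first exact: ge_inf.
  exact: ub_le_sup.
Qed.

Let nu_hull (I : set R) : open I -> is_interval I ->
  (nu I <= (w (sup (I `&` `]u, v])) - w (inf (I `&` `]u, v])))%:E)%E.
Proof.
move=> oI itvI; rewrite nuE.
(* [inf] and [sup] of the empty set are both 0, so an empty trace contributes 0. *)
have [->|/set0P/(hull_bounds itvI)/=] := eqVneq (I `&` `]u, v]) set0.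
  by rewrite inf0 sup0 subrr; have -> : lsW set0 = 0%E by exact: measure0.
set i := inf _; set s := sup _ => -[ui is_ sv _ sub].
apply: (@le_trans _ _ (lsW `[i, s])).
  apply: le_measure; rewrite ?inE//; apply: measurableI => //.
  exact: open_measurable.
apply: le_trans (lsW_cc is_) _.
have iuv : i \in `[u, v] by rewrite in_itv/= ui (le_trans is_ sv).
have suv : s \in `[u, v] by rewrite in_itv/= sv (le_trans ui is_).
by rewrite /W/= !clamp_id.
Qed.

(** An open set is a countable disjoint union of open intervals. The nondegenerate hulls of finitely
    many of them form a family to which [acw] applies, so all partial sums of their [nu]-measures
    are bounded by the same [e]. *)
Let nu_open (e : R) : 0 < e -> exists2 d : R, 0 < d &
  forall U, open U -> (mu U < d%:E)%E -> (nu U <= e%:E)%E.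
Proof.
move=> e0; have [d d0 H] := acw e0; exists d => // U oU Ud.
pose I := open_disjoint_itv oU.
have oI j : open (I j) by exact: open_disjoint_itv_open.
have itvI j : is_interval (I j) by exact: open_disjoint_itv_is_interval.
have trivI : trivIset setT I by exact: open_disjoint_itv_trivIset.
have mI j : measurable (I j) by exact: open_measurable.
have UE : U = \bigcup_j I j by exact: open_disjoint_itv_bigcup.
have sumI (m : {measure set (measurableTypeR R) -> \bar R}) :
    m U = (\sum_(0 <= j <oo) m (I j))%E.
  rewrite UE; apply/esym/cvg_lim => //.
  by apply: measure_semi_sigma_additive => //; exact: bigcupT_measurable.
pose J j := I j `&` `]u, v].
have HJ j : J j !=set0 -> _ := hull_bounds (itvI j).
pose hull j := (inf (J j), sup (J j)).
have J_neq0 j : inf (J j) < sup (J j) -> J j !=set0.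
  by move=> h; apply/set0P/eqP => J0; move: h; rewrite J0 inf0 sup0 ltxx.
have nu_n n : (\sum_(0 <= j < n) nu (I j) <= e%:E)%E.
  apply: (@le_trans _ _ (\sum_(0 <= j < n) (w (sup (J j)) - w (inf (J j)))%:E)%E).
    by apply: lee_sum => j _; exact: nu_hull.
  rewrite sumEFin lee_fin (bigID (fun j => inf (J j) < sup (J j)))/=.
  rewrite [X in _ + X]big1 ?addr0; last first.
    move=> j; rewrite -leNgt => sJiJ; have [->|/set0P/HJ/=[_ iJsJ _ _ _]] := eqVneq (J j) set0.
      by rewrite inf0 sup0 subrr.
    by rewrite (_ : inf (J j) = sup (J j)) ?subrr//; apply/eqP; rewrite eq_le iJsJ sJiJ.
  rewrite -big_filter.
  pose s := [seq hull j | j <- [seq j <- index_iota 0 n | inf (J j) < sup (J j)]].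
  have := H s; rewrite /s big_map/=; apply; split.
  - apply/allP => p /mapP[j]; rewrite mem_filter => /andP[/J_neq0/HJ/=].
    by move=> [ui is_ sv _ _] _ -> /=; rewrite ui is_ sv.
  - rewrite pairwise_map.
    have : uniq [seq j <- index_iota 0 n | inf (J j) < sup (J j)].
      by rewrite filter_uniq// iota_uniq.
    have : all (fun j => inf (J j) < sup (J j)) [seq j <- index_iota 0 n | inf (J j) < sup (J j)].
      exact: filter_all.
    move: [seq j <- index_iota 0 n | inf (J j) < sup (J j)] => l0.
    elim: l0 => //= j l ih /andP[jl al] /andP[jnl ul].
    rewrite ih// andbT; apply/allP => k kl; rewrite /itv_apart/=.
    have kk := allP al _ kl.
    apply/negPn/negP; rewrite negb_or -!ltNge => /andP[h1 h2].
    have [_ _ _ sj _] := HJ j (J_neq0 _ jl); have [_ _ _ sk _] := HJ k (J_neq0 _ kk).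
    (* The midpoint of an overlap of two hulls would lie in both components, against
       disjointness. *)
    have lt_m : Num.max (inf (J j)) (inf (J k)) < Num.min (sup (J j)) (sup (J k)).
      by rewrite gt_max !lt_min jl kk h1 h2.
    set m := Num.max _ _ in lt_m; set M := Num.min _ _ in lt_m.
    have : (I j `&` I k) ((m + M) / 2).
      split; [apply: sj|apply: sk] => /=; rewrite in_itv/=.
        have : inf (J j) <= m by rewrite le_max lexx.
        have : M <= sup (J j) by rewrite ge_min lexx.
        by move: lt_m => ? ? ?; apply/andP; split; lra.
      have : inf (J k) <= m by rewrite le_max lexx orbT.
      have : M <= sup (J k) by rewrite ge_min lexx orbT.
      by move: lt_m => ? ? ?; apply/andP; split; lra.
    move=> Ijk; have jk : j = k by apply: (trivI j k) => //; eexists; exact: Ijk.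
    by move: jnl; rewrite jk kl.
  - rewrite big_map/= -lte_fin -sumEFin big_filter.
    apply: le_lt_trans Ud.
    rewrite sumI.
    apply: (@le_trans _ _ (\sum_(0 <= j < n) mu (I j))%E); last first.
      by apply: nneseries_lim_ge => j _ _; exact: measure_ge0.
    rewrite big_mkcond/=; apply: lee_sum => j _; case: ifPn => // ij.
    have [_ is_ _ sj _] := HJ j (J_neq0 _ ij).
    apply: (@le_trans _ _ (mu `]inf (J j), sup (J j)[)); last first.
      by apply: le_measure; rewrite ?inE//; exact: mI.
    by rewrite lebesgue_measure_itv/= lte_fin ij EFinB.
rewrite sumI.
apply: lime_le; last exact: nearW.
by apply: is_cvg_nneseries => j _ _; exact: measure_ge0.
Qed.

(** Outer regularity encloses a null set in an open set of measure below the [d] of [nu_open]. *)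
Let nu_dom : nu `<< mu.
Proof.
apply/null_content_dominatesP => A mA muA0; apply/eqP; rewrite eq_le measure_ge0 andbT.
apply/lee_addgt0Pr => e e0; rewrite add0e.
have [d d0 H] := nu_open e0.
have [|U [oU AU UA]] := @lebesgue_regularity_outer R A d mA _ d0.
  by rewrite muA0.
apply: (@le_trans _ _ (nu U)).
  by apply: le_measure; rewrite ?inE//; exact: open_measurable.
apply: H => //.
have mU : measurable U by exact: open_measurable.
have -> : mu U = mu (U `\` A) + mu A :> \bar R.
  rewrite -[in LHS](setDKU AU) measureU//; [exact: measurableD|].
  by rewrite setDKI.
by rewrite muA0 adde0.
Qed.

Lemma nondecreasing_density : exists r : R -> R, mu.-integrable setT (EFin \o r) /\
  forall x, u <= x <= v -> w x - w u = \int[mu]_(t in `]u, x]) r t.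
Proof.
have [f [f0 ffin intf fE]] := radon_nikodym_sigma_finite nu_dom.
have fEF : EFin \o (fine \o f) = f by apply/funext => x /=; rewrite fineK.
exists (fine \o f); split; first by rewrite fEF.
move=> x /andP[ux xv]; rewrite /Rintegral.
have -> : (fun t => ((fine \o f) t)%:E) = f by [].
rewrite -fE// nuE.
have -> : `]u, x] `&` `]u, v] = `]u, x]%classic.
  apply/setIidl; apply: subset_itvl; rewrite bnd_simp//.
by rewrite lsW_oc//= /W/= !clamp_id// ?in_itv/= ?ux ?xv ?lexx ?(ltW uv).
Qed.

End monotone_density.

Section abs_continuous_FTC.
Context {R : realType}.
Notation mu := (@lebesgue_measure R).
Implicit Types (g : R -> R) (u v : R).

(* [g] is the difference of its total variation on [u, x] and of a nondecreasing
   function, both absolutely continuous. *)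
Lemma abs_continuous_density g u v : u < v -> abs_continuous_on u v g ->
  exists r : R -> R, mu.-integrable setT (EFin \o r) /\
    forall x, u <= x <= v -> g x - g u = \int[mu]_(t in `]u, x]) r t.
Proof.
move=> uv acg.
have bvg : bounded_variation u v g by apply: abs_continuous_bounded_variation (ltW uv) acg.
pose V x := fine (total_variation u x g).
have finTV x y : u <= x -> x <= y -> y <= v -> total_variation x y g \is a fin_num.
  move=> ux xy yv; apply/bounded_variationP => //.
  apply: (bounded_variationl xy yv); apply: (bounded_variationr ux) => //.
  exact: le_trans xy yv.
have VB x y : u <= x -> x <= y -> y <= v -> V y - V x = fine (total_variation x y g).
  move=> ux xy yv; rewrite /V (total_variationD g ux xy) fineD ?finTV//.
    by rewrite addrAC subrr add0r.
  exact: le_trans xy yv.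
have gV x y : u <= x -> x <= y -> y <= v -> `|g y - g x| <= V y - V x.
  move=> ux xy yv; rewrite VB// -lee_fin fineK ?finTV//; exact: total_variation_ge.
have ndV : {in `[u, v] &, nondecreasing_fun V}.
  move=> x y; rewrite !in_itv/= => /andP[ux _] /andP[_ yv] xy.
  by rewrite -subr_ge0; exact: le_trans (gV _ _ ux xy yv).
have smallV (e : R) : 0 < e -> exists2 d : R, 0 < d &
    forall s, small_itvs u v d s -> \sum_(p <- s) (V p.2 - V p.1) <= e.
  move=> e0; have [d d0 H] := abs_continuous_total_variation acg e0.
  exists d => // s ss; rewrite -lee_fin; apply: le_trans (H s ss).
  rewrite -sumEFin big_seq [leRHS]big_seq; apply: lee_sum => p ps.
  have [/allP /(_ p ps) /andP[/andP[up pp] pv] _ _] := ss.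
  by rewrite VB// fineK ?finTV.
have [r1 [ir1 r1E]] := nondecreasing_density uv ndV smallV.
(* Since [gV] bounds the increments of [g] by those of [V], an increment of [w] lies between 0 and
   twice that of [V]; so [w] is monotone and inherits the smallness. *)
pose w x := V x - g x.
have wV x y : u <= x -> x <= y -> y <= v -> 0 <= w y - w x <= 2 * (V y - V x).
  move=> ux xy yv; have := gV _ _ ux xy yv; rewrite ler_norml /w => /andP[h1 h2].
  by apply/andP; split; lra.
have ndw : {in `[u, v] &, nondecreasing_fun w}.
  move=> x y; rewrite !in_itv/= => /andP[ux _] /andP[_ yv] xy.
  by rewrite -subr_ge0; have /andP[] := wV _ _ ux xy yv.
have smallw (e : R) : 0 < e -> exists2 d : R, 0 < d &
    forall s, small_itvs u v d s -> \sum_(p <- s) (w p.2 - w p.1) <= e.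
  move=> e0; have [|d d0 H] := smallV (e / 2); first by rewrite divr_gt0.
  exists d => // s ss.
  have : \sum_(p <- s) (w p.2 - w p.1) <= \sum_(p <- s) 2 * (V p.2 - V p.1).
    rewrite big_seq [leRHS]big_seq; apply: ler_sum => p ps.
    have [/allP /(_ p ps) /andP[/andP[up pp] pv] _ _] := ss.
    by have /andP[] := wV _ _ up pp pv.
  rewrite -mulr_sumr; have := H s ss; lra.
have [r2 [ir2 r2E]] := nondecreasing_density uv ndw smallw.
exists (r1 \- r2); split; first exact: (integrableB _ ir1 ir2).
move=> x /[dup] uxv /andP[ux xv].
rewrite RintegralB//; [|exact: integrableS ir1|exact: integrableS ir2].
by rewrite -r1E// -r2E// /w; ring.
Qed.

(** The density of [g] equals [derive1 g] almost everywhere by Lebesgue differentiation.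
    Measurability of [derive1 g] is assumed because measurable sets are Borel sets here, and almost
    everywhere equality with a measurable function does not give it; for [L2space] it comes from
    membership in [Lfun]. *)
Lemma loc_abs_continuous_FTC g u v : u <= v -> loc_abs_continuous g ->
  measurable_fun setT (derive1 g) ->
  mu.-integrable `[u, v] (EFin \o derive1 g) /\
  g v - g u = \int[mu]_(t in `[u, v]) derive1 g t.
Proof.
(* The margin 1 makes all points of [[u, v]] interior to the interval of the density, as two-sided
   derivatives demand. *)
move=> uv lacg mg; have uv1 : u - 1 < v + 1 by lra.
have [r [ir rE]] := abs_continuous_density uv1 (lacg _ _ uv1).
have mr : measurable_fun setT r by case/integrableP : ir => /measurable_EFinP.
have locr : locally_integrable [set: R] r by exact: open_integrable_locally openT ir.
have intr y : mu.-integrable [set` Interval (BRight (u - 1)) (BRight y)] (EFin \o r).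
  by apply: integrableS ir.
have aeg : {ae mu, forall x, `]u - 1, v]%classic x -> (EFin \o derive1 g) x = (EFin \o r) x}.
  have := FTC1 intr locr; apply: (@filterS _ _ (ae_filter_ringOfSetsType mu)) => x + /= xuv.
  move: (xuv); rewrite in_itv/= => /andP[ux xv] /(_ ux)[dF F'].
  congr EFin; rewrite -F' !derive1E.
  set F := fun y => _ in dF F' *.
  have isF : is_derive x 1 F ('D_1 F x) by exact/derivableP.
  have isG : is_derive x 1 (F \+ cst (g (u - 1))) ('D_1 F x + 0).
    by apply: is_deriveD; exact: is_derive_cst.
  have := @near_eq_is_derive _ _ _ (F \+ cst (g (u - 1))) g x 1 _ _ isG.
  case; last by move=> _ ->; rewrite addr0.
  near=> y; rewrite /= /F -rE ?subrK//; apply/andP; split.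
    by near: y; exact: lt_le_nbhsr.
  by near: y; apply: lt_le_nbhsl; rewrite (le_lt_trans xv)// ltrDl.
have mgi (i : interval R) : measurable_fun [set` i] (EFin \o derive1 g).
  by apply/measurable_EFinP; exact: measurable_funS mg.
have mri (i : interval R) : measurable_fun [set` i] (EFin \o r).
  by apply/measurable_EFinP; exact: measurable_funS mr.
have ig : mu.-integrable `]u - 1, v] (EFin \o derive1 g).
  apply/integrableP; split; first exact: mgi.
  have /integrableP[_ h] := intr v; apply: le_lt_trans h.
  rewrite le_eqVlt; apply/orP; left; apply/eqP; apply: ae_eq_integral => //.
  - by apply: measurableT_comp => //; exact: mgi.
  - by apply: measurableT_comp => //; exact: mri.
  - by move: aeg; apply: (@filterS _ _ (ae_filter_ringOfSetsType mu)) => x /= + xuv => /(_ xuv) [->].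
have sub1 : `[u, v] `<=` `]u - 1, v] by apply: subset_itvr; rewrite bnd_simp; lra.
have sub2 : `]u, v] `<=` `]u - 1, v] by apply: subset_itvr; rewrite bnd_simp; lra.
split; first exact: integrableS ig.
rewrite -Rintegral_itv_obnd_cbnd; last exact: integrableS ig.
rewrite (_ : g v - g u = (g v - g (u - 1)) - (g u - g (u - 1))); last by ring.
rewrite !rE; [|by apply/andP; split; lra..].
rewrite Rintegral_itvB ?bnd_simp; [|exact: intr|lra|lra].
rewrite /Rintegral; congr fine; apply: ae_eq_integral; [by []|exact: mri|exact: mgi|].
by move: aeg; apply: (@filterS _ _ (ae_filter_ringOfSetsType mu)) => x /= H /sub2 /H ->.
Unshelve. all: by end_near. Qed.

End abs_continuous_FTC.

(** * Integral calculus *)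

Section affine_change_of_variables.
Context {R : realType}.
Notation mu := (@lebesgue_measure R).
Variables (x h : R).
Hypothesis h0 : 0 < h.

Let aff (t : R) : measurableTypeR R := x + h * t.

Let maff : measurable_fun [set: R] aff.
Proof. by apply: continuous_measurable_fun => t; apply: cvgD; [exact: cvg_cst|exact: mulrl_continuous]. Qed.

Let hnng : {nonneg R} := NngNum (ltW h0).

Let image_measure : {measure set (measurableTypeR R) -> \bar R} :=
  @measure_function_pushforward__canonical__measure_function_Measure _ _ _ _ _ mu aff maff.

(** The two measures agree on half-open intervals, which determine Lebesgue measure. *)
Let scaled_measure (A : set R) : measurable A -> mscale hnng image_measure A = mu A.
Proof.
move=> mA; apply/esym/lebesgue_measure_unique => //= _ [[a b]] _ <-.
rewrite /mscale/= /image_measure/= /pushforward.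
have -> : aff @^-1` `]a, b] = `](a - x) / h, (b - x) / h]%classic.
  apply/seteqP; split => t /=; rewrite !in_itv/= /aff ltr_pdivrMr// ler_pdivlMr//;
    move=> /andP[t1 t2]; apply/andP; split; lra.
rewrite !lebesgue_measure_itv/= !lte_fin ltr_pM2r ?invr_gt0// ltrD2r.
case: ifPn => _; last by rewrite mule0.
rewrite -!EFinB -EFinM; congr EFin; rewrite -mulrBl mulrC divfK ?gt_eqF//.
by rewrite opprB addrA subrK.
Qed.

Lemma ge0_integral_affine (D : set R) (f : R -> \bar R) : measurable D ->
  measurable_fun D f -> {in D, forall y, (0 <= f y)%E} ->
  (\int[mu]_(t in (fun t => x + h * t)%R @^-1` D) f (x + h * t)%R =
   (h^-1)%:E * \int[mu]_(y in D) f y)%E.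
Proof.
move=> mD mf f0.
have <- := @ge0_integral_pushforward _ _ (measurableTypeR R) (measurableTypeR R) R
  aff maff lebesgue_measure D f mD mf f0.
rewrite [in RHS](eq_measure_integral (mscale hnng image_measure)); last first.
  by move=> A mA _; apply/esym; exact: scaled_measure.
rewrite ge0_integral_mscale//=; last by move=> y Dy; apply: f0; rewrite inE.
by rewrite muleA -EFinM mulVf ?gt_eqF// mul1e.
Qed.

Lemma integrable_affine (D : set R) (f : R -> \bar R) : measurable D ->
  mu.-integrable D f ->
  mu.-integrable ((fun t => x + h * t) @^-1` D) (fun t => f (x + h * t)).
Proof.
move=> mD /integrableP[mf intf]; apply/integrableP; split.
  apply: (measurable_comp mD) => //; first by move=> _ [t tD <-].
  exact: measurable_funS maff.
rewrite (@ge0_integral_affine D (abse \o f))//=; last exact: measurableT_comp.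
by rewrite lte_mul_pinfty// lee_fin invr_ge0 ltW.
Qed.

Lemma integral_affine (D : set R) (f : R -> \bar R) : measurable D ->
  mu.-integrable D f ->
  (\int[mu]_(t in (fun t => x + h * t)%R @^-1` D) f (x + h * t)%R =
   (h^-1)%:E * \int[mu]_(y in D) f y)%E.
Proof.
move=> mD /[dup] intf /integrableP[mf _]; rewrite integralE.
have ep := ge0_integral_affine mD (measurable_funepos mf) (fun y _ => funepos_ge0 f y).
have en := ge0_integral_affine mD (measurable_funeneg mf) (fun y _ => funeneg_ge0 f y).
transitivity (((h^-1)%:E * \int[mu]_(y in D) f^\+ y)%E - ((h^-1)%:E * \int[mu]_(y in D) f^\- y)%E)%E.
  by rewrite -ep -en (funepos_comp f aff) (funeneg_comp f aff).
by rewrite [X in _ = (_ * X)%E]integralE [RHS]muleBr//; exact: integrable_add_def.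
Qed.

Lemma Rintegral_affine (D : set R) (f : R -> R) : measurable D ->
  mu.-integrable D (EFin \o f) ->
  \int[mu]_(t in (fun t => x + h * t) @^-1` D) f (x + h * t) =
   h^-1 * \int[mu]_(y in D) f y.
Proof.
move=> mD intf; rewrite /Rintegral.
rewrite (@integral_affine D (EFin \o f))// fineM//.
exact: integrable_fin_num.
Qed.

Lemma preimage_affine_itv b1 b2 (y z : R) :
  (fun t => x + h * t) @^-1` [set` Interval (BSide b1 y) (BSide b2 z)] =
  [set` Interval (BSide b1 ((y - x) / h)) (BSide b2 ((z - x) / h))].
Proof.
apply/seteqP; split => t /=; rewrite !in_itv/=; case: b1; case: b2 => /=;
  by rewrite ?(ltr_pdivrMr _ _ h0) ?(ler_pdivlMr _ _ h0) ?(ler_pdivrMr _ _ h0)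
    ?(ltr_pdivlMr _ _ h0) (mulrC t) ?ltrBlDl ?lerBlDl ?ltrBrDl ?lerBrDl.
Qed.

End affine_change_of_variables.

(** * Exchange of integrals over a triangle, with a weight singular at one end *)

Section triangular_Fubini.
Context {R : realType}.
Notation mu := (@lebesgue_measure R).
Variables (c d : R) (h w : R -> R).
Hypotheses (mh : measurable_fun setT h) (mw : measurable_fun setT w).
Hypothesis ih : mu.-integrable `]c, d] (EFin \o h).
Hypothesis iw : forall u, c < u <= d -> mu.-integrable `[u, d] (EFin \o w).
Hypothesis ihw : mu.-integrable `]c, d]
  (fun u => (h u * \int[mu]_(t in `[u, d]) `|w t|)%:E).

Let A : set (R * R) := [set z | c < z.1 /\ z.1 <= z.2 /\ z.2 <= d].

Let F (z : R * R) : \bar R := (h z.1 * w z.2 * \1_A z)%:E.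

Let mA : measurable A.
Proof.
have -> : A = (fst @^-1` `]c, +oo[) `&` ((fun z => z.2 - z.1) @^-1` `[0, +oo[) `&`
    (snd @^-1` `]-oo, d]).
  apply/seteqP; split => z; rewrite /A/= !in_itv/= !andbT subr_ge0.
    by move=> [? [? ?]].
  by move=> [[? ?] ?].
apply: measurableI; first apply: measurableI.
- by rewrite -[X in measurable X]setTI; exact: measurable_fst.
- by rewrite -[X in measurable X]setTI; apply: measurable_funB.
- by rewrite -[X in measurable X]setTI; exact: measurable_snd.
Qed.

Let mF : measurable_fun setT F.
Proof.
apply/measurable_EFinP; apply: measurable_funM.
  by apply: measurable_funM; apply: measurableT_comp.
exact: measurable_indic.
Qed.

Let A_row u t : \1_A (u, t) = \1_(`]c, d]) u * \1_(`[u, d]) t :> R.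
Proof.
rewrite !indicE -natrM mulnb; congr ((nat_of_bool _)%:R).
apply/idP/andP; rewrite !inE /A/= !in_itv/=.
  by move=> [cu [ut td]]; rewrite cu ut td (le_trans ut td).
by move=> [/andP[-> _] /andP[-> ->]].
Qed.

Let A_col u t : \1_A (u, t) = \1_(`]c, d]) t * \1_(`]c, t]) u :> R.
Proof.
rewrite !indicE -natrM mulnb; congr ((nat_of_bool _)%:R).
apply/idP/andP; rewrite !inE /A/= !in_itv/=.
  by move=> [cu [ut td]]; rewrite cu ut td (lt_le_trans cu ut).
by move=> [/andP[_ ->] /andP[-> ->]].
Qed.

Let integral_cond (D : set R) (x : R) (g : R -> R) :
  (\int[mu]_t ((x * g t * \1_D t)%R%:E) = \int[mu]_(t in D) (x * g t)%R%:E)%E.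
Proof.
rewrite [RHS]integral_mkcond; apply: eq_integral => t _.
by rewrite patchE indicE; case: ifPn => _; rewrite ?mulr1 ?mulr0.
Qed.

Let F_row u : (\int[mu]_t F (u, t) =
  ((fun u => (h u * (\int[mu]_(t in `[u, d]) w t)%R)%R%:E) \_ `]c, d]) u)%E.
Proof.
rewrite patchE; case: ifPn => ud; last first.
  apply: integral0_eq => t _; rewrite /F/= A_row indicE (negbTE ud).
  by rewrite mul0r mulr0.
transitivity (\int[mu]_t ((h u * w t * \1_(`[u, d]) t)%R%:E))%E.
  by apply: eq_integral => t _; rewrite /F/= A_row indicE ud mul1r.
have iwu : mu.-integrable `[u, d] (EFin \o w).
  by apply: iw; move: ud; rewrite inE/= in_itv.
rewrite integral_cond; under eq_integral do rewrite EFinM.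
rewrite integralZl// EFinM /Rintegral fineK//; exact: integrable_fin_num.
Qed.

Let F_row_norm u : (\int[mu]_t `|F (u, t)| =
  ((fun u => (`|h u| * (\int[mu]_(t in `[u, d]) `|w t|)%R)%R%:E) \_ `]c, d]) u)%E.
Proof.
rewrite patchE; case: ifPn => ud; last first.
  apply: integral0_eq => t _; rewrite /F/= A_row indicE (negbTE ud).
  by rewrite mul0r mulr0 normr0.
transitivity (\int[mu]_t ((`|h u| * `|w t| * \1_(`[u, d]) t)%R%:E))%E.
  apply: eq_integral => t _; rewrite /F/= A_row indicE ud mul1r.
  by rewrite !normrM [X in _ * X]ger0_norm.
have iwu : mu.-integrable `[u, d] (EFin \o (fun t => `|w t|)).
  by apply: (integrable_norm (iw _)); move: ud; rewrite inE/= in_itv.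
rewrite integral_cond; under eq_integral do rewrite EFinM.
rewrite integralZl// EFinM /Rintegral fineK//; exact: integrable_fin_num.
Qed.

Let F_col t : (\int[mu]_u F (u, t) =
  ((fun t => (w t * (\int[mu]_(u in `]c, t]) h u)%R)%R%:E) \_ `]c, d]) t)%E.
Proof.
rewrite patchE; case: ifPn => td; last first.
  apply: integral0_eq => u _; rewrite /F/= A_col indicE (negbTE td).
  by rewrite mul0r mulr0.
transitivity (\int[mu]_u ((w t * h u * \1_(`]c, t]) u)%R%:E))%E.
  apply: eq_integral => u _; rewrite /F/= A_col indicE td mul1r.
  by rewrite [h u * _]mulrC.
have iht : mu.-integrable `]c, t] (EFin \o h).
  apply: integrableS ih => //; apply: subset_itvl.
  by move: td; rewrite inE/= in_itv/= bnd_simp => /andP[].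
rewrite integral_cond; under eq_integral do rewrite EFinM.
rewrite integralZl// EFinM /Rintegral fineK//; exact: integrable_fin_num.
Qed.

Let iF : (mu \x mu)%E.-integrable setT F.
Proof.
apply/integrable12ltyP => //.
under eq_integral do rewrite F_row_norm.
rewrite -integral_mkcond.
have /integrableP[_] := ihw; apply: le_lt_trans.
rewrite le_eqVlt; apply/orP; left; apply/eqP; apply: eq_integral => u _ /=.
congr EFin; rewrite normrM; congr (_ * _); rewrite ger0_norm//.
exact: Rintegral_ge0.
Qed.

(** [w] may be singular at [c]: it is integrable only on [[u, d]] with [c < u], and [ihw] supplies
    Tonelli's condition. The weights used are powers of [t] at [c = 0], and the constant 1 for
    Taylor's formula. *)
Lemma triangular_Fubini :
  \int[mu]_(t in `]c, d]) (w t * \int[mu]_(u in `]c, t]) h u) =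
  \int[mu]_(u in `]c, d]) (h u * \int[mu]_(t in `[u, d]) w t).
Proof.
rewrite /Rintegral; congr fine; rewrite integral_mkcond [RHS]integral_mkcond.
transitivity (\int[mu]_t \int[mu]_u F (u, t))%E.
  by apply: eq_integral => t _; exact/esym/F_col.
by rewrite -(Fubini iF); apply: eq_integral => u _; exact: F_row.
Qed.

Lemma triangular_integrable :
  mu.-integrable `]c, d] (fun t => (w t * \int[mu]_(u in `]c, t]) h u)%:E).
Proof.
apply/(integrable_mkcond _ _) => //.
have mG := measurable_fubini_G iF.
have GE : fubini_G mu F = (fun t => (w t * \int[mu]_(u in `]c, t]) h u)%:E) \_ `]c, d].
  by apply/funext => t; rewrite /fubini_G F_col.
rewrite -GE; apply/integrableP; split => //.
have := iF; rewrite integrable21ltyP//; apply: le_lt_trans.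
apply: ge0_le_integral => //.
- exact: measurableT_comp.
- apply: (@measurable_fun_fubini_tonelli_G _ _ _ _ _ mu (abse \o F)).
    exact: measurableT_comp.
  by move=> z; exact: abse_ge0.
- move=> t _; apply: le_abse_integral => //.
  by apply: measurableT_comp => //; exact: pair2_measurable.
Qed.

End triangular_Fubini.

(** * Integral remainder of Taylor's formula and integrals of powers *)

Section calculus.
Context {R : realType}.
Notation mu := (@lebesgue_measure R).
Implicit Types (f : R -> R) (c d k r : R).

Lemma integrable_cc_oc f c d : mu.-integrable `[c, d] (EFin \o f) ->
  mu.-integrable `]c, d] (EFin \o f).
Proof. by apply: integrableS => //; apply: subset_itvr; rewrite bnd_simp. Qed.

Lemma Rintegral_oc_cc f c d : mu.-integrable `]c, d] (EFin \o f) ->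
  \int[mu]_(t in `[c, d]) f t = \int[mu]_(t in `]c, d]) f t.
Proof. by move=> ?; rewrite Rintegral_itv_obnd_cbnd. Qed.

Lemma cvg_sides f x : {for x, continuous f} -> f @ x^'+ --> f x /\ f @ x^'- --> f x.
Proof. by move=> fx; split; apply: cvg_within_filter. Qed.

Lemma C1_FTC f (f1 : R -> R) c d : c <= d ->
  (forall x : R, c <= x <= d -> is_derive x 1 f (f1 x)) ->
  (forall x, c <= x <= d -> {for x, continuous f1}) ->
  [/\ mu.-integrable `]c, d] (EFin \o f1),
      mu.-integrable `[c, d] (EFin \o f1),
      \int[mu]_(t in `]c, d]) f1 t = f d - f c &
      \int[mu]_(t in `[c, d]) f1 t = f d - f c].
Proof.
rewrite le_eqVlt => /predU1P[<-{d} _ _|cd df cf1].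
  rewrite set_itvoc0 set_itv1 Rintegral_set0 Rintegral_set1 subrr; split => //.
    exact: integrable_set0.
  apply/integrableP; split; first exact: measurable_fun_set1.
  by rewrite integral_set1.
have cwf1 : {within `[c, d], continuous f1}.
  by apply: continuous_in_subspaceT => x; rewrite inE/= in_itv/=; exact: cf1.
have icd : mu.-integrable `[c, d] (EFin \o f1).
  by apply: continuous_compact_integrable => //; exact: segment_compact.
have ioc := integrable_cc_oc icd.
suff E : \int[mu]_(t in `[c, d]) f1 t = f d - f c by rewrite -Rintegral_oc_cc.
have cf x : c <= x <= d -> {for x, continuous f}.
  move=> /df ?; apply: differentiable_continuous; apply/derivable1_diffP.
  exact: ex_derive.
rewrite /Rintegral (continuous_FTC2 cd cwf1 (F := f)) //.
- split.
  + move=> x; rewrite in_itv/= => /andP[/ltW cx /ltW xd].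
    have ? : is_derive x 1 f (f1 x) by apply: df; rewrite cx.
    exact: ex_derive.
  + by have [] := @cvg_sides f c (cf c _); rewrite ?lexx ?ltW.
  + by have [] := @cvg_sides f d (cf d _); rewrite ?lexx ?ltW.
- move=> x; rewrite in_itv/= => /andP[/ltW cx /ltW xd].
  have ? : is_derive x 1 f (f1 x) by apply: df; rewrite cx.
  by rewrite derive1E derive_val.
Qed.

(** The interface between [L2space] and the estimates. [f2] enters only through the increments of
    [f1], so exceptional values of a second derivative do not matter, and the class is closed under
    rescaling and subtraction. *)
Definition second_primitive f (f1 f2 : R -> R) :=
  [/\ forall x : R, is_derive x 1 f (f1 x), continuous f1, measurable_fun setT f2 &
      forall c d, c <= d -> mu.-integrable `]c, d] (EFin \o f2) /\
        f1 d - f1 c = \int[mu]_(t in `]c, d]) f2 t].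

(** Integrating [f1 t - f1 c], itself an integral of [f2], and exchanging the order with weight 1
    produces the factor [d - u]. *)
Lemma second_primitive_Taylor f (f1 f2 : R -> R) c d : second_primitive f f1 f2 -> c <= d ->
  mu.-integrable `]c, d] (fun u => ((d - u) * f2 u)%:E) /\
  f d - f c - (d - c) * f1 c = \int[mu]_(u in `]c, d]) ((d - u) * f2 u).
Proof.
move=> [df cf1 mf2 f12] cd; have [if2 _] := f12 c d cd.
have unit_int u : u <= d -> mu.-integrable `[u, d] (EFin \o (fun=> 1 : R)) /\
    \int[mu]_(t in `[u, d]) (1 : R) = d - u.
  move=> ud; have [|_ ? _ ?] := @C1_FTC id (fun=> 1) u d ud; last by split.
  by move=> x _; exact: cvg_cst.
have int1 u (ud : u <= d) : \int[mu]_(t in `[u, d]) (1 : R) = d - u := (unit_int u ud).2.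
have i1 u : c < u <= d -> mu.-integrable `[u, d] (EFin \o (fun=> 1 : R)).
  by move=> /andP[_ /unit_int[]].
have iw : mu.-integrable `]c, d] (fun u => ((d - u) * f2 u)%:E).
  have := @integrableMr _ _ _ mu `]c, d]%classic _ (fun u => d - u) (EFin \o f2).
  apply => //.
    apply: measurable_funB => //; exact: measurable_funS measurable_id.
  exists (d - c); split; first exact: num_real.
  move=> M dcM x /=; rewrite in_itv/= => /andP[cx xd].
  rewrite ger0_norm ?subr_ge0//; lra.
have eqw : {in `]c, d], (fun u => (f2 u * \int[mu]_(t in `[u, d]) `|1 : R|)%:E) =1
    (fun u => ((d - u) * f2 u)%:E)}.
  move=> u; rewrite in_itv/= => /andP[_ ud].
  by rewrite normr1 int1// mulrC.
split => //.
have iw' : mu.-integrable `]c, d]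
   (fun u => (f2 u * \int[mu]_(t in `[u, d]) `|1 : R|)%:E).
  by apply: eq_integrable iw => // u; rewrite inE/= => /eqw ->.
have := @triangular_Fubini R c d f2 (fun=> 1) mf2 (measurable_cst _) if2 i1 iw'.
move=> E; transitivity (\int[mu]_(u in `]c, d]) (f2 u * \int[mu]_(t in `[u, d]) (1 : R))).
  rewrite -E; transitivity (\int[mu]_(t in `]c, d]) (f1 t - f1 c)); last first.
    apply: eq_Rintegral => t; rewrite inE/= in_itv/= => /andP[/ltW ct _].
    by have [_ ->] := f12 c t ct; rewrite mul1r.
  have dfB (x : R) : c <= x <= d -> is_derive x 1 (fun t => f t - t * f1 c) (f1 x - f1 c).
    move=> _; have dfx := df x.
    have -> : (fun t => f t - t * f1 c) = f - id * cst (f1 c) by [].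
    by apply: is_derive_eq; rewrite /= scaler0 add0r /GRing.scale/= mulr1.
  have [|_ _ -> _] := @C1_FTC _ _ c d cd dfB; last by ring.
  by move=> x _; apply: cvgB; [exact: cf1|exact: cvg_cst].
apply: eq_Rintegral => u; rewrite inE/= in_itv/= => /andP[_ ud].
by rewrite int1// mulrC.
Qed.

Lemma is_derive_powR r (t : R) : 0 < t ->
  is_derive t 1 (fun t => t `^ r) (r * t `^ (r - 1)).
Proof.
move=> t0; have tI : t \in `]0, +oo[ by rewrite in_itv/= t0.
have D := @derivable_powR R 1 r _ tI.
by apply: DeriveDef => //; rewrite -derive1E powR_derive1.
Qed.

Lemma continuous_powR r (t : R) : 0 < t -> {for t, continuous (fun t => t `^ r)}.
Proof.
move=> t0; apply: differentiable_continuous; apply/derivable1_diffP.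
by have ? := is_derive_powR r t0; exact: ex_derive.
Qed.

Lemma integral_powR r (u v : R) : 0 < u -> u <= v -> r != 0 ->
  mu.-integrable `[u, v] (EFin \o (fun t => t `^ (r - 1))) /\
  \int[mu]_(t in `[u, v]) t `^ (r - 1) = (v `^ r - u `^ r) / r.
Proof.
move=> u0 uv r0.
have := @C1_FTC (fun t => t `^ r / r) (fun t => t `^ (r - 1)) u v uv.
case=> [x /andP[ux _]|x /andP[ux _]|_ ? _ ->]; last by rewrite mulrBl.
- have x0 := lt_le_trans u0 ux; have D := is_derive_powR r x0.
  have -> : (fun t => t `^ r / r) = (fun t => t `^ r) * cst r^-1 by [].
  by apply: is_derive_eq; rewrite /= scaler0 add0r /GRing.scale/= mulrA mulVf// mul1r.
- exact: continuous_powR (lt_le_trans u0 ux).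
Qed.

Lemma powR_cvgy0 r : 0 < r -> (fun t : R => t `^ (- r)) @ +oo --> (0 : R).
Proof.
move=> r0; apply/cvgrPdist_le => e e0; near=> t.
have t0 : 0 < t by near: t; exact: nbhs_pinfty_gt.
have te : e `^ (- r^-1) <= t by near: t; apply: nbhs_pinfty_ge; exact: num_real.
rewrite sub0r normrN ger0_norm ?powR_ge0// powRN -[leRHS]invrK lef_pV2 ?posrE ?invr_gt0 ?powR_gt0//.
have -> : e^-1 = (e `^ (- r^-1)) `^ r.
  by rewrite -powRrM mulNr mulVf ?gt_eqF// powR_inv1// ltW.
by apply: ge0_ler_powR; rewrite ?nnegrE ?powR_ge0// ltW.
Unshelve. all: by end_near. Qed.

Lemma integral_powRy r : 0 < r ->
  mu.-integrable `]1, +oo[ (EFin \o (fun t => t `^ (- r - 1))) /\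
  \int[mu]_(t in `]1, +oo[) t `^ (- r - 1) = r^-1.
Proof.
move=> r0; have Nr0 : - r != 0 by rewrite oppr_eq0 gt_eqF.
have D (x : R) : 1 <= x -> is_derive x 1 (fun t => t `^ (- r) / - r) (x `^ (- r - 1)).
  move=> x1; have x0 := lt_le_trans ltr01 x1; have D := is_derive_powR (- r) x0.
  have -> : (fun t => t `^ (- r) / - r) = (fun t => t `^ (- r)) * cst (- r)^-1 by [].
  by apply: is_derive_eq; rewrite /= scaler0 add0r /GRing.scale/= mulrA mulVf// mul1r.
have E : (\int[mu]_(t in `[1%R, +oo[) (t `^ (- r - 1))%:E = (r^-1)%:E)%E.
  rewrite (@ge0_continuous_FTC2y _ _ (fun t => t `^ (- r) / - r) 1 0).
  - by rewrite powR1 -EFinB sub0r mul1r invrN opprK.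
  - by move=> x _; exact: powR_ge0.
  - apply: continuous_in_subspaceT => x; rewrite inE/= in_itv/= andbT => x1.
    exact: continuous_powR (lt_le_trans ltr01 x1).
  - rewrite -[X in _ --> X](mul0r (- r)^-1); apply: cvgMl; exact: powR_cvgy0.
  - by move=> x /ltW /D ?; exact: ex_derive.
  - suff /cvg_sides[] : {for 1, continuous (fun t => t `^ (- r) / - r)} by [].
    apply: differentiable_continuous; apply/derivable1_diffP.
    by have ? := D 1 (lexx _); exact: ex_derive.
  - move=> x; rewrite in_itv/= andbT => /ltW /D ?.
    by rewrite derive1E derive_val.
have mp : measurable_fun setT (EFin \o (fun t : R => t `^ (- r - 1))).
  apply/measurable_EFinP; exact: measurable_powR.
have iy : mu.-integrable `[1, +oo[ (EFin \o (fun t => t `^ (- r - 1))).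
  apply/integrableP; split; first exact: measurable_funS mp.
  under eq_integral do rewrite /= ger0_norm ?powR_ge0//.
  by rewrite E ltry.
have iy' : mu.-integrable `]1, +oo[ (EFin \o (fun t => t `^ (- r - 1))).
  by apply: integrableS iy => //; apply: subset_itvr; rewrite bnd_simp.
split => //; rewrite /Rintegral integral_itv_obnd_cbnd ?E//.
exact: measurable_funS mp.
Qed.

End calculus.

Section linear_combinations.
Context {R : realType}.
Notation mu := (@lebesgue_measure R).

Lemma Rintegral_lin (D : set R) (f g : R -> R) (a b : R) : measurable D ->
  mu.-integrable D (EFin \o f) -> mu.-integrable D (EFin \o g) ->
  mu.-integrable D (fun x => (a * f x + b * g x)%:E) /\
  \int[mu]_(x in D) (a * f x + b * g x) =
    a * (\int[mu]_(x in D) f x) + b * (\int[mu]_(x in D) g x).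
Proof.
move=> mD intf intg.
have iaf : mu.-integrable D (fun x => (a * f x)%:E) by exact: integrableZl intf.
have ibg : mu.-integrable D (fun x => (b * g x)%:E) by exact: integrableZl intg.
split; first exact: (integrableD _ iaf ibg).
by rewrite RintegralD// !RintegralZl.
Qed.

Lemma eq_integrable_Rintegral (D : set R) (f g : R -> R) : measurable D ->
  {in D, f =1 g} -> mu.-integrable D (EFin \o f) ->
  mu.-integrable D (EFin \o g) /\ \int[mu]_(x in D) g x = \int[mu]_(x in D) f x.
Proof.
move=> mD fg intf; split; last by apply: eq_Rintegral => x /fg.
by apply: eq_integrable intf => // x /fg /= ->.
Qed.

Lemma integrable_disjoint_setU (A B : set R) (f : R -> \bar R) :
  measurable A -> measurable B -> [disjoint A & B] ->
  mu.-integrable A f -> mu.-integrable B f -> mu.-integrable (A `|` B) f.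
Proof.
move=> mA mB AB /integrableP[mfA fA] /integrableP[mfB fB]; apply/integrableP.
have mAB : measurable_fun (A `|` B) f by apply/measurable_funU.
split => //; rewrite ge0_integral_setU//=; last exact: measurableT_comp.
exact: lte_add_pinfty.
Qed.

End linear_combinations.

(** * The remainder integral at the origin, split at 1 *)

Section fractional_integral_at_origin.
Context {R : realType}.
Notation mu := (@lebesgue_measure R).
Variables (k M : R) (f f1 f2 : R -> R).
Hypothesis k12 : 1 < k < 2.
Hypothesis prim : second_primitive f f1 f2.
Hypothesis fM : forall x, `|f x| <= M.
Hypothesis if2 : mu.-integrable `]0, 1] (fun u => (f2 u * u `^ (1 - k))%:E).

Let g t := f t - f 0 - t * f1 0.

Let k1 : 0 < k - 1. Proof. by rewrite subr_gt0; case/andP: k12. Qed.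
Let k0 : 0 < k. Proof. by case/andP: k12 => /(lt_trans ltr01). Qed.
Let k1n0 : k - 1 != 0. Proof. by rewrite gt_eqF ?k1 ?k0. Qed.
Let kn0 : k != 0. Proof. by rewrite gt_eqF ?k1 ?k0. Qed.

Let powR_D (t x y : R) : 0 < t -> t `^ (x + y) = t `^ x * t `^ y.
Proof. by move=> t0; rewrite powRD//; apply/implyP => _; rewrite gt_eqF. Qed.

Let mf2 : measurable_fun setT f2. Proof. by case: prim. Qed.

Let if2' : mu.-integrable `]0, 1] (EFin \o f2).
Proof. by have [_ _ _ /(_ 0 1 ler01)[]] := prim. Qed.

Let iuf2 : mu.-integrable `]0, 1] (EFin \o (fun u => u * f2 u)).
Proof.
have [iT _] := second_primitive_Taylor prim ler01.
have [i _] := Rintegral_lin 1 (-1) (measurable_itv _) if2' iT.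
by apply: eq_integrable i => // u _ /=; congr EFin; ring.
Qed.

Let weight_k (u : R) : 0 < u <= 1 -> mu.-integrable `[u, 1] (EFin \o (fun t => t `^ (- k))) /\
  \int[mu]_(t in `[u, 1]) t `^ (- k) = (u `^ (1 - k) - 1) / (k - 1).
Proof.
move=> /andP[u0 u1]; have r0 : 1 - k != 0 by rewrite subr_eq0 eq_sym -subr_eq0.
have := integral_powR u0 u1 r0; rewrite [1 - k - 1]addrAC subrr sub0r powR1 => -[i ->].
by split => //; field; rewrite k1n0 r0.
Qed.

Let weight_k1 (u : R) : 0 < u <= 1 -> mu.-integrable `[u, 1] (EFin \o (fun t => t `^ (- k - 1))) /\
  \int[mu]_(t in `[u, 1]) t `^ (- k - 1) = (u `^ (- k) - 1) / k.
Proof.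
move=> /andP[u0 u1]; have r0 : - k != 0 by rewrite oppr_eq0.
have := integral_powR u0 u1 r0; rewrite powR1 => -[i ->].
by split => //; rewrite invrN mulrN -mulNr opprB.
Qed.

Let norm_powRE (u r : R) : \int[mu]_(t in `[u, 1]) `|t `^ r| = \int[mu]_(t in `[u, 1]) t `^ r.
Proof. by apply: eq_Rintegral => t _; rewrite ger0_norm ?powR_ge0. Qed.

(** By Taylor's formula [g t / t^(1+k)] is [t^(-k)] times the integral of [f2] over []0, t]], minus
    [t^(-k-1)] times that of [u * f2 u]. The order of integration is exchanged in the first term
    here and in the second in [local_B]; both converge because [f2 u * u^(1-k)] is integrable. *)
Let local_A :
  mu.-integrable `]0, 1] (fun t => (t `^ (- k) * \int[mu]_(u in `]0, t]) f2 u)%:E) /\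
  \int[mu]_(t in `]0, 1]) (t `^ (- k) * \int[mu]_(u in `]0, t]) f2 u) =
  (k - 1)^-1 * (\int[mu]_(u in `]0, 1]) (f2 u * u `^ (1 - k)) - \int[mu]_(u in `]0, 1]) f2 u).
Proof.
have [i E] := Rintegral_lin (k - 1)^-1 (- (k - 1)^-1) (measurable_itv _) if2 if2'.
have ulin : {in `]0, 1]%classic,
    (fun u : R => (k - 1)^-1 * (f2 u * u `^ (1 - k)) + - (k - 1)^-1 * f2 u) =1
    (fun u : R => f2 u * \int[mu]_(t in `[u, 1]) t `^ (- k))}.
  by move=> u; rewrite inE/= in_itv/= => /weight_k[_ ->]; ring.
have [i2 E2] := eq_integrable_Rintegral (measurable_itv _) ulin i.
have i2' : mu.-integrable `]0, 1]
    (fun u => (f2 u * \int[mu]_(t in `[u, 1]) `|t `^ (- k)|)%:E).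
  by apply: eq_integrable i2 => // u _ /=; rewrite norm_powRE.
have mp : measurable_fun setT (fun t : R => t `^ (- k)) by exact: measurable_powR.
have iw u : 0 < u <= 1 -> mu.-integrable `[u, 1] (EFin \o (fun t => t `^ (- k))).
  by move=> /weight_k[].
split; first exact: triangular_integrable.
rewrite triangular_Fubini// E2 E; ring.
Qed.

Let local_B :
  mu.-integrable `]0, 1] (fun t => (t `^ (- k - 1) * \int[mu]_(u in `]0, t]) (u * f2 u))%:E) /\
  \int[mu]_(t in `]0, 1]) (t `^ (- k - 1) * \int[mu]_(u in `]0, t]) (u * f2 u)) =
  k^-1 * (\int[mu]_(u in `]0, 1]) (f2 u * u `^ (1 - k)) - \int[mu]_(u in `]0, 1]) (u * f2 u)).
Proof.
have [i E] := Rintegral_lin k^-1 (- k^-1) (measurable_itv _) if2 iuf2.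
have ulin : {in `]0, 1]%classic, (fun u : R => k^-1 * (f2 u * u `^ (1 - k)) + - k^-1 * (u * f2 u)) =1
    (fun u : R => u * f2 u * \int[mu]_(t in `[u, 1]) t `^ (- k - 1))}.
  move=> u; rewrite inE/= in_itv/= => /[dup] /weight_k1[_ ->] /andP[u0 _].
  by rewrite powR_D// powRr1 ?ltW//; ring.
have [i2 E2] := eq_integrable_Rintegral (measurable_itv _) ulin i.
have i2' : mu.-integrable `]0, 1]
    (fun u => (u * f2 u * \int[mu]_(t in `[u, 1]) `|t `^ (- k - 1)|)%:E).
  by apply: eq_integrable i2 => // u _ /=; rewrite norm_powRE.
have mp : measurable_fun setT (fun t : R => t `^ (- k - 1)) by exact: measurable_powR.
have iw u : 0 < u <= 1 -> mu.-integrable `[u, 1] (EFin \o (fun t => t `^ (- k - 1))).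
  by move=> /weight_k1[].
have muf2 : measurable_fun setT (fun u : R => u * f2 u) by exact: measurable_funM.
split; first exact: triangular_integrable.
rewrite triangular_Fubini// E2 E; ring.
Qed.

Let local_part :
  mu.-integrable `]0, 1] (fun t => (g t / t `^ (1 + k))%:E) /\
  k * (k - 1) * \int[mu]_(t in `]0, 1]) (g t / t `^ (1 + k)) =
  \int[mu]_(u in `]0, 1]) (f2 u * u `^ (1 - k)) - f1 1 - (k - 1) * f 1
    + k * f1 0 + (k - 1) * f 0.
Proof.
have [iA EA] := local_A; have [iB EB] := local_B.
have [i E] := Rintegral_lin 1 (-1) (measurable_itv _) iA iB.
have [_ _ _ f12] := prim.
have gE : {in `]0, 1]%classic,
    (fun t : R => 1 * (t `^ (- k) * \int[mu]_(u in `]0, t]) f2 u) +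
       -1 * (t `^ (- k - 1) * \int[mu]_(u in `]0, t]) (u * f2 u))) =1
    (fun t : R => g t / t `^ (1 + k))}.
  move=> t; rewrite inE/= in_itv/= => /andP[t0 t1].
  have t0' := ltW t0; have sub01 : `]0, t] `<=` `]0, 1] by apply: subset_itvl; rewrite bnd_simp.
  have [iT ET] := second_primitive_Taylor prim t0'.
  have it : mu.-integrable `]0, t] (EFin \o f2) by exact: integrableS if2'.
  have iut : mu.-integrable `]0, t] (EFin \o (fun u => u * f2 u)) by exact: integrableS iuf2.
  have [_ EL] := Rintegral_lin t (-1) (measurable_itv _) it iut.
  rewrite (_ : g t = t * \int[mu]_(u in `]0, t]) f2 u - \int[mu]_(u in `]0, t]) (u * f2 u)).
    rewrite -powRN opprD powR_D// [t `^ (-1)]powR_inv1 ?ltW// powR_D// powR_inv1 ?ltW//.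
    by field; rewrite gt_eqF.
  rewrite /g -[t in X in X * f1 0]subr0 ET mulN1r in EL *; rewrite -EL.
  by apply: eq_Rintegral => u _; ring.
have [i2 E2] := eq_integrable_Rintegral (measurable_itv _) gE i.
split => //; rewrite E2 E EA EB.
have [iT ET] := second_primitive_Taylor prim ler01.
have [_ E1] := f12 0 1 ler01.
have [_ EL] := Rintegral_lin 1 (-1) (measurable_itv _) if2' iT.
have -> : \int[mu]_(u in `]0, 1]) (u * f2 u) = f1 1 - f1 0 - (f 1 - f 0 - f1 0).
  have ET' : f 1 - f 0 - f1 0 = \int[mu]_(u in `]0, 1]) ((1 - u) * f2 u).
    by rewrite -ET subr0 mul1r.
  rewrite E1 ET'.
  rewrite mulN1r mul1r in EL; rewrite -EL.
  by apply: eq_Rintegral => u _; ring.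
by rewrite -E1; field; rewrite kn0 k1n0.
Qed.

Let ipk : mu.-integrable `]1, +oo[ (EFin \o (fun t => t `^ (- k - 1))).
Proof. by have [] := integral_powRy k0. Qed.

Lemma integrable_tail : mu.-integrable `]1, +oo[ (fun t => (f t * t `^ (- k - 1))%:E).
Proof.
have [df _ _ _] := prim.
apply: (le_integrable _ _ _ (integrableZl _ M ipk)) => //.
  apply/measurable_EFinP/measurable_funTS; apply: measurable_funM; last exact: measurable_powR.
  apply: continuous_measurable_fun => x; apply: differentiable_continuous.
  by apply/derivable1_diffP; have ? := df x; exact: ex_derive.
move=> t _ /=; rewrite lee_fin !normrM ler_pM//.
by rewrite (le_trans (fM t))// ler_norm.
Qed.

Let far_part :
  mu.-integrable `]1, +oo[ (fun t => (g t / t `^ (1 + k))%:E) /\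
  k * (k - 1) * \int[mu]_(t in `]1, +oo[) (g t / t `^ (1 + k)) =
  k * (k - 1) * \int[mu]_(t in `]1, +oo[) (f t * t `^ (- k - 1))
    - (k - 1) * f 0 - k * f1 0.
Proof.
have [_ E1] := integral_powRy k0.
have [i2 E2] := integral_powRy k1.
have [i3 E3] := Rintegral_lin (- f 0) (- f1 0) (measurable_itv _) ipk i2.
have [i4 E4] := Rintegral_lin 1 1 (measurable_itv _) integrable_tail i3.
have gE : {in `]1, +oo[%classic, (fun t : R => 1 * (f t * t `^ (- k - 1)) +
    1 * (- f 0 * t `^ (- k - 1) + - f1 0 * t `^ (- (k - 1) - 1))) =1
    (fun t : R => g t / t `^ (1 + k))}.
  move=> t; rewrite inE/= in_itv/= andbT => t1; have t0 := lt_trans ltr01 t1.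
  rewrite -powRN (_ : - (k - 1) - 1 = (- (1 + k)) + 1); last by ring.
  rewrite (_ : - k - 1 = - (1 + k)); last by ring.
  by rewrite [t `^ (_ + 1)]powR_D// powRr1 ?ltW// /g; ring.
have [i E] := eq_integrable_Rintegral (measurable_itv _) gE i4.
split => //; rewrite E E4 E3 E1 E2; field.
by rewrite kn0 k1n0.
Qed.

(** The contributions of [f 0] and [f1 0] from the two sides of 1 cancel. The term [f1 1] that
    remains is removed later by the integration by parts against [Omega]. *)
Lemma origin_integral :
  mu.-integrable `]0, +oo[ (fun t => (g t / t `^ (1 + k))%:E) /\
  k * (k - 1) * \int[mu]_(t in `]0, +oo[) (g t / t `^ (1 + k)) =
  \int[mu]_(u in `]0, 1]) (f2 u * u `^ (1 - k)) - f1 1 - (k - 1) * f 1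
  + k * (k - 1) * \int[mu]_(t in `]1, +oo[) (f t * t `^ (- k - 1)).
Proof.
have [i1 E1] := local_part; have [i2 E2] := far_part.
have U : `]0, +oo[%classic = `]0, 1] `|` `]1, +oo[ :> set R.
  by rewrite -itv_bndbnd_setU// bnd_simp.
have D : [disjoint (`]0, 1]%classic : set R) & (`]1, +oo[%classic : set R)]%classic.
  apply/disj_setPS => y [/=]; rewrite !in_itv/= andbT => /andP[_ y1].
  by rewrite ltNge y1.
have iU : mu.-integrable `]0, +oo[ (fun t => (g t / t `^ (1 + k))%:E).
  by rewrite U; apply: integrable_disjoint_setU.
split => //; rewrite U Rintegral_setU//=; last by rewrite -U.
rewrite mulrDr E1 E2; ring.
Qed.

End fractional_integral_at_origin.

(** * The function tau *)

Section has_Rintegral.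
Context {R : realType}.
Notation mu := (@lebesgue_measure R).

(** Integrability is kept with the value, since [Rintegral] is total and its value alone cannot be
    added over pieces. *)
Definition has_Rintegral (D : set R) (f : R -> R) (I : R) :=
  mu.-integrable D (EFin \o f) /\ \int[mu]_(x in D) f x = I.

Lemma has_Rintegral_eq (D : set R) (f g : R -> R) (I J : R) : measurable D ->
  {in D, f =1 g} -> I = J -> has_Rintegral D f I -> has_Rintegral D g J.
Proof.
move=> mD fg <- [intf <-]; have [i E] := eq_integrable_Rintegral mD fg intf.
by split.
Qed.

Lemma has_Rintegral_itvU (l r : itv_bound R) (c : bool) (x : R) (f : R -> R) (I J : R) :
  (l <= BSide c x)%O -> (BSide c x <= r)%O ->
  has_Rintegral [set` Interval l (BSide c x)] f I ->
  has_Rintegral [set` Interval (BSide c x) r] f J ->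
  has_Rintegral [set` Interval l r] f (I + J).
Proof.
move=> lx xr [iI <-] [iJ <-].
have D : [disjoint [set` Interval l (BSide c x)] & [set` Interval (BSide c x) r]]%classic.
  apply/disj_setPS => y [/=]; rewrite !itv_boundlr/= => /andP[_ y1] /andP[y2 _].
  by have := le_trans y1 y2; rewrite bnd_simp ltxx.
have i := integrable_disjoint_setU (measurable_itv _) (measurable_itv _) D iI iJ.
split; first by rewrite (itv_bndbnd_setU lx xr).
by rewrite (itv_bndbnd_setU lx xr) Rintegral_setU.
Qed.

Lemma has_Rintegral_cst (b1 b2 : bool) (u v r : R) : u <= v ->
  has_Rintegral [set` Interval (BSide b1 u) (BSide b2 v)] (fun=> r) (r * (v - u)).
Proof.
move=> uv; have muE : mu [set` Interval (BSide b1 u) (BSide b2 v)] = (v - u)%:E.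
  rewrite lebesgue_measure_itv/= lte_fin; case: ltP => [//|vu].
  by rewrite (_ : u = v) ?subrr//; apply/eqP; rewrite eq_le uv.
have mufin : (mu [set` Interval (BSide b1 u) (BSide b2 v)] < +oo)%E by rewrite muE ltry.
split; last by rewrite Rintegral_cst//; congr (_ * _); exact: (congr1 fine muE).
apply: (measurable_bounded_integrable _ mufin) => //.
by exists `|r|; split; [exact: num_real|move=> M rM t _; exact: ltW].
Qed.

Lemma has_Rintegral_set0 (D : set R) (f : R -> R) : measurable D ->
  {in D, forall x, f x = 0} -> has_Rintegral D f 0.
Proof.
move=> mD f0; apply: (@has_Rintegral_eq D (cst 0) f 0 0) => //.
  by move=> x /f0 ->.
split; first exact: integrable0.
by rewrite Rintegral_cst// mul0r.
Qed.

End has_Rintegral.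

(** * Convexity of negative powers through tangent lines *)

Section power_inequalities.
Context {R : realType}.
Variable k : R.
Hypothesis k1 : 1 < k.

(** The power is [exp ((1 - k) ln r)]; combine [exp z >= 1 + z] with [ln r <= r - 1], the latter
    reversed by the negative factor [1 - k]. *)
Lemma powR_ge_tangent1 (r : R) : 0 < r -> 1 + (1 - k) * (r - 1) <= r `^ (1 - k).
Proof.
move=> r0; rewrite /powR gt_eqF//.
apply: le_trans (expR_ge1Dx _); rewrite lerD2l.
apply: ler_wnM2l; first by rewrite subr_le0 ltW.
have := @le_ln1Dx R (r - 1); rewrite addrCA subrr addr0; apply.
by rewrite ltrBrDr addrC subrr.
Qed.

Lemma powR_ge_tangent (x y : R) : 0 < x -> 0 < y ->
  y `^ (1 - k) + (1 - k) * y `^ (- k) * (x - y) <= x `^ (1 - k).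
Proof.
move=> x0 y0; have := powR_ge_tangent1 (divr_gt0 x0 y0).
rewrite -(ler_pM2l (powR_gt0 (1 - k) y0)) -(powRM _ (ltW y0) (ltW (divr_gt0 x0 y0))).
rewrite [y * (x / y)]mulrC divfK ?gt_eqF//; apply: le_trans; rewrite le_eqVlt; apply/orP; left; apply/eqP.
have -> : y `^ (1 - k) = y * y `^ (- k).
  by rewrite powRD ?powRr1 ?ltW//; apply/implyP => _; rewrite gt_eqF.
by field; rewrite gt_eqF.
Qed.

End power_inequalities.

Section tau_analysis.
Context {R : realType}.
Notation mu := (@lebesgue_measure R).
Variables (k a b p : R).
Hypothesis k1 : 1 < k.
Hypothesis hS : in_S a b p.

Lemma in_S_bounds : [/\ 0 < a, a < 1, 0 < b, b < 1 & a <= b /\ 0 <= p].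
Proof. by have [/andP[? ?] /andP[? ?] ? ?] := hS. Qed.

(** [slope2] belongs to the chord of [x^(1-k)] over [[b, 1]], and [slope1] to the segment from
    [(-p, 0)] to the point over [a] of the line carrying that chord. *)
Definition slope1 := (1 - b + (1 - b `^ (1 - k)) * (a - 1)) / ((1 - b) * (a + p)).
Definition slope2 := (1 - b)^-1 * (1 - b `^ (1 - k)).

Definition Omega (x : R) :=
  if x <= - p then 0 else if x <= a then slope1 * (x + p)
  else if x < 1 then 1 + slope2 * (x - 1) else x `^ (1 - k).

Lemma slope1_join : slope1 * (a + p) = 1 + slope2 * (a - 1).
Proof.
have [a0 a1 b0 b1 [ab p0]] := in_S_bounds.
rewrite /slope1 /slope2; field.
by rewrite !gt_eqF// ?subr_gt0// ltr_wpDr.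
Qed.

Lemma powb_gt1 : 1 < b `^ (1 - k).
Proof.
have [a0 a1 b0 b1 _] := in_S_bounds; have := powR_ge_tangent1 k1 b0.
have : 0 < (1 - k) * (b - 1) by rewrite nmulr_rgt0 subr_lt0.
lra.
Qed.

Lemma slope1_gt0 : 0 < slope1.
Proof.
have [a0 a1 b0 b1 [ab p0]] := in_S_bounds.
apply: divr_gt0; last by rewrite mulr_gt0 ?subr_gt0// ltr_wpDr.
have : 0 < (1 - b `^ (1 - k)) * (a - 1) by rewrite nmulr_rgt0 subr_lt0 ?powb_gt1.
lra.
Qed.

Lemma slope2_mul : slope2 * (1 - b) = 1 - b `^ (1 - k).
Proof.
have [a0 a1 b0 b1 [ab p0]] := in_S_bounds.
by rewrite /slope2 mulrAC mulVf ?mul1r// gt_eqF// subr_gt0.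
Qed.

Lemma slope2_le : slope2 <= 1 - k.
Proof.
have [a0 a1 b0 b1 [ab p0]] := in_S_bounds.
rewrite -(ler_pM2r (_ : 0 < 1 - b)) ?subr_gt0// slope2_mul.
have := powR_ge_tangent1 k1 b0; lra.
Qed.

Lemma slope2_lt0 : slope2 < 0.
Proof. by apply: le_lt_trans slope2_le _; rewrite subr_lt0. Qed.

Lemma has_Rintegral_omega (x : R) : has_Rintegral `]-oo, x] (omega k a b p) (Omega x).
Proof.
have [a0 a1 b0 b1 [ab p0]] := in_S_bounds.
have pa : - p < a by rewrite (le_lt_trans _ a0)// oppr_le0.
have i0 y : y <= - p -> has_Rintegral `]-oo, y] (omega k a b p) 0.
  move=> yp; apply: has_Rintegral_set0 => // z; rewrite inE/= in_itv/= => zy.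
  by rewrite /omega (le_trans zy yp).
have i1 y : - p <= y -> y <= a -> has_Rintegral `]-oo, y] (omega k a b p) (slope1 * (y + p)).
  move=> py ya; rewrite -[X in has_Rintegral _ _ X]add0r.
  apply: (@has_Rintegral_itvU _ _ _ false (- p)) => //; first exact: i0.
  have H := @has_Rintegral_cst R false false (- p) y slope1 py.
  apply: has_Rintegral_eq H => //; last by rewrite opprK.
  move=> z; rewrite inE/= in_itv/= => /andP[pz zy].
  by rewrite /omega leNgt pz/= (le_trans zy ya).
have omega2 y : a < y -> y < 1 -> omega k a b p y = slope2.
  by move=> ay y1; rewrite /omega leNgt (lt_trans pa ay)/= leNgt ay/= y1.
have i2 c y : a < y -> (if c then y <= 1 else y < 1) ->
    has_Rintegral [set` Interval -oo%O (BSide c y)] (omega k a b p) (1 + slope2 * (y - 1)).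
  move=> ay yc; rewrite (_ : 1 + _ = slope1 * (a + p) + slope2 * (y - a)); last first.
    by rewrite slope1_join; ring.
  apply: (@has_Rintegral_itvU _ _ _ false a) => //.
  - by case: (c); rewrite bnd_simp// ltW.
  - exact: (i1 a (ltW pa) (lexx a)).
  have H := @has_Rintegral_cst R false c a y slope2 (ltW ay).
  apply: has_Rintegral_eq H => // z; rewrite inE/= in_itv/= => /andP[az zy].
  by apply/esym/omega2 => //; case: c yc zy => /= yc zy;
    [exact: lt_le_trans zy yc|exact: le_lt_trans zy yc].
rewrite /Omega; case: (leP x (- p)) => [xp|px]; first exact: i0.
case: (leP x a) => [xa|ax]; first exact: i1 (ltW px) xa.
case: (ltP x 1) => [x1|x1]; first exact: i2.
rewrite (_ : x `^ _ = 1 + slope2 * (1 - 1) + (x `^ (1 - k) - 1 `^ (1 - k))); last first.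
  by rewrite powR1; ring.
apply: (@has_Rintegral_itvU _ _ _ true 1) => //; first exact: (i2 true).
have D (t : R) : 1 <= t <= x -> is_derive t 1 (fun t => t `^ (1 - k)) ((1 - k) * t `^ (- k)).
  move=> /andP[t1 _]; have := is_derive_powR (1 - k) (lt_le_trans ltr01 t1).
  by rewrite (_ : 1 - k - 1 = - k)//; ring.
have [t /andP[t1 _]|_ iD _ ED] := C1_FTC x1 D.
  apply: cvgM; first exact: cvg_cst.
  exact: continuous_powR (lt_le_trans ltr01 t1).
apply: (@has_Rintegral_eq _ _ (fun t => (1 - k) * t `^ (- k)) _ _ _ (measurable_itv _) _ erefl); last by split.
move=> t; rewrite inE/= in_itv/= => /andP[t1 tx].
have t0 := lt_le_trans a1 t1.
by rewrite /omega leNgt (lt_trans pa t0)/= leNgt t0/= ltNge t1.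
Qed.

Lemma tauE (x : R) : tau k a b p x = rho k x - Omega x.
Proof. by rewrite /tau; have [_ ->] := has_Rintegral_omega x. Qed.

Lemma rho_gt0 (x : R) : 0 < x -> rho k x = x `^ (1 - k).
Proof. by rewrite /rho => ->. Qed.

Lemma tau_le (x : R) : x <= - p -> tau k a b p x = 0.
Proof.
have [_ _ _ _ [_ p0]] := in_S_bounds => xp.
by rewrite tauE /Omega xp /rho ltNge (le_trans xp) ?oppr_le0//= subrr.
Qed.

Lemma tau_ge (x : R) : 1 <= x -> tau k a b p x = 0.
Proof.
have [a0 a1 _ _ [_ p0]] := in_S_bounds => x1.
have x0 := lt_le_trans ltr01 x1; have ax := lt_le_trans a1 x1.
rewrite tauE rho_gt0// /Omega leNgt (le_lt_trans _ x0) ?oppr_le0//=.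
by rewrite leNgt ax/= ltNge x1/= subrr.
Qed.

Lemma tau_neg (x : R) : - p < x -> x <= 0 -> tau k a b p x = - (slope1 * (x + p)).
Proof.
have [a0 a1 _ _ [_ p0]] := in_S_bounds => px x0.
by rewrite tauE /rho ltNge x0/= sub0r /Omega leNgt px/= (le_trans x0 (ltW a0)).
Qed.

Lemma tau_left (x : R) : 0 < x -> x <= a -> tau k a b p x = x `^ (1 - k) - slope1 * (x + p).
Proof.
have [a0 a1 _ _ [_ p0]] := in_S_bounds => x0 xa.
by rewrite tauE rho_gt0// /Omega leNgt (le_lt_trans _ x0) ?oppr_le0//= xa.
Qed.

Lemma tau_right (x : R) : a <= x -> x <= 1 ->
  tau k a b p x = x `^ (1 - k) - (1 + slope2 * (x - 1)).
Proof.
have [a0 a1 _ _ [_ p0]] := in_S_bounds; rewrite le_eqVlt => /predU1P[<- _|ax].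
  by rewrite tau_left// slope1_join.
rewrite le_eqVlt => /predU1P[->|x1].
  by rewrite tau_ge// powR1; ring.
have x0 := lt_trans a0 ax.
by rewrite tauE rho_gt0// /Omega leNgt (le_lt_trans _ x0) ?oppr_le0//= leNgt ax/= x1.
Qed.

(** The tangent at [b] stays below the power at 1, so its slope [m] is at most [slope2]; left of [b]
    the chord line is thus below this tangent. *)
Lemma chord_le (x : R) : 0 < x -> x <= b -> 1 + slope2 * (x - 1) <= x `^ (1 - k).
Proof.
have [a0 a1 b0 b1 _] := in_S_bounds => x0 xb.
have h1 := powR_ge_tangent k1 x0 b0; have := powR_ge_tangent k1 ltr01 b0.
rewrite powR1; have := slope2_mul; set m := (1 - k) * _ in h1 *.
set B := b `^ _ in h1 * => eB h2.
have m2 : m <= slope2 by rewrite -(ler_pM2r (_ : 0 < 1 - b)) ?subr_gt0// eB; lra.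
have : 0 <= (slope2 - m) * (b - x) by rewrite mulr_ge0// subr_ge0.
move: eB h1; lra.
Qed.

Lemma chord_ge (x : R) : b <= x -> x <= 1 -> x `^ (1 - k) <= 1 + slope2 * (x - 1).
Proof.
have [a0 a1 b0 b1 _] := in_S_bounds => bx x1; have x0 := lt_le_trans b0 bx.
have h1 := powR_ge_tangent k1 b0 x0; have := powR_ge_tangent k1 ltr01 x0.
rewrite powR1; have := slope2_mul; set m := (1 - k) * _ in h1 *.
set B := b `^ _ in h1 *; set X := x `^ _ in h1 * => eB h2.
rewrite -(ler_pM2r (_ : 0 < 1 - b)) ?subr_gt0// mulrDl mulrAC eB.
(* The tangent at [x] is tested at [b] and at 1 with weights [1 - x] and [x - b], for which its
   slope cancels. *)
have : 0 <= (1 - x) * (B - (X + m * (b - x))) by rewrite mulr_ge0// subr_ge0.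
have : 0 <= (x - b) * (1 - (X + m * (1 - x))) by rewrite mulr_ge0// subr_ge0.
lra.
Qed.

Lemma powR_le_nonincreasing (x y : R) : 0 < x -> x <= y -> y `^ (1 - k) <= x `^ (1 - k).
Proof.
move=> x0 xy; have y0 := lt_le_trans x0 xy; have := powR_ge_tangent k1 x0 y0.
have : 0 <= (1 - k) * y `^ (- k) * (x - y).
  by rewrite mulr_le0 ?subr_le0// mulr_le0_ge0 ?powR_ge0// subr_le0 ltW.
lra.
Qed.

Lemma tau_le0_neg (x : R) : x <= 0 -> tau k a b p x <= 0.
Proof.
move=> x0; have [xp|px] := leP x (- p); first by rewrite tau_le.
by rewrite tau_neg// oppr_le0 mulr_ge0 ?(ltW slope1_gt0)// -lerBlDr sub0r ltW.
Qed.

(** [Omega] increases up to [a], where it lies on the chord line, hence below [a^(1-k)] because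
    [a <= b]. *)
Lemma tau_left_ge (x : R) : 0 < x -> x <= a ->
  x `^ (1 - k) - a `^ (1 - k) <= tau k a b p x.
Proof.
have [a0 a1 b0 b1 [ab p0]] := in_S_bounds => x0 xa; rewrite tau_left//.
have := chord_le a0 ab; rewrite -slope1_join.
have : 0 <= slope1 * (a - x) by rewrite mulr_ge0 ?(ltW slope1_gt0)// subr_ge0.
lra.
Qed.

Lemma tau_ge0 (x : R) : 0 < x -> x <= b -> 0 <= tau k a b p x.
Proof.
have [a0 a1 b0 b1 [ab p0]] := in_S_bounds => x0 xb.
have [xa|/ltW ax] := leP x a.
  by apply: le_trans (tau_left_ge x0 xa); rewrite subr_ge0 powR_le_nonincreasing.
by rewrite tau_right ?subr_ge0 ?chord_le// (le_trans xb (ltW b1)).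
Qed.

Lemma tau_le0 (x : R) : b <= x -> tau k a b p x <= 0.
Proof.
have [a0 a1 b0 b1 [ab p0]] := in_S_bounds => bx.
have [/ltW x1|/tau_ge-> //] := ltP x 1.
by rewrite tau_right ?subr_le0 ?chord_ge// (le_trans ab).
Qed.

(** [1 - slope2] is the value at 0 of the chord line, an upper bound of [Omega] left of 1; on []0,
    1]] the power is at least 1 and absorbs [Omega]. *)
Lemma tau_bound (x : R) : `|tau k a b p x| <= (1 - slope2) * (if 0 < x then x `^ (1 - k) else 1).
Proof.
have [a0 a1 b0 b1 [ab p0]] := in_S_bounds.
have s2 := slope2_lt0; have s1 := slope1_gt0; have C0 : 0 <= 1 - slope2 by lra.
have Oa : slope1 * (a + p) <= 1 - slope2.
  rewrite slope1_join; have : 0 <= - slope2 * a by rewrite mulr_ge0 ?oppr_ge0// ltW.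
  lra.
case: (ltP 0 x) => [x0|x0]; last first.
  have [xp|px] := leP x (- p); first by rewrite tau_le// normr0 mulr1.
  have P : 0 <= slope1 * (x + p) by rewrite pmulr_rge0// -lerBlDr sub0r ltW.
  rewrite tau_neg// normrN ger0_norm//.
  have : 0 <= slope1 * (a - x) by rewrite mulr_ge0 ?(ltW s1)// subr_ge0 (le_trans x0)// ltW.
  by move: Oa; lra.
have [x1|/ltW x1] := leP 1 x.
  by rewrite tau_ge// normr0 mulr_ge0 ?powR_ge0.
have X1 : 1 <= x `^ (1 - k) by have := powR_le_nonincreasing x0 x1; rewrite powR1.
suff : 0 <= Omega x /\ Omega x <= 1 - slope2.
  move=> [Om0 OmC]; rewrite tauE rho_gt0// ler_norml; apply/andP; split.
    have : 1 - slope2 <= (1 - slope2) * x `^ (1 - k) by rewrite ler_peMr.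
    have := powR_ge0 x (1 - k); lra.
  have : 1 * x `^ (1 - k) <= (1 - slope2) * x `^ (1 - k) by rewrite ler_wpM2r ?powR_ge0//; lra.
  lra.
have xp : (x <= - p) = false by apply/negbTE; rewrite -ltNge (le_lt_trans _ x0)// oppr_le0.
rewrite /Omega xp; case: (leP x a) => [xa|ax].
  have : 0 <= slope1 * (a - x) by rewrite mulr_ge0 ?(ltW s1)// subr_ge0.
  have : 0 <= slope1 * (x + p) by rewrite mulr_ge0 ?(ltW s1)// addr_ge0// ltW.
  by move=> ? ?; split => //; move: Oa; lra.
have := x1; rewrite le_eqVlt => /predU1P[->|x1'].
  by rewrite ltxx powR1; split => //; lra.
rewrite x1'.
have : 0 <= - slope2 * (1 - x) by rewrite mulr_ge0 ?subr_ge0// oppr_ge0 ltW.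
have : 0 <= - slope2 * x by rewrite mulr_ge0 ?(ltW x0)// oppr_ge0 ltW.
by move=> ? ?; split; lra.
Qed.

Lemma measurable_tau : measurable_fun setT (tau k a b p).
Proof.
have -> : tau k a b p = rho k \- Omega by apply/funext => x; rewrite tauE.
have mpow : measurable_fun setT (fun t : R => t `^ (1 - k)) by exact: measurable_powR.
apply: measurable_funB.
  apply: measurable_fun_ifT => //.
  exact: measurable_fun_ltr.
apply: measurable_fun_ifT => //; first exact: measurable_fun_ler.
apply: measurable_fun_ifT => //; first exact: measurable_fun_ler.
  by apply: measurable_funM => //; exact: measurable_funD.
apply: measurable_fun_ifT => //; first exact: measurable_fun_ltr.
by apply: measurable_funD => //; apply: measurable_funM => //; exact: measurable_funB.
Qed.

End tau_analysis.

(** * Lebesgue norms *)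

Section affine_null_sets.
Context {R : realType}.
Notation mu := (@lebesgue_measure R).

Lemma lebesgue_measure_affine (x h : R) (A : set R) : 0 < h -> measurable A ->
  mu ((fun t => x + h * t) @^-1` A) = ((h^-1)%:E * mu A)%E.
Proof.
move=> h0 mA; have := @ge0_integral_affine R x h h0 A (cst 1%E) mA (measurable_cst _) (fun _ _ => lee01).
rewrite !integral_cst ?mul1e//.
have maff : measurable_fun setT (fun t : R => x + h * t).
  by apply: measurable_funD => //; exact: measurable_funM.
by rewrite -[X in measurable X]setTI; exact: maff.
Qed.

Lemma ae_affine (x h : R) (P : R -> Prop) : 0 < h ->
  {ae mu, forall t, P t} -> {ae mu, forall t, P (x + h * t)}.
Proof.
move=> h0 [N [mN N0 PN]]; exists ((fun t => x + h * t) @^-1` N).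
have maff : measurable_fun setT (fun t : R => x + h * t).
  by apply: measurable_funD => //; exact: measurable_funM.
split; first by rewrite -[X in measurable X]setTI; exact: maff.
  by rewrite lebesgue_measure_affine// N0 mule0.
by move=> t /= nP; apply: PN.
Qed.

End affine_null_sets.

(** [Lnorm] at +oo is the essential supremum only on a space of positive measure. *)
Lemma lebesgue_setT_gt0 (R : realType) : (0 < @lebesgue_measure R [set: R])%E.
Proof. by rewrite -set_itvNyy lebesgue_measure_itv/= ?(ltNyr, ltry)//. Qed.

Section conjugate_exponents.
Context {R : realType}.
Variable s : \bar R.
Hypothesis s1 : (1 < s)%E.

Variant exponent_spec : \bar R -> R -> R -> Type :=
| ExponentInfty : exponent_spec +oo%E 1 0
| ExponentFinite r : 1 < r -> exponent_spec r%:E (r / (r - 1)) r^-1.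

Lemma exponentP : exponent_spec s (conj_exp s) (inv_exp s).
Proof.
move: s1; rewrite /conj_exp /inv_exp; case: s => [r|_|//]; last first.
  by rewrite hoelder_conjugatey invey/=; exact: ExponentInfty.
rewrite lte_fin => r1; have r0 : r != 0 by rewrite gt_eqF// (lt_trans ltr01 r1).
have r10 : r - 1 != 0 by rewrite gt_eqF// subr_gt0.
rewrite /hoelder_conjugate/= eqe (negbTE r0) -EFinB !inver (negbTE r0) (negbTE r10)/=.
exact: ExponentFinite.
Qed.

Lemma conj_exp_ge1 : 1 <= conj_exp s.
Proof.
case: exponentP => // r r1; rewrite ler_pdivlMr ?subr_gt0// mul1r lerBlDr lerDl//.
Qed.

Lemma conj_exp_inv : (conj_exp s)^-1 = 1 - inv_exp s.
Proof.
case: exponentP => [|r r1]; first by rewrite subr0 invr1.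
by field; rewrite !gt_eqF// ?subr_gt0// (lt_trans ltr01 r1).
Qed.

Lemma inv_exp_itv : 0 <= inv_exp s < 1.
Proof.
case: exponentP => [|r r1]; first by rewrite lexx ltr01.
have r0 := lt_trans ltr01 r1.
by rewrite invr_ge0 (ltW r0)/= invf_lt1.
Qed.

End conjugate_exponents.

Section norm_bounds.
Context {R : realType}.
Notation mu := (@lebesgue_measure R).
Variable s : \bar R.
Hypothesis s1 : (1 < s)%E.
Let q := conj_exp s.

Definition norm_le (f : R -> R) (N : R) :=
  measurable_fun setT f /\ ('N[mu]_s[EFin \o f] <= N%:E)%E.

Lemma Lnorm_EFin (r : R) (f : R -> R) : 0 < r ->
  ('N[mu]_(r%:E)[EFin \o f] = (\int[mu]_x (`|f x| `^ r)%:E) `^ r^-1)%E.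
Proof.
move=> r0; rewrite unlock; congr (_ `^ _)%E.
Qed.

Lemma Lnorm_infty_ae (f : R -> R) (N : R) :
  ('N[mu]_+oo[EFin \o f] <= N%:E)%E <-> {ae mu, forall x, `|f x| <= N}.
Proof.
rewrite unlock lebesgue_setT_gt0; split.
  move/ess_supP; apply: (@filterS _ _ (ae_filter_ringOfSetsType mu)) => x /=.
  by rewrite lee_fin.
move=> H; apply/ess_supP; move: H.
by apply: (@filterS _ _ (ae_filter_ringOfSetsType mu)) => x /=; rewrite lee_fin.
Qed.

Lemma integrable_powR_norm (r : R) (f : R -> R) : 0 < r -> measurable_fun setT f ->
  ('N[mu]_(r%:E)[EFin \o f] < +oo)%E -> mu.-integrable setT (fun x => (`|f x| `^ r)%:E).
Proof.
move=> r0 mf; rewrite Lnorm_EFin// => H; apply/integrableP; split.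
  apply/measurable_EFinP; apply: (measurableT_comp (measurable_powR _)) => //.
  exact: measurableT_comp.
under eq_integral do rewrite /= ger0_norm ?powR_ge0//.
by apply: lty_poweRy H; rewrite invr_eq0 gt_eqF.
Qed.

Lemma fine_Lnorm (r : R) (f : R -> R) : 0 < r ->
  mu.-integrable setT (fun x => (`|f x| `^ r)%:E) ->
  ('N[mu]_(r%:E)[EFin \o f] = ((\int[mu]_x (`|f x| `^ r)) `^ r^-1)%:E)%E.
Proof.
by move=> r0 int; rewrite Lnorm_EFin// -poweR_EFin /Rintegral fineK// integrable_fin_num.
Qed.

Lemma hoelder_Rintegral (f g : R -> R) (N : R) : norm_le f N -> measurable_fun setT g ->
  mu.-integrable setT (fun x => (`|g x| `^ q)%:E) ->
  mu.-integrable setT (fun x => (f x * g x)%:E) /\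
  `|\int[mu]_x (f x * g x)| <= N * (\int[mu]_x (`|g x| `^ q)) `^ q^-1.
Proof.
move=> [mf fN] mg ig; have mfg : measurable_fun setT (fun x => f x * g x).
  exact: measurable_funM.
suff bound : (\int[mu]_x `|(f x * g x)%:E| <= (N * (\int[mu]_x (`|g x| `^ q)) `^ q^-1)%:E)%E.
  have ifg : mu.-integrable setT (fun x => (f x * g x)%:E).
    apply/integrableP; split; first exact/measurable_EFinP.
    by apply: le_lt_trans bound _; rewrite ltry.
  split => //; apply: le_trans (le_normr_Rintegral _ ifg) _ => //.
  rewrite -lee_fin /Rintegral fineK//.
  have := integrable_abse ifg => ?.
  exact: integrable_fin_num.
move: fN ig; rewrite /q; case: exponentP => // [|r r1] fN ig.
  have {}fN : {ae mu, forall x, `|f x| <= N} by exact/Lnorm_infty_ae.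
  under [in leRHS]eq_Rintegral do rewrite powRr1//.
  have ig' : mu.-integrable setT (fun x => `|g x|%:E).
    by apply: eq_integrable ig => // x _; rewrite powRr1.
  rewrite invr1 powRr1; last by apply: Rintegral_ge0.
  rewrite EFinM /Rintegral fineK; last exact: integrable_fin_num.
  (* A negative essential bound of [|f|] would make the whole line a null set. *)
  have N0 : 0 <= N.
    have [//|N0] := leP 0 N; exfalso.
    have : {ae mu, forall x : R, False}.
      move: fN; apply: (@filterS _ _ (ae_filter_ringOfSetsType mu)) => x /= fx.
      by have := le_lt_trans (le_trans (normr_ge0 _) fx) N0; rewrite ltxx.
    move=> [M [mM M0 TM]]; have := lebesgue_setT_gt0 R.
    have -> : [set: R] = M by apply/seteqP; split => // x _; apply: TM.
    by rewrite M0 ltxx.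
  have mng : measurable_fun setT (fun x => `|g x|%:E).
    by apply/measurable_EFinP; exact: measurableT_comp.
  rewrite -ge0_integralZl_EFin//.
  apply: ae_ge0_le_integral => //.
  - by apply: measurableT_comp => //; exact/measurable_EFinP.
  - by move=> x _; rewrite mule_ge0// lee_fin.
  - exact: measurable_funeM.
  - move: fN; apply: (@filterS _ _ (ae_filter_ringOfSetsType mu)) => x /= fx _.
    by rewrite -EFinM lee_fin normrM ler_wpM2r.
have r0 := lt_trans ltr01 r1.
have q0 : 0 < r / (r - 1) by rewrite divr_gt0// subr_gt0.
have pq : r^-1 + (r / (r - 1))^-1 = 1.
  by field; rewrite !gt_eqF// subr_gt0.
have := hoelder mu mf mg r0 q0 pq; rewrite Lnorm1 (fine_Lnorm q0 ig).
move=> /le_trans; apply; rewrite EFinM; apply: lee_wpmul2r => //.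
by rewrite lee_fin powR_ge0.
Qed.

(** Two powers of [h] come from differentiating twice, and [h^(-1/s)] from the change of variables
    in the norm. *)
Lemma norm_le_affine (f : R -> R) (N x h : R) : 0 < h -> norm_le f N ->
  norm_le (fun t => h ^+ 2 * f (x + h * t)) (h `^ (2 - inv_exp s) * N).
Proof.
move=> h0 [mf fN]; have maff : measurable_fun setT (fun t : R => x + h * t).
  by apply: measurable_funD => //; exact: measurable_funM.
have mfa : measurable_fun setT (fun t => h ^+ 2 * f (x + h * t)).
  by apply: measurable_funM => //; exact: measurableT_comp.
split => //; move: fN; case: exponentP => // [|r r1] fN.
  have {}fN : {ae mu, forall x, `|f x| <= N} by exact/Lnorm_infty_ae.
  apply/Lnorm_infty_ae; have := ae_affine x h0 fN.
  apply: (@filterS _ _ (ae_filter_ringOfSetsType mu)) => t /= ft.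
  rewrite subr0 (powR_mulrn 2 (ltW h0)) normrM (ger0_norm (exprn_ge0 2 (ltW h0))).
  by rewrite ler_pM2l ?exprn_gt0.
have r0 := lt_trans ltr01 r1.
have fNoo : ('N[mu]_(r%:E)[EFin \o f] < +oo)%E by apply: le_lt_trans fN _; rewrite ltry.
have intf := integrable_powR_norm r0 mf fNoo.
have ipre : (fun t => x + h * t) @^-1` [set: R] = setT by [].
have [ia Ea] := (integrable_affine x h0 measurableT intf, Rintegral_affine x h0 measurableT intf).
rewrite ipre in ia Ea.
have powE t : `|h ^+ 2 * f (x + h * t)| `^ r = h `^ (2 * r) * (`|f (x + h * t)| `^ r).
  rewrite normrM powRM// (ger0_norm (exprn_ge0 2 (ltW h0))).
  by rewrite -(powR_mulrn 2 (ltW h0)) -powRrM.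
have ia' : mu.-integrable setT (fun t => (`|h ^+ 2 * f (x + h * t)| `^ r)%:E).
  have := integrableZl measurableT (h `^ (2 * r)) ia.
  by apply: eq_integrable => // t _; rewrite powE.
have Eh := @fine_Lnorm r (fun t => h ^+ 2 * f (x + h * t)) r0 ia'.
have E1 := @fine_Lnorm r f r0 intf.
rewrite Eh lee_fin; move: fN; rewrite E1 lee_fin => fN.
under eq_Rintegral do rewrite powE.
rewrite RintegralZl// Ea mulrA powRM; last 2 first.
- by rewrite mulr_ge0 ?powR_ge0// invr_ge0 ltW.
- by apply: Rintegral_ge0 => t _; exact: powR_ge0.
rewrite -(powR_inv1 (ltW h0)) -powRD; last by apply/implyP => _; rewrite gt_eqF.
rewrite -powRrM mulrDl mulfK ?gt_eqF// mulN1r.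
by rewrite ler_pM2l// powR_gt0.
Qed.

End norm_bounds.

(** * Second-order Taylor remainders at the origin *)

Section extremal_functional.
Context {R : realType}.
Notation mu := (@lebesgue_measure R).

(** For [r < 1] the integrand is singular at 0: monotone convergence along [[1/(n+1), 1]], where the
    integrals stay below [1/r]. *)
Lemma integrable_powR0 (r : R) : 0 < r ->
  mu.-integrable `]0, 1] (EFin \o (fun t => t `^ (r - 1))).
Proof.
move=> r0; have mp : measurable_fun setT (fun t : R => t `^ (r - 1)) by exact: measurable_powR.
apply/integrableP; split; first by apply/measurable_EFinP; exact: measurable_funTS.
under eq_integral do rewrite /= ger0_norm ?powR_ge0//.
pose F (n : nat) : set R := `[n.+1%:R^-1, 1]%classic.
have FE : \bigcup_n F n = `]0, 1]%classic.
  apply/seteqP; split => x /=.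
    by move=> [n _]; rewrite /F/= !in_itv/= => /andP[nx ->]; rewrite andbT (lt_le_trans _ nx).
  rewrite in_itv/= => /andP[x0 x1]; exists (Num.bound x^-1) => //; rewrite /F/= in_itv/= x1 andbT.
  rewrite -[leRHS]invrK lef_pV2 ?posrE ?invr_gt0//.
  apply: le_trans (ltW (archi_boundP _)) _; first by rewrite invr_ge0 ltW.
  by rewrite ler_nat.
have ndF : nondecreasing_seq F.
  move=> i j ij; apply/subsetPset; apply: subset_itvr; rewrite bnd_simp.
  by rewrite lef_pV2 ?posrE// ler_nat.
have mF i : measurable (F i) by exact: measurable_itv.
have mf i : measurable_fun (F i) (fun t : R => (t `^ (r - 1))%:E).
  by apply/measurable_EFinP; exact: measurable_funTS.
have f0 i x : F i x -> (0 <= (x `^ (r - 1))%:E)%E by rewrite lee_fin powR_ge0.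
have cvgF := @ge0_nondecreasing_set_cvg_integral _ (measurableTypeR R) R F _
  lebesgue_measure ndF mF mf f0.
rewrite FE in cvgF *; rewrite -(cvg_lim _ cvgF)//; apply: (@le_lt_trans _ _ (r^-1)%:E); last exact: ltry.
apply: lime_le; first by apply/cvg_ex; eexists; exact: cvgF.
apply: nearW => n; have n0 : 0 < n.+1%:R^-1 :> R by rewrite invr_gt0.
have n1 : n.+1%:R^-1 <= 1 :> R by rewrite invf_le1// ler1n.
have [i E] := integral_powR n0 n1 (lt0r_neq0 r0).
have -> : (\int[mu]_(x in F n) (x `^ (r - 1))%:E = ((1 `^ r - n.+1%:R^-1 `^ r) / r)%:E)%E.
  by rewrite -E /Rintegral fineK//; exact: integrable_fin_num.
rewrite lee_fin powR1 -[leRHS]mul1r ler_pM2r ?invr_gt0//.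
Qed.

Variables (s : \bar R) (k a b p : R).
Hypothesis s1 : (1 < s)%E.
Hypothesis hk : 1 < k < 2 - inv_exp s.
Hypothesis hS : in_S a b p.
Let q := conj_exp s.

Lemma k_gt1 : 1 < k. Proof. by case/andP: hk. Qed.
Lemma k_itv : 1 < k < 2.
Proof.
have /andP[k1 ks] := hk; have /andP[i0 _] := inv_exp_itv s1.
by rewrite k1 (lt_le_trans ks)// lerBlDr lerDl.
Qed.

Lemma q_ge1 : 1 <= q. Proof. exact: conj_exp_ge1. Qed.
Lemma q_gt0 : 0 < q. Proof. exact: lt_le_trans ltr01 q_ge1. Qed.

(** As [1/q = 1 - 1/s], the condition [k < 2 - 1/s] reads [(k - 1) q < 1]: the kernel [t^(1-k)] is
    in L_q near 0. *)
Lemma powR_exponent_gt0 : 0 < (1 - k) * q + 1.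
Proof.
have q0 := q_gt0; have /andP[_ ks] := hk.
have : (k - 1) * q < q^-1 * q.
  by rewrite ltr_pM2r// conj_exp_inv//; move: ks; lra.
rewrite mulVf ?gt_eqF//; lra.
Qed.

Let kernel (u : R) := u `^ (1 - k) * \1_(`]0, 1]) u.

Let kernel_pow u : `|kernel u| `^ q = u `^ ((1 - k) * q) * \1_(`]0, 1]) u.
Proof.
rewrite /kernel indicE; case: (u \in _); last by rewrite !mulr0 normr0 powR0// gt_eqF// q_gt0.
by rewrite !mulr1 ger0_norm ?powR_ge0// powRrM.
Qed.

Let measurable_kernel : measurable_fun setT kernel.
Proof. by apply: measurable_funM; [exact: measurable_powR|exact: measurable_indic]. Qed.

Lemma integrable_indic (D : set R) (f : R -> R) : measurable D ->
  mu.-integrable D (EFin \o f) <-> mu.-integrable setT (fun u => (f u * \1_D u)%:E).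
Proof.
move=> mD; rewrite integrable_mkcond//.
rewrite (_ : (fun u => (f u * \1_D u)%:E) = (EFin \o f) \_ D)//.
by apply/funext => u; rewrite patchE indicE; case: ifP => _; rewrite ?mulr1 ?mulr0.
Qed.

Lemma Rintegral_indic (D : set R) (f : R -> R) :
  \int[mu]_(u in D) f u = \int[mu]_u (f u * \1_D u).
Proof.
rewrite Rintegral_mkcond; apply: eq_Rintegral => u _.
by rewrite patchE indicE; case: ifP => _; rewrite ?mulr1 ?mulr0.
Qed.

Let integrable_kernel : mu.-integrable setT (fun u => (`|kernel u| `^ q)%:E).
Proof.
have := integrable_powR0 powR_exponent_gt0; rewrite addrK.
move=> /(integrable_indic _ (measurable_itv _)).
by apply: eq_integrable => // u _; rewrite /= kernel_pow.
Qed.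

Lemma integrable_f2_powR (f2 : R -> R) (N : R) : norm_le s f2 N ->
  mu.-integrable `]0, 1] (fun u => (f2 u * u `^ (1 - k))%:E).
Proof.
move=> f2N; have [i _] := hoelder_Rintegral s1 f2N measurable_kernel integrable_kernel.
apply/(integrable_indic (fun u => f2 u * u `^ (1 - k)) (measurable_itv _)).
by apply: eq_integrable i => // u _; rewrite /= mulrA.
Qed.

Notation tau' := (tau k a b p).

(** [tau] vanishes outside []-p, 1]]; there [tau_bound] dominates it by a constant on []-p, 0]] and
    a multiple of [kernel] on []0, 1]]. *)
Lemma integrable_tau_pow : mu.-integrable setT (fun u => (`|tau' u| `^ q)%:E).
Proof.
have q0 := q_gt0; have k1 := k_gt1; have [a0 a1 b0 b1 [ab p0]] := in_S_bounds hS.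
pose C := (1 - slope2 k b) `^ q.
have mt : measurable_fun setT (fun u => (`|tau' u| `^ q)%:E).
  apply/measurable_EFinP; apply: (measurableT_comp (measurable_powR _)) => //.
  by apply: measurableT_comp => //; exact: measurable_tau.
have i1 : mu.-integrable setT (fun u : R => (1 * \1_(`]- p, 0]) u)%:E).
  apply/(integrable_indic (fun=> 1) (measurable_itv _)).
  by have [] := @has_Rintegral_cst R false false (- p) 0 1 _; rewrite ?oppr_le0.
have [i _] := Rintegral_lin C C measurableT i1 integrable_kernel.
have sl := slope2_lt0 k1 hS.
apply: (le_integrable _ _ _ i) => //.
move=> u _; rewrite /= lee_fin.
have R0 : 0 <= C * (1 * \1_(`]- p, 0]) u) + C * (`|kernel u| `^ q).
  by rewrite addr_ge0 ?mulr_ge0 ?powR_ge0.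
rewrite (ger0_norm (powR_ge0 _ _)) (ger0_norm R0); move: R0.
rewrite mul1r kernel_pow !indicE => R0.
have [up|pu] := leP u (- p).
  by rewrite tau_le// normr0 powR0 ?gt_eqF.
have := tau_bound k1 hS u; case: ltP => u0 bound; last first.
  rewrite mem_set/= ?in_itv/= ?pu// memNset/= ?in_itv/= ?ltNge ?u0//.
  rewrite mulr0 mulr0 addr0 mulr1 mulr1 in bound *.
  by apply: ge0_ler_powR; rewrite ?nnegrE ?(ltW q0)// (le_trans _ bound).
have [u1|/ltW u1] := leP u 1; last first.
  by rewrite tau_ge// normr0 powR0 ?gt_eqF.
rewrite memNset/= ?in_itv/= ?[u <= 0]leNgt ?u0/= ?andbF// mem_set/= ?in_itv/= ?u0//.
rewrite mulr0 add0r mulr1 /C powRrM -powRM ?powR_ge0//; last by rewrite subr_ge0; lra.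
by apply: ge0_ler_powR; rewrite ?nnegrE ?(ltW q0)// (le_trans _ bound).
Qed.

Definition tau_norm := (\int[mu]_u (`|tau' u| `^ q)) `^ q^-1.

Lemma tau_norm_bound (f2 : R -> R) (N : R) : norm_le s f2 N ->
  mu.-integrable setT (fun x => (f2 x * tau' x)%:E) /\
  `|\int[mu]_x (f2 x * tau' x)| <= N * tau_norm.
Proof.
move=> f2N; apply: hoelder_Rintegral => //; last exact: integrable_tau_pow.
exact: measurable_tau hS.
Qed.

Variables (f f1 f2 : R -> R) (M N : R).
Hypothesis prim : second_primitive f f1 f2.
Hypothesis fM : forall x, `|f x| <= M.
Hypothesis f2N : norm_le s f2 N.

Notation slope1' := (slope1 k a b p).
Notation slope2' := (slope2 k b).

(** Writing [Omega u] as [slope1 * (a + p) - slope1 * (a - u)] reduces the integral to a Taylor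
    remainder. No [f1 (- p)] survives because [Omega] vanishes at [- p]. *)
Let f2_Omega_left : has_Rintegral `]- p, a] (fun u => f2 u * Omega k a b p u)
  (slope1' * ((a + p) * f1 a - f a + f (- p))).
Proof.
have [a0 a1 b0 b1 [ab p0]] := in_S_bounds hS.
have pa : - p <= a by rewrite (le_trans _ (ltW a0))// oppr_le0.
have [iT ET] := second_primitive_Taylor prim pa.
have [_ _ _ /(_ _ _ pa)[i1 E1]] := prim.
have [i E] := Rintegral_lin (slope1' * (a + p)) (- slope1') (measurable_itv _) i1 iT.
apply: (@has_Rintegral_eq _ _ (fun x => slope1' * (a + p) * f2 x + - slope1' * ((a - x) * f2 x))
  _ _ _ (measurable_itv _)); [|exact: erefl|split; [exact: i|]].
  move=> u; rewrite inE/= in_itv/= => /andP[pu ua].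
  by rewrite /Omega leNgt pu/= ua; ring.
by rewrite E -E1 -ET; ring.
Qed.

Let f2_Omega_right : has_Rintegral `]a, 1] (fun u => f2 u * Omega k a b p u)
  ((f1 1 - f1 a) - slope2' * (f 1 - f a - (1 - a) * f1 a)).
Proof.
have [a0 a1 b0 b1 [ab p0]] := in_S_bounds hS.
have [iT ET] := second_primitive_Taylor prim (ltW a1).
have [_ _ _ /(_ _ _ (ltW a1))[i1 E1]] := prim.
have [i E] := Rintegral_lin 1 (- slope2') (measurable_itv _) i1 iT.
apply: (@has_Rintegral_eq _ _ (fun x => 1 * f2 x + - slope2' * ((1 - x) * f2 x))
  _ _ _ (measurable_itv _)); [|exact: erefl|split; [exact: i|]].
  move=> u; rewrite inE/= in_itv/= => /andP[au u1].
  have -> : Omega k a b p u = 1 + slope2' * (u - 1); last by ring.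
  have u0 := lt_trans a0 au.
  rewrite /Omega leNgt (le_lt_trans _ u0) ?oppr_le0//= leNgt au/=.
  by move: u1; rewrite le_eqVlt => /predU1P[->|->//]; rewrite ltxx powR1; ring.
by rewrite E -E1 -ET; ring.
Qed.

Let f2_rho : has_Rintegral `]- p, 1] (fun u => f2 u * rho k u)
  (\int[mu]_(u in `]0, 1]) (f2 u * u `^ (1 - k))).
Proof.
have [a0 a1 b0 b1 [ab p0]] := in_S_bounds hS.
rewrite -[X in has_Rintegral _ _ X]add0r.
apply: (@has_Rintegral_itvU _ _ _ false 0); rewrite ?bnd_simp ?oppr_le0//.
  apply: has_Rintegral_set0 => // u; rewrite inE/= in_itv/= => /andP[_ u0].
  by rewrite /rho ltNge u0/= mulr0.
apply: (@has_Rintegral_eq _ _ (fun u => f2 u * u `^ (1 - k)) _ _ _ (measurable_itv _));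
  [|exact: erefl|split; [exact: integrable_f2_powR f2N|by []]].
by move=> u; rewrite inE/= in_itv/= => /andP[u0 _]; rewrite /rho u0.
Qed.

(** The two terms in [f1 a] cancel because [Omega] is continuous at [a] ([slope1_join]), and [f1 1]
    has coefficient [Omega 1 = 1], as in [origin_integral]. *)
Let f2_tau : \int[mu]_u (f2 u * tau' u) =
  \int[mu]_(u in `]0, 1]) (f2 u * u `^ (1 - k))
  - (f1 1 - slope2' * (f 1 - f a) - slope1' * (f a - f (- p))).
Proof.
have [a0 a1 b0 b1 [ab p0]] := in_S_bounds hS; have k1 := k_gt1.
have pa : - p <= a by rewrite (le_trans _ (ltW a0))// oppr_le0.
have le1 : (BSide false (- p) <= BSide false a)%O by rewrite bnd_simp.
have le2 : (BSide false a <= BSide false 1)%O by rewrite bnd_simp ltW.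
have HO := has_Rintegral_itvU le1 le2 f2_Omega_left f2_Omega_right.
have [[iO EO] [ir Er]] := (HO, f2_rho).
have [_ E] := Rintegral_lin 1 (-1) (measurable_itv _) ir iO.
have -> : \int[mu]_u (f2 u * tau' u) = \int[mu]_(u in `]- p, 1]) (f2 u * tau' u).
  rewrite [RHS]Rintegral_mkcond; apply: eq_Rintegral => u _; rewrite patchE.
  case: ifPn => //; rewrite notin_setE/= in_itv/= => /negP; rewrite negb_and -leNgt -ltNge.
  by move=> /orP[up|/ltW u1]; [rewrite tau_le|rewrite tau_ge]; rewrite ?mulr0.
transitivity (\int[mu]_(u in `]- p, 1])
    (1 * (f2 u * rho k u) + -1 * (f2 u * Omega k a b p u))).
  by apply: eq_Rintegral => u _; rewrite tauE//; ring.
rewrite E EO Er mul1r mulN1r; congr (_ - _).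
have := slope1_join k hS; set S := slope1' * (a + p) => SE.
have -> : slope1' * ((a + p) * f1 a - f a + f (- p)) =
  S * f1 a - slope1' * (f a - f (- p)) by rewrite /S; ring.
by rewrite SE; ring.
Qed.

Lemma origin_representation :
  k * (k - 1) * \int[mu]_(t in `]0, +oo[) ((f t - f 0 - t * f1 0) / t `^ (1 + k)) =
  \int[mu]_u (f2 u * tau' u) + slope1' * f (- p) + (slope2' - slope1') * f a
  + ((1 - k) - slope2') * f 1
  + k * (k - 1) * \int[mu]_(t in `]1, +oo[) (f t * t `^ (- k - 1)).
Proof.
have [_ ->] := origin_integral k_itv prim fM (integrable_f2_powR f2N).
by rewrite f2_tau; ring.
Qed.

Let k_gt0 : 0 < k. Proof. exact: lt_trans ltr01 k_gt1. Qed.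

(** The signs of the slopes resolve the absolute values of the coefficients, and the tail
    contributes [(k - 1) M]: [s1 + (s1 - s2) + (1 - k - s2) + (k - 1) = 2 (s1 - s2)]. *)
Lemma origin_bound :
  `|k * (k - 1) * \int[mu]_(t in `]0, +oo[) ((f t - f 0 - t * f1 0) / t `^ (1 + k))|
  <= 2 * (slope1' - slope2') * M + N * tau_norm.
Proof.
have k1 := k_gt1; have [_ E2] := tau_norm_bound f2N.
have s1p := slope1_gt0 k1 hS; have s2n := slope2_lt0 k1 hS; have s2k := slope2_le k1 hS.
have [ip Ep] := integral_powRy k_gt0.
have iM : mu.-integrable `]1, +oo[ (fun t => (M * t `^ (- k - 1))%:E).
  exact: integrableZl ip.
have tail : `|\int[mu]_(t in `]1, +oo[) (f t * t `^ (- k - 1))| <= M / k.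
  have it := integrable_tail k_itv prim fM.
  apply: le_trans (le_normr_Rintegral _ it) _ => //.
  rewrite -Ep -RintegralZl//; apply: le_Rintegral => //; first exact: (integrable_norm it).
  by move=> t _; rewrite normrM (ger0_norm (powR_ge0 _ _)) ler_wpM2r ?powR_ge0.
rewrite origin_representation.
have kk : 0 <= k * (k - 1) by rewrite mulr_ge0 ?subr_ge0 ?ltW.
have T : `|k * (k - 1) * \int[mu]_(t in `]1, +oo[) (f t * t `^ (- k - 1))| <= (k - 1) * M.
  rewrite normrM (ger0_norm kk); apply: le_trans (ler_wpM2l kk tail) _.
  by rewrite le_eqVlt; apply/orP; left; apply/eqP; field; rewrite gt_eqF.
have Q c x : `|c * f x| <= `|c| * M by rewrite normrM ler_wpM2l.
have Q1 := Q slope1' (- p); have Q2 := Q (slope2' - slope1') a.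
have Q3 := Q (1 - k - slope2') 1.
have e2 : `|slope2' - slope1'| = slope1' - slope2'.
  rewrite ltr0_norm ?opprB// subr_lt0; exact: lt_trans s1p.
have e3 : `|1 - k - slope2'| = 1 - k - slope2' by rewrite ger0_norm// subr_ge0.
rewrite (gtr0_norm s1p) in Q1; rewrite e2 in Q2; rewrite e3 in Q3.
apply: le_trans (ler_normD _ _) _; apply: le_trans (lerD (ler_normD _ _) T) _.
apply: le_trans (lerD (lerD (ler_normD _ _) Q3) (lexx _)) _.
apply: le_trans (lerD (lerD (lerD (ler_normD _ _) Q2) (lexx _)) (lexx _)) _.
move: E2 Q1; lra.
Qed.

End extremal_functional.

(** * The Marchaud derivative *)

Section second_primitive_closure.
Context {R : realType}.
Notation mu := (@lebesgue_measure R).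
Implicit Types (f g : R -> R).

Lemma second_primitive_affine f (f1 f2 : R -> R) (x h : R) : 0 < h ->
  second_primitive f f1 f2 ->
  second_primitive (fun t => f (x + h * t)) (fun t => h * f1 (x + h * t))
    (fun t => h ^+ 2 * f2 (x + h * t)).
Proof.
move=> h0 [df cf1 mf2 f12].
have caff : continuous (fun t : R => x + h * t).
  by move=> t; apply: cvgD; [exact: cvg_cst|exact: mulrl_continuous].
split.
- move=> t; have dft := df (x + h * t).
  have daff : is_derive t 1 (fun t : R => x + h * t) h.
    have -> : (fun t : R => x + h * t) = cst x + (h \*: id) by [].
    by apply: is_derive_eq; rewrite add0r /GRing.scale/= mulr1.
  by have := @is_derive1_comp R f (fun t => x + h * t) t _ _ dft daff; rewrite mulrC.
- move=> t; apply: cvgM; first exact: cvg_cst.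
  apply: (@continuous_comp _ _ _ (fun t : R => x + h * t) f1); first exact: caff.
  exact: cf1.
- apply: measurable_funM => //; apply: measurableT_comp => //.
  by apply: continuous_measurable_fun.
- move=> c d cd; have cd' : x + h * c <= x + h * d by rewrite lerD2l ler_pM2l.
  have [i E] := f12 _ _ cd'.
  have pre : (fun t : R => x + h * t) @^-1` `]x + h * c, x + h * d] = `]c, d]%classic.
    by rewrite preimage_affine_itv// ![x + _]addrC !addrK ![h * _]mulrC !mulfK// gt_eqF.
  have ia := integrable_affine x h0 (measurable_itv _) i.
  have Ea := Rintegral_affine x h0 (measurable_itv _) i.
  rewrite pre in ia Ea; split; first exact: integrableZl ia.
  rewrite RintegralZl// Ea -E; field; exact: lt0r_neq0.
Qed.

Lemma second_primitive_sub f g (f1 f2 g1 g2 : R -> R) :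
  second_primitive f f1 f2 -> second_primitive g g1 g2 ->
  second_primitive (fun t => f t - g t) (fun t => f1 t - g1 t) (fun t => f2 t - g2 t).
Proof.
move=> [df cf1 mf2 f12] [dg cg1 mg2 g12]; split.
- by move=> t; have := df t; have := dg t => ? ?; exact: is_deriveB.
- by move=> t; apply: cvgB; [exact: cf1|exact: cg1].
- exact: measurable_funB.
- move=> c d cd; have [fi fE] := f12 c d cd; have [gi gE] := g12 c d cd.
  split; first exact: (integrableB _ fi gi).
  by rewrite RintegralB// -fE -gE; ring.
Qed.

Lemma norm_le_sub (s : \bar R) f g (N1 N2 : R) : (1 < s)%E ->
  norm_le s f N1 -> norm_le s g N2 -> norm_le s (fun t => f t - g t) (N1 + N2).
Proof.
move=> s1 [mf fN] [mg gN]; split; first exact: measurable_funB.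
have mNg : measurable_fun setT (\- g) by exact: measurableT_comp.
apply: le_trans (eminkowski mu mf mNg (ltW s1)) _.
rewrite EFinD; apply: leeD => //.
have -> : EFin \o (\- g) = (\- (EFin \o g))%E by [].
by rewrite oppe_Lnorm.
Qed.

Lemma has_Rintegral_sum (D : set R) n (c : 'I_n -> R) (F : 'I_n -> R -> R) (I : 'I_n -> R) :
  measurable D -> (forall i, has_Rintegral D (F i) (I i)) ->
  has_Rintegral D (fun t => \sum_(i < n) c i * F i t) (\sum_(i < n) c i * I i).
Proof.
move=> mD; elim: n c F I => [|n ih] c F I H.
  rewrite big_ord0; apply: has_Rintegral_set0 => // t _; by rewrite big_ord0.
have [ij Ej] := ih (fun i => c (widen_ord (leqnSn n) i)) (fun i => F (widen_ord (leqnSn n) i))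
  (fun i => I (widen_ord (leqnSn n) i)) (fun i => H _).
have [im Em] := H ord_max.
have [i E] := Rintegral_lin 1 (c ord_max) mD ij im.
apply: (@has_Rintegral_eq _ D _ _ _ _ mD _ _ (conj i erefl)).
  by move=> t _; rewrite /= big_ord_recr/= mul1r.
by rewrite E Ej Em big_ord_recr/= mul1r.
Qed.

End second_primitive_closure.

Section alternating_sums.
Context {R : realType}.

Lemma sum_sign_bin (n : nat) : (0 < n)%N ->
  \sum_(m < n.+1) (-1) ^+ m * 'C(n, m)%:R = 0 :> R.
Proof.
move=> n0; have := exprBn (1 : R) 1 n; rewrite subrr expr0n eqn0Ngt n0/= => /esym E.
rewrite -[RHS]E; apply: eq_bigr => i _.
by rewrite !expr1n !mulr1 mulr_natr.
Qed.

(** The identity [m C(n, m) = n C(n-1, m-1)] reduces the sum to [sum_sign_bin] for [n - 1]. *)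
Lemma sum_sign_bin_id (n : nat) : (1 < n)%N ->
  \sum_(m < n.+1) (-1) ^+ m * 'C(n, m)%:R * m%:R = 0 :> R.
Proof.
case: n => // n n1; rewrite big_ord_recl/= mulr0 add0r.
transitivity (- n.+1%:R * \sum_(m < n.+1) (-1) ^+ m * 'C(n, m)%:R : R).
  rewrite mulr_sumr; apply: eq_bigr => i _; rewrite /bump/= add1n exprS.
  rewrite -!mulrA -natrM (mulnC 'C(_, _)) -mul_bin_diag natrM; ring.
by rewrite sum_sign_bin ?mulr0.
Qed.

End alternating_sums.

Section marchaud_representation.
Context {R : realType}.
Notation mu := (@lebesgue_measure R).
Variables (s : \bar R) (k : R) (n : nat).
Hypothesis s1 : (1 < s)%E.
Hypothesis hk : 1 < k < 2 - inv_exp s.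
Hypothesis hn : k < n%:R.

Definition origin_functional (f f1 : R -> R) :=
  k * (k - 1) * \int[mu]_(t in `]0, +oo[) ((f t - f 0 - t * f1 0) / t `^ (1 + k)).

Definition marchaud_factor := (marchaud_cst k n)^-1 *
  (\sum_(m < n.+1) (-1) ^+ m * 'C(n, m)%:R * m%:R `^ k) / (k * (k - 1)).

Section single_function.
Variables (f f1 f2 : R -> R) (M N : R).
Hypothesis prim : second_primitive f f1 f2.
Hypothesis fM : forall x, `|f x| <= M.
Hypothesis f2N : norm_le s f2 N.

Lemma origin_integrable :
  mu.-integrable `]0, +oo[ (fun t => ((f t - f 0 - t * f1 0) / t `^ (1 + k))%:E).
Proof.
by have [] := origin_integral (k_itv s1 hk) prim fM (integrable_f2_powR s1 hk f2N).
Qed.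

End single_function.

Lemma origin_functional_sub (f f1 f2 g g1 g2 : R -> R) (M N M' N' : R) :
  second_primitive f f1 f2 -> (forall x, `|f x| <= M) -> norm_le s f2 N ->
  second_primitive g g1 g2 -> (forall x, `|g x| <= M') -> norm_le s g2 N' ->
  origin_functional f f1 - origin_functional g g1 =
  origin_functional (fun t => f t - g t) (fun t => f1 t - g1 t).
Proof.
move=> pf fM f2N pg gM g2N.
have If := origin_integrable pf fM f2N; have Ig := origin_integrable pg gM g2N.
have [_ E] := Rintegral_lin 1 (-1) (measurable_itv _) If Ig.
rewrite /origin_functional -mulrBr; congr (_ * _).
rewrite -mulN1r -[X in X + _ = _]mul1r -E.
by apply: eq_Rintegral => t _; ring.
Qed.

Section single_function_marchaud.
Variables (f f1 f2 : R -> R) (M N x : R).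
Hypothesis prim : second_primitive f f1 f2.
Hypothesis fM : forall x, `|f x| <= M.
Hypothesis f2N : norm_le s f2 N.

Let G (u : R) := (f (x + u) - f x - u * f1 x) / u `^ (1 + k).

Let k0 : 0 < k. Proof. exact: lt_trans ltr01 (k_gt1 hk). Qed.

Let G_integrable : mu.-integrable `]0, +oo[ (EFin \o G).
Proof.
have := origin_integrable (second_primitive_affine x ltr01 prim)
   (fun t => fM _) (norm_le_affine s1 x ltr01 f2N).
by apply: eq_integrable => // t _; rewrite /= /G !mul1r addr0.
Qed.

Let preimage_pos (h : R) : 0 < h -> (fun t : R => 0 + h * t) @^-1` `]0, +oo[ = `]0, +oo[%classic.
Proof.
move=> h0; apply/seteqP; split => t /=; rewrite !in_itv/= !andbT add0r pmulr_rgt0//.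
Qed.

Let G_scaled (h : R) : 0 < h ->
  has_Rintegral `]0, +oo[ (fun t => (f (x + h * t) - f x - h * t * f1 x) / t `^ (1 + k))
    (h `^ k * \int[mu]_(u in `]0, +oo[) G u).
Proof.
move=> h0; have ia := integrable_affine 0 h0 (measurable_itv _) G_integrable.
have Ea := Rintegral_affine 0 h0 (measurable_itv _) G_integrable.
rewrite preimage_pos// in ia Ea.
have iZ : mu.-integrable `]0, +oo[ (fun t => (h `^ (1 + k) * G (0 + h * t))%:E).
  exact: integrableZl ia.
have EZ : \int[mu]_(t in `]0, +oo[) (h `^ (1 + k) * G (0 + h * t)) =
    h `^ k * \int[mu]_(u in `]0, +oo[) G u.
  rewrite RintegralZl// Ea mulrA; congr (_ * _).
  rewrite -(powR_inv1 (ltW h0)) -powRD; last by apply/implyP => _; rewrite gt_eqF.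
  by congr (_ `^ _); ring.
apply: (@has_Rintegral_eq _ _ _ _ _ _ (measurable_itv _) _ EZ (conj iZ erefl)).
move=> t; rewrite inE/= in_itv/= andbT => t0; rewrite add0r /G powRM ?ltW//.
have hp : h `^ (1 + k) != 0 by rewrite gt_eqF// powR_gt0.
have tp : t `^ (1 + k) != 0 by rewrite gt_eqF// powR_gt0.
by field; rewrite hp tp.
Qed.

(** Term [m] of the finite difference is [G_scaled] at [h = m], once [f x] and [m t f1 x] are
    subtracted at no cost; [1 < k < n] gives the [n >= 2] that this takes. The left-hand side does
    not contain [h], which leaves [h] free for the final estimate. *)
Lemma marchaud_scaled (h : R) : 0 < h ->
  marchaud n k f x = marchaud_factor * h `^ (- k) *
    origin_functional (fun t => f (x + h * t)) (fun t => h * f1 (x + h * t)).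
Proof.
move=> h0; have k1 := k_gt1 hk.
have n1 : (1 < n)%N by rewrite -(ltr_nat R) (lt_trans k1).
have -> : origin_functional (fun t => f (x + h * t)) (fun t => h * f1 (x + h * t)) =
    k * (k - 1) * (h `^ k * \int[mu]_(u in `]0, +oo[) G u).
  rewrite /origin_functional; have [_ <-] := G_scaled h0; congr (_ * _).
  by apply: eq_Rintegral => t _; rewrite mulr0 addr0; congr (_ / _); ring.
have H (m : 'I_n.+1) : has_Rintegral `]0, +oo[
    (fun t => (f (x + m%:R * t) - f x - m%:R * t * f1 x) / t `^ (1 + k))
    (m%:R `^ k * \int[mu]_(u in `]0, +oo[) G u).
  (* [G_scaled] requires a positive scale; for [m = 0] the integrand and [0^k] are both 0. *)
  have [m0|m0] := posnP m; last by apply: G_scaled; rewrite ltr0n.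
  rewrite m0 powR0 ?gt_eqF// mul0r; apply: has_Rintegral_set0 => // t _.
  by rewrite mul0r addr0 subrr sub0r mul0r oppr0 mul0r.
have [_ E] := has_Rintegral_sum (fun m : 'I_n.+1 => (-1) ^+ m * 'C(n, m)%:R) (measurable_itv _) H.
have -> : marchaud n k f x = (marchaud_cst k n)^-1 *
    \sum_(m < n.+1) (-1) ^+ m * 'C(n, m)%:R * (m%:R `^ k * \int[mu]_(u in `]0, +oo[) G u).
  rewrite /marchaud -E; congr (_ * _); apply: eq_Rintegral => t _.
  rewrite /finite_diff mulr_suml.
  have S0 := @sum_sign_bin R n (ltnW n1); have S1 := @sum_sign_bin_id R n n1.
  transitivity (\sum_(m < n.+1) (-1) ^+ m * 'C(n, m)%:R * f (x + m%:R * t) / t `^ (1 + k)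
    - \sum_(m < n.+1) (-1) ^+ m * 'C(n, m)%:R * (f x / t `^ (1 + k))
    - \sum_(m < n.+1) (-1) ^+ m * 'C(n, m)%:R * m%:R * (t * f1 x / t `^ (1 + k))).
    by rewrite -!mulr_suml S0 S1 !mul0r !subr0.
  rewrite -!sumrB.
  by apply: eq_bigr => m _; ring.
under eq_bigr do rewrite mulrA.
rewrite -mulr_suml /marchaud_factor powRN.
have hp : h `^ k != 0 by rewrite gt_eqF// powR_gt0.
set S := \sum_(m < _) _; set I := \int[mu]_(u in _) _; set c := (marchaud_cst k n)^-1.
by field; rewrite hp !gt_eqF// subr_gt0.
Qed.

End single_function_marchaud.

End marchaud_representation.

(** * The extremal function *)

Section abs_continuity_of_integrals.
Context {R : realType}.
Notation mu := (@lebesgue_measure R).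
Implicit Types (g : R -> R).

Lemma loc_abs_continuous_continuous g : loc_abs_continuous g -> continuous g.
Proof.
move=> gac x; apply/cvgrPdist_lt => e e0.
have xx : x - 1 < x + 1 by lra.
have [d d0 H] := abs_continuous_seq (gac _ _ xx) e0.
apply/nbhs_ballP; exists (Num.min 1 d); first by rewrite /= lt_min ltr01.
move=> y; rewrite /ball/= lt_min => /andP[y1 yd].
move: y1; rewrite ltr_norml => /andP[y1 y2].
have [xy|/ltW yx] := leP x y.
  have := H [:: (x, y)]; rewrite big_seq1/= distrC; apply; split => //=.
    by rewrite xy andbT; apply/andP; split; lra.
  by rewrite big_seq1/= -[ltLHS]ger0_norm ?subr_ge0// distrC.
have := H [:: (y, x)]; rewrite big_seq1/=; apply; split => //=.
  by rewrite yx; apply/andP; split; [apply/andP; split|]; lra.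
by rewrite big_seq1/= -[ltLHS]ger0_norm ?subr_ge0.
Qed.

(** Short disjoint intervals unite to one set of measure below [d], over which the integral of [|h|]
    is small. *)
Lemma loc_abs_continuous_integral (h g : R -> R) : mu.-integrable setT (EFin \o h) ->
  (forall c d, c <= d -> g d - g c = \int[mu]_(t in `]c, d]) h t) ->
  loc_abs_continuous g.
Proof.
move=> ih gE u v uv e e0; have [d [d0 H]] := integral_normr_continuous ih e0.
exists d => // N l r lr tlr lrd.
pose F (i : 'I_N) : set R := `]l i, r i[%classic.
have mF i : measurable (F i) by exact: measurable_itv.
have mh : measurable_fun setT h by case/integrableP : ih => /measurable_EFinP.
have tF : trivIset [set` index_enum 'I_N] F by apply: sub_trivIset tlr.
pose D := \big[setU/set0]_(i < N) F i.
have mD : measurable D by exact: bigsetU_measurable.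
have muD : (mu D < d%:E)%E.
  have := @ge0_integral_bigsetU _ _ _ mu 'I_N F (cst 1%E) (index_enum 'I_N) mF
    (index_enum_uniq _) tF (measurable_cst _) (fun _ _ => lee01).
  rewrite /= integral_cst// mul1e => ->.
  rewrite -lte_fin -sumEFin in lrd; apply: le_lt_trans lrd.
  apply: lee_sum => i _.
  have -> : (\int[mu]_(x in F i) cst 1%E x = mu (F i))%E by rewrite integral_cst ?mul1e//; exact: mF.
  rewrite lebesgue_measure_itv/= lte_fin; case: ifP => // _.
  by have [_ [lri _]] := lr i; rewrite lee_fin subr_ge0.
apply: le_lt_trans (H D mD muD).
have inh A : measurable A -> mu.-integrable A (EFin \o (fun t => `|h t|)).
  by move=> mA; apply: integrable_norm; exact: integrableS ih.
have -> : \int[mu]_(x in D) `|h x| = \sum_(i < N) \int[mu]_(x in F i) `|h x|.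
  rewrite /Rintegral ge0_integral_bigsetU//; last 2 first.
  - exact: index_enum_uniq.
  - by apply/measurable_EFinP/measurable_funTS; exact: measurableT_comp.
  rewrite -sum_fine // => i _; by apply: integrable_fin_num; [exact: mF|exact: inh (mF i)].
apply: ler_sum => i _; have [_ [lri _]] := lr i.
rewrite gE// -Rintegral_itv_bndo_bndc; last exact: integrableS ih.
by apply: le_normr_Rintegral => //; exact: integrableS ih.
Qed.

(** All subsets of a finite set are Borel. This serves for the second derivative of [phi], whose
    values at the breakpoints are not computed. *)
Lemma measurable_fun_off_finite (f g : R -> R) (E : set R) : finite_set E ->
  measurable_fun setT f -> (forall x, ~ E x -> g x = f x) -> measurable_fun setT g.
Proof.
move=> fE mf gf _ Y mY; rewrite setTI.
have cE A : A `<=` E -> measurable A.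
  move=> AE; apply: countable_measurable => [t|]; first exact: measurable_set1.
  by apply: finite_set_countable; exact: sub_finite_set AE fE.
have -> : g @^-1` Y = (f @^-1` Y `\` E) `|` (g @^-1` Y `&` E).
  apply/seteqP; split => x /=.
    by move=> Yx; have [Ex|nEx] := pselect (E x); [right|left; rewrite -gf].
  by move=> [[Yx nEx]|[]//]; rewrite gf.
apply: measurableU; last by apply: cE => x [].
apply: measurableD; last exact: cE.
by rewrite -[X in measurable X]setTI; exact: mf.
Qed.

Lemma ae_off_finite (P : R -> Prop) (E : set R) : finite_set E ->
  (forall x, ~ E x -> P x) -> {ae mu, forall x, P x}.
Proof.
move=> fE EP; exists E; split.
- apply: countable_measurable => [t|]; first exact: measurable_set1.
  exact: finite_set_countable.
- by apply: countable_lebesgue_measure0; exact: finite_set_countable.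
- by move=> x /= nP; apply: contrapT => /EP.
Qed.

End abs_continuity_of_integrals.

(** * Zeros of tau and continuity of its signed power *)

Section strict_sign_of_tau.
Context {R : realType}.
Variables (k a b p : R).
Hypothesis k1 : 1 < k.
Hypothesis hS : in_S a b p.

Lemma powR_gt_tangent1 (r : R) : 0 < r -> r != 1 -> 1 + (1 - k) * (r - 1) < r `^ (1 - k).
Proof.
move=> r0 r1; rewrite /powR gt_eqF//.
have lnr : (1 - k) * ln r != 0.
  by rewrite mulf_neq0 ?ln_eq0// subr_eq0 lt_eqF.
apply: le_lt_trans (expR_gt1Dx lnr); rewrite lerD2l.
apply: ler_wnM2l; first by rewrite subr_le0 ltW.
have := @le_ln1Dx R (r - 1); rewrite addrCA subrr addr0; apply.
by rewrite ltrBrDr addrC subrr.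
Qed.

Lemma powR_gt_tangent (x y : R) : 0 < x -> 0 < y -> x != y ->
  y `^ (1 - k) + (1 - k) * y `^ (- k) * (x - y) < x `^ (1 - k).
Proof.
move=> x0 y0 xy; have xy1 : x / y != 1.
  by apply: contra_neq xy => e; rewrite -[LHS](divfK (lt0r_neq0 y0)) e mul1r.
have := powR_gt_tangent1 (divr_gt0 x0 y0) xy1.
rewrite -(ltr_pM2l (powR_gt0 (1 - k) y0)) -(powRM _ (ltW y0) (ltW (divr_gt0 x0 y0))).
rewrite [y * (x / y)]mulrC divfK ?gt_eqF//; apply: le_lt_trans; rewrite le_eqVlt; apply/orP; left; apply/eqP.
have -> : y `^ (1 - k) = y * y `^ (- k).
  by rewrite powRD ?powRr1 ?ltW//; apply/implyP => _; rewrite gt_eqF.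
by field; rewrite gt_eqF.
Qed.

Lemma powR_lt_decreasing (x y : R) : 0 < x -> x < y -> y `^ (1 - k) < x `^ (1 - k).
Proof.
move=> x0 xy; have y0 := lt_trans x0 xy.
have := powR_gt_tangent x0 y0; rewrite lt_eqF// => /(_ isT).
have : 0 <= (1 - k) * y `^ (- k) * (x - y).
  by rewrite mulr_le0 ?subr_le0 ?(ltW xy)// mulr_le0_ge0 ?powR_ge0// subr_le0 ltW.
lra.
Qed.

Lemma tau_lt0_neg (x : R) : - p < x -> x <= 0 -> tau k a b p x < 0.
Proof.
move=> px x0; rewrite tau_neg// oppr_lt0 mulr_gt0 ?(slope1_gt0 k1 hS)//.
by rewrite -ltrBlDr sub0r.
Qed.

Lemma tau_gt0_left (x : R) : 0 < x -> x < a -> 0 < tau k a b p x.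
Proof.
move=> x0 xa; apply: lt_le_trans (tau_left_ge k1 hS x0 (ltW xa)).
by rewrite subr_gt0; exact: powR_lt_decreasing.
Qed.

Lemma tau_gt0_middle (x : R) : a <= x -> x < b -> 0 < tau k a b p x.
Proof.
have [a0 a1 b0 b1 [ab p0]] := in_S_bounds hS => ax xb.
have x0 := lt_le_trans a0 ax.
rewrite tau_right ?subr_gt0 ?(le_trans (ltW xb) (ltW b1))//.
have h1 := powR_gt_tangent x0 b0; rewrite lt_eqF// in h1; move: (h1 isT) => {}h1.
have := powR_ge_tangent k1 ltr01 b0.
rewrite powR1; have := slope2_mul k hS; set m := (1 - k) * _ in h1 *.
set B := b `^ _ in h1 * => eB h2.
have m2 : m <= slope2 k b by rewrite -(ler_pM2r (_ : 0 < 1 - b)) ?subr_gt0// eB; lra.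
have : 0 <= (slope2 k b - m) * (b - x) by rewrite mulr_ge0 ?subr_ge0// ltW.
move: eB h1; lra.
Qed.

Lemma tau_lt0_right (x : R) : b < x -> x < 1 -> tau k a b p x < 0.
Proof.
have [a0 a1 b0 b1 [ab p0]] := in_S_bounds hS => bx x1; have x0 := lt_trans b0 bx.
rewrite tau_right ?subr_lt0 ?(le_trans ab) ?ltW//.
have h1 := powR_gt_tangent b0 x0; rewrite lt_eqF// in h1; move: (h1 isT) => {}h1.
have := powR_ge_tangent k1 ltr01 x0.
rewrite powR1; have := slope2_mul k hS; set m := (1 - k) * _ in h1 *.
set B := b `^ _ in h1 *; set X := x `^ _ in h1 * => eB h2.
rewrite -(ltr_pM2r (_ : 0 < 1 - b)) ?subr_gt0// mulrDl mulrAC eB.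
have : 0 < (1 - x) * (B - (X + m * (b - x))) by rewrite mulr_gt0// subr_gt0.
have : 0 <= (x - b) * (1 - (X + m * (1 - x))) by rewrite mulr_ge0 ?subr_ge0// ltW.
lra.
Qed.

(** [rho] jumps at 0, [Omega] changes its formula at [- p], [a] and 1, and [tau] vanishes at [b].
    For [q = 1] the signed power is the sign function, so zeros of [tau] must be excluded unless
    [tau] vanishes in a neighbourhood. *)
Definition breakpoints : set R := [set - p; 0; a; b; 1].

Lemma near_continuous (f g : R -> R) (x : R) : (\near x, g x = f x) ->
  {for x, continuous g} -> {for x, continuous f}.
Proof.
move=> fg cg; have E : g x = f x by exact: nbhs_singleton fg.
suff : f @ x --> f x by [].
by rewrite -E; apply: cvg_trans cg; exact: near_eq_cvg fg.
Qed.

Lemma signed_pow_continuous (q y : R) : y != 0 -> {for y, continuous (signed_pow q)}.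
Proof.
rewrite neq_lt => /orP[y0|y0].
- apply: (@near_continuous _ (fun z => - (- z) `^ (q - 1))).
    near=> z; have z0 : z < 0 by near: z; exact: lt_nbhsl.
    by rewrite /signed_pow ltr0_norm// ltr0_sg// mulrN1.
  apply: cvgN; apply: (@continuous_comp _ _ _ -%R (fun z : R => z `^ (q - 1))).
    exact: opp_continuous.
  by apply: continuous_powR; rewrite oppr_gt0.
- apply: (@near_continuous _ (fun z => z `^ (q - 1))).
    near=> z; have z0 : 0 < z by near: z; exact: lt_nbhsr.
    by rewrite /signed_pow gtr0_norm// gtr0_sg// mulr1.
  exact: continuous_powR.
Unshelve. all: by end_near. Qed.

Lemma tau_pow_continuous (q x : R) : ~ breakpoints x -> {for x, continuous (tau_pow k q a b p)}.
Proof.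
have [a0 a1 b0 b1 [ab p0]] := in_S_bounds hS => nE.
have xNp : x != - p by apply/eqP => e; apply: nE; rewrite e /breakpoints /=; do 4 left.
have xN0 : x != 0 by apply/eqP => e; apply: nE; rewrite e /breakpoints /=; do 3 left; right.
have xNa : x != a by apply/eqP => e; apply: nE; rewrite e /breakpoints /=; do 2 left; right.
have xNb : x != b by apply/eqP => e; apply: nE; rewrite e /breakpoints /=; left; right.
have xN1 : x != 1 by apply/eqP => e; apply: nE; rewrite e /breakpoints /=; right.
have zero : (\near x, tau k a b p x = 0) -> {for x, continuous (tau_pow k q a b p)}.
  move=> near0; apply: (@near_continuous _ (cst 0)); last exact: cvg_cst.
  near=> z; rewrite /tau_pow /signed_pow /=.
  have -> : tau k a b p z = 0 by near: z.
  by rewrite sgr0 mulr0.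
have comp : tau k a b p x != 0 -> {for x, continuous (tau k a b p)} ->
    {for x, continuous (tau_pow k q a b p)}.
  move=> t0 ct; apply: (@continuous_comp _ _ _ (tau k a b p) (signed_pow q)) => //.
  exact: signed_pow_continuous.
have caffine (c d e : R) : {for x, continuous (fun z => c + d * (z + e))}.
  apply: cvgD; first exact: cvg_cst.
  by apply: cvgM; [exact: cvg_cst|apply: cvgD; [exact: cvg_id|exact: cvg_cst]].
have [xp|px] := ltP x (- p).
  apply: zero; near=> z; apply: tau_le => //.
  by near: z; exact: lt_le_nbhsl.
have {}px : - p < x by rewrite lt_neqAle eq_sym xNp.
have [x0|x0] := ltP x 0.
  apply: comp; first by rewrite lt_eqF// tau_lt0_neg// ltW.
  apply: (@near_continuous _ (fun z => 0 + - slope1 k a b p * (z + p))); last exact: caffine.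
  near=> z; rewrite tau_neg//; first by ring.
  - by near: z; exact: lt_nbhsr.
  - by near: z; exact: lt_le_nbhsl.
have {}x0 : 0 < x by rewrite lt_neqAle eq_sym xN0.
have [xa|ax] := ltP x a.
  apply: comp; first by rewrite gt_eqF// tau_gt0_left.
  apply: (@near_continuous _ (fun z => z `^ (1 - k) - (0 + slope1 k a b p * (z + p)))).
    near=> z; rewrite tau_left//; first by rewrite add0r.
    - by near: z; exact: lt_nbhsr.
    - by near: z; exact: lt_le_nbhsl.
  apply: cvgB; first exact: continuous_powR.
  exact: caffine.
have {}ax : a < x by rewrite lt_neqAle eq_sym xNa.
have [x1|x1] := ltP x 1; last first.
  have {}x1 : 1 < x by rewrite lt_neqAle eq_sym xN1.
  apply: zero; near=> z; apply: tau_ge => //.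
  by near: z; exact: lt_le_nbhsr.
apply: comp.
  move: xNb; rewrite neq_lt => /orP[xb|bx].
    by rewrite gt_eqF// tau_gt0_middle// ltW.
  by rewrite lt_eqF// tau_lt0_right.
apply: (@near_continuous _ (fun z => z `^ (1 - k) - (1 + slope2 k b * (z + -1)))).
  near=> z; rewrite tau_right//.
  - by near: z; exact: lt_le_nbhsr.
  - by near: z; exact: lt_le_nbhsl.
apply: cvgB; first exact: continuous_powR.
exact: caffine.
Unshelve. all: by end_near. Qed.

End strict_sign_of_tau.

(** * Norms of continuous functions and the equality case of Hoelder's inequality *)

Section norm_tools.
Context {R : realType}.
Notation mu := (@lebesgue_measure R).
Implicit Types (f g : R -> R) (s : \bar R).

Lemma LfunP' s f : f \in Lfun mu s <->
  measurable_fun setT f /\ ('N[mu]_s[EFin \o f] < +oo)%E.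
Proof.
split.
  by rewrite !inE => /andP[]; rewrite !inE.
by move=> [mf fN]; rewrite !inE; apply/andP; rewrite !inE.
Qed.

Lemma is_derive_continuous f (x df : R) : is_derive x 1 f df -> {for x, continuous f}.
Proof.
move=> D; apply: differentiable_continuous; apply/derivable1_diffP.
exact: ex_derive.
Qed.

(** If [|f x|] exceeded the norm, so would [|f|] on a ball around [x], and a ball has positive
    measure. *)
Lemma Lnorm_infty_ge f x : {for x, continuous f} ->
  (`|f x|%:E <= 'N[mu]_+oo[EFin \o f])%E.
Proof.
move=> cf; rewrite leNgt; apply/negP => fN.
have [N NE] : exists N, ('N[mu]_+oo[EFin \o f] = N%:E)%E.
  exists (fine 'N[mu]_+oo[EFin \o f]%E); rewrite fineK// ge0_fin_numE ?Lnorm_ge0//.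
  exact: lt_trans fN (ltry _).
rewrite NE lte_fin in fN.
have : {ae mu, forall t, `|f t| <= N} by apply/Lnorm_infty_ae; rewrite NE.
move=> [A [mA A0 fA]].
have : \forall y \near x, N < `|f y|.
  have cnf : (fun y => `|f y|) @ x --> `|f x| by exact: cvg_norm.
  exact: (cvgr_gt `|f x| cnf).
move=> /nbhs_ballP[e /= e0 be].
have : (mu (ball x e) <= mu A)%E.
  apply: le_measure; rewrite ?inE//; first exact: measurable_ball.
  by move=> y /be Nf; apply: fA => /=; rewrite leNgt Nf.
by rewrite A0 (lebesgue_measure_ball _ (ltW e0)) lee_fin leNgt pmulrn_lgt0 ?e0.
Qed.

Lemma eq_off_finite_Lnorm s f g (E : set R) : (1 < s)%E -> finite_set E ->
  measurable_fun setT f -> measurable_fun setT g -> (forall x, ~ E x -> f x = g x) ->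
  ('N[mu]_s[EFin \o f] = 'N[mu]_s[EFin \o g])%E.
Proof.
move=> s1 fE mf mg fg; have ae := ae_off_finite fE fg.
move: s1; case: s => [r| |//].
  rewrite lte_fin => r1; have r0 := lt_trans ltr01 r1; rewrite !Lnorm_EFin//.
  have mp (h : R -> R) : measurable_fun setT h -> measurable_fun setT (fun x => (`|h x| `^ r)%:E).
    move=> mh; apply/measurable_EFinP; apply: (measurableT_comp (measurable_powR _)) => //.
    exact: measurableT_comp.
  congr (_ `^ _)%E; apply: ae_eq_integral => //; [exact: mp|exact: mp|].
  by move: ae; apply: (@filterS _ _ (ae_filter_ringOfSetsType mu)) => x /= -> _.
move=> _; rewrite unlock lebesgue_setT_gt0; apply: eq_ess_sup.
by move: ae; apply: (@filterS _ _ (ae_filter_ringOfSetsType mu)) => x /= ->.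
Qed.

Lemma eq_off_finite_Rintegral f g (E : set R) : finite_set E ->
  measurable_fun setT f -> measurable_fun setT g -> (forall x, ~ E x -> f x = g x) ->
  \int[mu]_x f x = \int[mu]_x g x.
Proof.
move=> fE mf mg fg; have ae := ae_off_finite fE fg.
rewrite /Rintegral; congr fine; apply: ae_eq_integral => //; [exact/measurable_EFinP|exact/measurable_EFinP|].
by move: ae; apply: (@filterS _ _ (ae_filter_ringOfSetsType mu)) => x /= -> _.
Qed.

Lemma Lnorm_scale s f (c : R) : (1 < s)%E -> f \in Lfun mu s ->
  ('N[mu]_s[EFin \o (fun x => (c * f x)%R)] = `|c|%:E * 'N[mu]_s[EFin \o f])%E.
Proof. by move=> s1 fL; exact: LnormZ (Lfun_Sub (ltW s1) fL) c. Qed.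

Lemma Rintegral_gt0 f (u v C : R) : u < v -> 0 < C -> mu.-integrable setT (EFin \o f) ->
  (forall t, 0 <= f t) -> (forall t, u < t <= v -> C <= f t) -> 0 < \int[mu]_t f t.
Proof.
move=> uv C0 intf f0 fC.
have [i E] := @has_Rintegral_cst R false false u v C (ltW uv).
rewrite Rintegral_indic in E.
apply: (@lt_le_trans _ _ (C * (v - u))); first by rewrite mulr_gt0// subr_gt0.
rewrite -E; apply: le_Rintegral => //; first exact/(integrable_indic (fun=> C) (measurable_itv _)).
move=> t _; rewrite indicE; have [|] := boolP (t \in _); rewrite ?mulr0//.
by rewrite inE/= in_itv/= mulr1 => /fC.
Qed.

(** For finite [s], [(q - 1) s = q] makes the s-th power of the extremizer equal to [|f|^q], so its
    norm is [I^(1/s)], and [1/s + 1/q = 1] gives equality. *)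
Lemma signed_pow_norm s f (I := \int[mu]_x (`|f x| `^ conj_exp s)) : (1 < s)%E ->
  measurable_fun setT (signed_pow (conj_exp s) \o f) -> measurable_fun setT f ->
  mu.-integrable setT (fun x => (`|f x| `^ conj_exp s)%:E) -> 0 < I ->
  exists2 N : R, ('N[mu]_s[EFin \o (signed_pow (conj_exp s) \o f)] = N%:E)%E &
    I = N * I `^ (conj_exp s)^-1.
Proof.
move=> s1; rewrite {}/I; have H := @hoelder_Rintegral R s s1; move: H.
case: (exponentP s1) => [|r r1] H mT mf intf.
  set I := \int[mu]_x _ => I0.
  have Tf x : signed_pow 1 (f x) * f x = `|f x| `^ 1.
    by rewrite /signed_pow subrr powRr0 mul1r -normrEsg powRr1.
  have N1 : ('N[mu]_+oo[EFin \o (signed_pow 1 \o f)] <= 1%:E)%E.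
    apply/Lnorm_infty_ae; apply: aeW => x.
    by rewrite /= /signed_pow subrr powRr0 mul1r normr_sg; case: eqP.
  have [N NE] : exists N : R, ('N[mu]_+oo[EFin \o (signed_pow 1 \o f)] = N%:E)%E.
    exists (fine ('N[mu]_+oo[EFin \o (signed_pow 1 \o f)])%E).
    rewrite fineK// ge0_fin_numE ?Lnorm_ge0//; exact: le_lt_trans N1 (ltry _).
  rewrite NE lee_fin in N1; exists N => //.
  have TN : norm_le +oo%E (signed_pow 1 \o f) N by split; rewrite ?NE.
  (* For [s = +oo] the extremizer is a sign function with norm [N <= 1]; Hoelder's inequality itself
     gives [I <= N * I], hence equality. *)
  have [_] := H _ _ _ TN mf intf.
  under eq_Rintegral do rewrite /= Tf.
  rewrite -/I invr1 powRr1 ?(ltW I0)// (gtr0_norm I0) => IN.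
  by apply/eqP; rewrite eq_le IN/= ler_piMl// ltW.
have r0 := lt_trans ltr01 r1; have r10 : 0 < r - 1 by rewrite subr_gt0.
set I := \int[mu]_x _ => I0.
have Tr x : `|signed_pow (r / (r - 1)) (f x)| `^ r = `|f x| `^ (r / (r - 1)).
  rewrite /signed_pow normrM normr_sg (ger0_norm (powR_ge0 _ _)).
  have [->|f0] := eqVneq (f x) 0.
    by rewrite mulr0 normr0 !powR0// ?mulf_neq0 ?invr_eq0 ?gt_eqF.
  rewrite mulr1 -powRrM; congr (_ `^ _); field; exact: lt0r_neq0.
exists (I `^ r^-1).
  have -> : I = \int[mu]_x (`|signed_pow (r / (r - 1)) (f x)| `^ r).
    by apply: eq_Rintegral => x _; rewrite Tr.
  apply: fine_Lnorm => //; apply: eq_integrable intf => // x _.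
  by rewrite /= Tr.
rewrite -powRD; last by rewrite (gt_eqF I0) implybT.
rewrite (_ : r^-1 + _ = 1) ?powRr1 ?(ltW I0)//.
by field; rewrite !gt_eqF.
Qed.

End norm_tools.

(** * Shape, norms and extremality of phi *)

Section extremal_function.
Context {R : realType}.
Notation mu := (@lebesgue_measure R).
Variables (s : \bar R) (k a b p : R).
Hypothesis s1 : (1 < s)%E.
Hypothesis hk : 1 < k < 2 - inv_exp s.
Hypothesis hS : in_S a b p.
Let q := conj_exp s.
Hypothesis hsys : phi_system k q a b p.

Let k1 : 1 < k := k_gt1 hk.
Let T := tau_pow k q a b p.
Notation tau' := (tau k a b p).

Let q1 : 1 <= q. Proof. exact: q_ge1. Qed.
Let q0 : 0 < q. Proof. exact: q_gt0. Qed.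

Let pos_a : 0 < a. Proof. by have [] := in_S_bounds hS. Qed.
Let pa : - p < a. Proof. by have [_ _ _ _ [_ p0]] := in_S_bounds hS; rewrite (le_lt_trans _ pos_a)// oppr_le0. Qed.
Let a1 : a < 1. Proof. by have [] := in_S_bounds hS. Qed.
Let ab : a <= b. Proof. by have [_ _ _ _ []] := in_S_bounds hS. Qed.
Let b1 : b < 1. Proof. by have [] := in_S_bounds hS. Qed.
Let p0 : 0 <= p. Proof. by have [_ _ _ _ []] := in_S_bounds hS. Qed.

Let norm_T (t : R) : `|T t| = `|tau' t| `^ (q - 1) * (tau' t != 0)%:R.
Proof.
by rewrite /T /tau_pow /signed_pow normrM (ger0_norm (powR_ge0 _ _)) normr_sg.
Qed.

Let T_tau (t : R) : T t * tau' t = `|tau' t| `^ q.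
Proof.
rewrite /T /tau_pow /signed_pow -mulrA -normrEsg mulrC.
exact: mulr_powRB1.
Qed.

Let T_ge0 (t : R) : 0 <= tau' t -> 0 <= T t.
Proof. by move=> ?; rewrite /T /tau_pow /signed_pow mulr_ge0 ?powR_ge0// sgr_ge0. Qed.

Let T_le0 (t : R) : tau' t <= 0 -> T t <= 0.
Proof. by move=> ?; rewrite /T /tau_pow /signed_pow mulr_ge0_le0 ?powR_ge0// sgr_le0. Qed.

Let T_eq0 (t : R) : tau' t = 0 -> T t = 0.
Proof. by move=> t0; rewrite /T /tau_pow /signed_pow t0 sgr0 mulr0. Qed.

Let T_left (t : R) : t <= - p -> T t = 0.
Proof. by move=> tp; apply: T_eq0; rewrite tau_le. Qed.

Let T_right (t : R) : 1 <= t -> T t = 0.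
Proof. by move=> tp; apply: T_eq0; rewrite tau_ge. Qed.

Let measurable_T : measurable_fun setT T.
Proof.
have mt := @measurable_tau R k a b p hS.
have mp : measurable_fun setT (fun t => `|tau' t| `^ (q - 1)).
  by apply: (measurableT_comp (measurable_powR _)) => //; exact: measurableT_comp.
have -> : T = fun t => if 0 < tau' t then `|tau' t| `^ (q - 1) else
    if tau' t < 0 then - `|tau' t| `^ (q - 1) else 0.
  apply/funext => t; rewrite /T /tau_pow /signed_pow.
  by case: sgrP => _; rewrite ?mulr0 ?mulr1 ?mulrN1.
apply: measurable_fun_ifT => //; first exact: measurable_fun_ltr.
apply: measurable_fun_ifT => //; first exact: measurable_fun_ltr.
exact: measurableT_comp.
Qed.

Let bool_le1 (c : bool) : c%:R <= 1 :> R.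
Proof. by case: c. Qed.

(** [T] is supported in []-p, 1]], and [y^(q-1) <= 1 + y^q] for [y >= 0]. *)
Let integrable_T : mu.-integrable setT (EFin \o T).
Proof.
have i1 : mu.-integrable setT (fun u : R => (1 * \1_(`]- p, 1]) u)%:E).
  apply/(integrable_indic (fun=> 1) (measurable_itv _)).
  have := @has_Rintegral_cst R false false (- p) 1 1; case => //.
  by rewrite (le_trans (ltW pa))// ltW.
have [i _] := Rintegral_lin 1 1 measurableT i1 (integrable_tau_pow s1 hk hS).
apply: (le_integrable _ _ _ i) => //; first exact/measurable_EFinP.
move=> u _; rewrite /= lee_fin !mul1r [leRHS]ger0_norm ?addr_ge0 ?powR_ge0//.
have [up|pu] := leP u (- p); first by rewrite T_left// normr0 addr_ge0 ?powR_ge0.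
have [u1|/ltW u1] := leP u 1; last by rewrite T_right// normr0 addr_ge0 ?powR_ge0.
rewrite indicE mem_set/= ?in_itv/= ?pu ?u1// norm_T.
have [t1|/ltW t1] := leP `|tau' u| 1.
  apply: (@le_trans _ _ 1); last by rewrite lerDl powR_ge0.
  apply: mulr_ile1; rewrite ?powR_ge0 ?bool_le1//.
  have := @ge0_ler_powR R (q - 1); rewrite subr_ge0 q1 => /(_ isT) H.
  by have := H `|tau' u| 1; rewrite !nnegrE normr_ge0 ler01 powR1; apply.
apply: (@le_trans _ _ (`|tau' u| `^ (q - 1))).
  by rewrite ler_piMr ?powR_ge0 ?bool_le1.
apply: (@le_trans _ _ (`|tau' u| `^ q)); last by rewrite lerDr.
by apply: ler_powR => //; rewrite lerBlDr lerDl.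
Qed.

(* The derivative of phi. *)
Let F (x : R) := \int[mu]_(t in `]-oo, x]) T t.

Let integrable_T_on (D : set R) : measurable D -> mu.-integrable D (EFin \o T).
Proof. by move=> mD; exact: integrableS integrable_T. Qed.

Let F_sub c d : c <= d -> F d - F c = \int[mu]_(t in `]c, d]) T t.
Proof.
by move=> cd; rewrite /F Rintegral_itvB ?bnd_simp//; exact: integrable_T_on.
Qed.

Let F_ac : loc_abs_continuous F.
Proof. exact: loc_abs_continuous_integral integrable_T F_sub. Qed.

Let F_cont : continuous F. Proof. exact: loc_abs_continuous_continuous. Qed.

Let F_left (x : R) : x <= - p -> F x = 0.
Proof.
move=> xp; have H0 : {in `]-oo, x]%classic, forall t, T t = 0}.
  by move=> t; rewrite inE/= in_itv/= => tx; rewrite T_left// (le_trans tx).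
by have [] := has_Rintegral_set0 (measurable_itv _) H0.
Qed.

(** The first equation of the system makes [a] a critical point of [phi]; the second carries this
    over to 1 in [F_right]. *)
Let F_a : F a = 0.
Proof.
have [H _ _] := hsys; have := F_sub (ltW pa); rewrite (F_left (lexx (- p))) subr0 => ->.
by rewrite -Rintegral_oc_cc ?H//; exact: integrable_T_on.
Qed.

Let F_right (x : R) : 1 <= x -> F x = 0.
Proof.
move=> x1; have [_ H _] := hsys.
have F1 : F 1 = 0.
  have := F_sub (ltW a1); rewrite F_a subr0 => ->.
  by rewrite -Rintegral_oc_cc ?H//; exact: integrable_T_on.
have := F_sub x1; rewrite F1 subr0 => ->.
have H0 : {in `]1, x]%classic, forall t, T t = 0}.
  by move=> t; rewrite inE/= in_itv/= => /andP[/ltW t1 _]; rewrite T_right.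
by have [] := has_Rintegral_set0 (measurable_itv _) H0.
Qed.

(** By the signs of [tau], [F] decreases from 0 on [[-p, 0]] and then increases to [F a = 0]. *)
Let F_le0 (x : R) : x <= a -> F x <= 0.
Proof.
move=> xa; have [xp|/ltW px] := leP x (- p); first by rewrite F_left.
have [x0|/ltW x0] := leP x 0.
  have := F_sub px; rewrite (F_left (lexx (- p))) subr0 => ->; rewrite -oppr_ge0 -mulN1r -RintegralZl//; last exact: integrable_T_on.
  apply: Rintegral_ge0 => t; rewrite /= in_itv/= => /andP[pt tx].
  by rewrite mulN1r oppr_ge0 T_le0// tau_le0_neg// (le_trans tx).
have := F_sub xa; rewrite F_a sub0r => E.
rewrite -oppr_ge0 E; apply: Rintegral_ge0 => t.
rewrite /= in_itv/= => /andP[xt ta]; apply: T_ge0; apply: tau_ge0 => //.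
  exact: le_lt_trans x0 xt.
exact: le_trans ta ab.
Qed.

(** [F] increases from [F a = 0] up to [b] and then decreases to [F 1 = 0]. *)
Let F_ge0 (x : R) : a <= x -> 0 <= F x.
Proof.
move=> ax; have [xb|/ltW bx] := leP x b.
  have := F_sub ax; rewrite F_a subr0 => ->; apply: Rintegral_ge0 => t.
  rewrite /= in_itv/= => /andP[at_ tx]; apply: T_ge0; apply: tau_ge0 => //.
    exact: lt_trans pos_a at_.
  exact: le_trans tx xb.
have [x1|/ltW x1] := leP 1 x; first by rewrite F_right.
have := F_sub x1; rewrite (F_right (lexx 1)) sub0r => E.
rewrite -[F x]opprK E -mulN1r -RintegralZl//; last exact: integrable_T_on.
apply: Rintegral_ge0 => t; rewrite /= in_itv/= => /andP[xt t1].
by rewrite mulN1r oppr_ge0 T_le0// tau_le0// (le_trans bx) ?ltW.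
Qed.

Notation phi' := (phi k q a b p).

(** As [T] has integral 0 over [[-p, a]], [phi] drops by [2 M] between [- p] and [a]; the additive
    constant in [phi] centres its range at 0. *)
Let M := 2^-1 * \int[mu]_(t in `[- p, a]) (t * T t).

Let integrable_tT (c d : R) : mu.-integrable `]c, d] (EFin \o (fun t => t * T t)).
Proof.
have [cd|dc] := leP c d; last first.
  by rewrite set_itv_ge ?bnd_simp -?leNgt ?ltW//; exact: integrable_set0.
have iT := integrable_T_on (measurable_itv `]c, d]).
have iC : mu.-integrable `]c, d] (fun t => ((Num.max `|c| `|d|) * T t)%:E).
  exact: integrableZl iT.
apply: (le_integrable _ _ _ iC) => //.
  apply/measurable_EFinP/measurable_funTS; exact: measurable_funM.
move=> t; rewrite /= in_itv/= => /andP[ct td]; rewrite lee_fin !normrM ler_wpM2r//.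
apply: le_trans (ler_norm _); rewrite le_max.
have [t0|t0] := leP 0 t.
  by rewrite (ger0_norm t0) (le_trans td (ler_norm d)) orbT.
by rewrite (ltr0_norm t0) -normrN (le_trans _ (ler_norm (- c)))// lerN2 ltW.
Qed.

(** Exchanging integrals with weight 1 turns the factor [x - t] into a second integration. The free
    base point [c] covers arguments left of [- p]. *)
Let phiE (c x : R) : c <= - p -> c <= x ->
  phi' x = M + \int[mu]_(t in `]c, x]) F t.
Proof.
move=> cp cx; rewrite /phi -/M; congr (_ + _).
have iT (y : R) : mu.-integrable `]c, y] (EFin \o T) by exact: integrable_T_on.
have [ixT ExT] := Rintegral_lin x (-1) (measurable_itv _) (iT x) (integrable_tT c x).
have [i1 E1] : has_Rintegral `]c, x] (fun t => (x - t) * T t)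
    (x * \int[mu]_(t in `]c, x]) T t - \int[mu]_(t in `]c, x]) (t * T t)).
  apply: (@has_Rintegral_eq _ _ (fun t => x * T t + -1 * (t * T t)) _ _ _ (measurable_itv _)).
  - by move=> t _; ring.
  - by rewrite mulN1r in ExT; exact: ExT.
  - by split.
have -> : \int[mu]_(t in `[- p, x]) ((x - t) * tau_pow k q a b p t) =
    \int[mu]_(t in `]c, x]) ((x - t) * T t).
  rewrite [LHS]Rintegral_indic [RHS]Rintegral_indic; apply: eq_Rintegral => t _; rewrite !indicE.
  have [tp|pt] := leP t (- p); first by rewrite -/T T_left// !mulr0 !mul0r.
  congr (_ * (nat_of_bool _)%:R); apply/idP/idP; rewrite !inE/= !in_itv/=.
    by move=> /andP[_ ->]; rewrite (le_lt_trans cp pt).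
  by move=> /andP[_ ->]; rewrite (ltW pt).
have unit_int u : c < u <= x -> mu.-integrable `[u, x] (EFin \o (fun=> 1 : R)).
  by move=> /andP[_ ux]; have [] := @has_Rintegral_cst R true false u x 1 ux.
have int1 u : u <= x -> \int[mu]_(t in `[u, x]) (1 : R) = x - u.
  by move=> ux; have [_ ->] := @has_Rintegral_cst R true false u x 1 ux; rewrite mul1r.
have iw : mu.-integrable `]c, x] (fun u => (T u * \int[mu]_(t in `[u, x]) `|1 : R|)%:E).
  apply: eq_integrable i1 => // u; rewrite inE/= in_itv/= => /andP[_ ux].
  by rewrite normr1 int1// mulrC.
have := @triangular_Fubini R c x T (fun=> 1) measurable_T (measurable_cst _) (iT x) unit_int iw.
move=> E; transitivity (\int[mu]_(u in `]c, x]) (T u * \int[mu]_(t in `[u, x]) (1 : R))).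
  by apply: eq_Rintegral => u; rewrite inE/= in_itv/= => /andP[_ ux]; rewrite int1// mulrC.
rewrite -E; apply: eq_Rintegral => t; rewrite inE/= in_itv/= => /andP[/ltW ct _].
by rewrite mul1r; have := F_sub ct; rewrite (F_left cp) subr0 => ->.
Qed.

Let F_int (c d : R) : c <= d ->
  mu.-integrable `]c, d] (EFin \o F) /\ mu.-integrable `[c, d] (EFin \o F).
Proof.
move=> cd; suff i : mu.-integrable `[c, d] (EFin \o F) by split => //; exact: integrable_cc_oc.
apply: continuous_compact_integrable; first exact: segment_compact.
by apply: continuous_subspaceT => t; exact: F_cont.
Qed.

Lemma is_derive_phi : forall x : R, is_derive x 1 phi' (F x).
Proof.
(* This base point is left of [- p] and strictly left of [x], so that [x] is interior to the
   interval of integration. *)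
move=> x; pose c := Num.min (- p) x - 1.
have cp : c <= - p by rewrite lerBlDr (le_trans (_ : _ <= - p))// ?ge_min ?lexx// lerDl.
have cx : c < x by rewrite ltrBlDr (le_lt_trans (_ : _ <= x))// ?ge_min ?lexx ?orbT// ltrDl.
have xx : x < x + 1 by rewrite ltrDl.
have [icx _] := F_int (ltW (lt_trans cx xx)).
have cFx : {for x, continuous F} by exact: F_cont.
have bcx : (BRight c < BRight x)%O by rewrite bnd_simp.
have [dG EG] := continuous_FTC1 xx icx bcx cFx.
set G := (fun y => _) in dG EG.
have isG : is_derive x 1 G (F x) by apply: DeriveDef => //; rewrite -derive1E.
have isMG : is_derive x 1 (cst M + G) (F x) by apply: is_derive_eq; rewrite add0r.
apply: near_eq_is_derive isMG; near=> y.
by rewrite /= (@phiE c y)//; near: y; exact: lt_le_nbhsr.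
Unshelve. all: by end_near. Qed.

Let phi_sub (c d : R) : c <= d -> phi' d - phi' c = \int[mu]_(t in `]c, d]) F t.
Proof.
move=> cd; have [|_ _ E _] := C1_FTC cd (fun x _ => is_derive_phi x); last by rewrite E.
by move=> x _; exact: F_cont.
Qed.

Let phi_left (x : R) : x <= - p -> phi' x = M.
Proof.
move=> xp; rewrite (phiE xp (lexx x)).
by rewrite set_itvoc0 Rintegral_set0 addr0.
Qed.

Let phi_a : phi' a = - M.
Proof.
have int0 : \int[mu]_(t in `[- p, a]) T t = 0 by have [H _ _] := hsys.
have iT : mu.-integrable `[- p, a] (EFin \o T) by exact: integrable_T_on.
have itT : mu.-integrable `[- p, a] (EFin \o (fun t => t * T t)).
  by apply: integrableS (integrable_tT (- p - 1) a) => //; apply: subset_itvr; rewrite bnd_simp; lra.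
have [_ E] := Rintegral_lin a (-1) (measurable_itv _) iT itT.
have -> : phi' a = M + \int[mu]_(t in `[- p, a]) (a * T t + -1 * (t * T t)).
  by rewrite /phi -/M; congr (_ + _); apply: eq_Rintegral => t _; rewrite -/T; ring.
by rewrite E int0 /M; field.
Qed.

(** The third equation of the system, with the vanishing of the integral of [T] over [[-p, 1]],
    brings [phi] back to [M] at 1; beyond 1 its derivative is 0. *)
Let phi_right (x : R) : 1 <= x -> phi' x = M.
Proof.
move=> x1; have [H1 H2 H3] := hsys.
have p1 : - p <= 1 by rewrite (le_trans (ltW pa)) ?ltW.
have int0 : \int[mu]_(t in `[- p, 1]) T t = 0.
  rewrite Rintegral_oc_cc; last exact: integrable_T_on.
  by rewrite -F_sub// (F_left (lexx _)) (F_right (lexx _)) subr0.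
have iT : mu.-integrable `[- p, 1] (EFin \o T) by exact: integrable_T_on.
have itT : mu.-integrable `[- p, 1] (EFin \o (fun t => t * T t)).
  by apply: integrableS (integrable_tT (- p - 1) 1) => //; apply: subset_itvr; rewrite bnd_simp; lra.
have [_ E] := Rintegral_lin 1 (-1) (measurable_itv _) iT itT.
have phi1 : phi' 1 = M.
  have -> : phi' 1 = M + \int[mu]_(t in `[- p, 1]) (1 * T t + -1 * (t * T t)).
    by rewrite /phi -/M; congr (_ + _); apply: eq_Rintegral => t _; rewrite -/T; ring.
  by rewrite E int0 H3; ring.
rewrite -[LHS](subrK (phi' 1)) phi_sub// phi1.
have H0 : {in `]1, x]%classic, forall t, F t = 0}.
  by move=> t; rewrite inE/= in_itv/= => /andP[/ltW t1 _]; rewrite F_right.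
by have [_ ->] := has_Rintegral_set0 (measurable_itv _) H0; rewrite add0r.
Qed.

Let phi_antitone (c d : R) : c <= d -> d <= a -> phi' d <= phi' c.
Proof.
move=> cd da; have [iF _] := F_int cd; rewrite -subr_ge0 -opprB phi_sub// -mulN1r -RintegralZl//.
apply: Rintegral_ge0 => t; rewrite /= in_itv/= => /andP[_ td].
by rewrite mulN1r oppr_ge0 F_le0// (le_trans td).
Qed.

Let phi_monotone (c d : R) : c <= d -> a <= c -> phi' c <= phi' d.
Proof.
move=> cd ac; rewrite -subr_ge0 phi_sub//; apply: Rintegral_ge0 => t.
by rewrite /= in_itv/= => /andP[/ltW ct _]; rewrite F_ge0// (le_trans ac).
Qed.

Let phi_bound (x : R) : `|phi' x| <= M.
Proof.
rewrite ler_norml -phi_a; have [xa|/ltW ax] := leP x a.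
  rewrite phi_antitone//=; have [xp|/ltW px] := leP x (- p); first by rewrite phi_left.
  by rewrite -(phi_left (lexx (- p))) phi_antitone.
rewrite phi_monotone//=; have [x1|/ltW x1] := leP 1 x; first by rewrite phi_right.
by rewrite -(phi_right (lexx 1)) phi_monotone.
Qed.

(** The derivative [F] is bounded by the L_1 norm of [T]. The Lipschitz bound serves the continuity
    of the Marchaud derivative. *)
Lemma phi_lipschitz : exists2 K, 0 <= K & forall x y, `|phi' x - phi' y| <= K * `|x - y|.
Proof.
pose K := \int[mu]_t `|T t|.
have iN := integrable_norm integrable_T.
have FK t : `|F t| <= K.
  apply: le_trans (le_normr_Rintegral _ (integrable_T_on _)) _ => //.
  rewrite Rintegral_indic; apply: le_Rintegral => //.
    apply/(integrable_indic (fun t => `|T t|) (measurable_itv _)).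
    exact: integrableS iN.
  by move=> u _; rewrite ler_piMr// indicE bool_le1.
exists K; first exact: Rintegral_ge0.
suff key x y : x <= y -> `|phi' y - phi' x| <= K * (y - x).
  move=> x y; have [xy|/ltW yx] := leP x y.
    by rewrite distrC [X in _ <= _ * X]distrC [X in _ <= _ * X]ger0_norm ?subr_ge0// key.
  by rewrite [X in _ <= _ * X]ger0_norm ?subr_ge0// key.
move=> xy; have [iF _] := F_int xy; rewrite phi_sub//.
have [iK EK] := @has_Rintegral_cst R false false x y K xy.
apply: le_trans (le_normr_Rintegral _ iF) _ => //; rewrite -EK.
by apply: le_Rintegral => //; exact: (integrable_norm iF).
Qed.

Let finite_breakpoints : finite_set (breakpoints a b p).
Proof. by rewrite /breakpoints !finite_setU. Qed.

Let tau_lower : exists2 c : R, 0 < c & forall t, a / 4 < t <= a / 2 -> c <= tau' t.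
Proof.
exists ((a / 2) `^ (1 - k) - a `^ (1 - k)).
  by rewrite subr_gt0; apply: powR_lt_decreasing => //; rewrite ?divr_gt0//; move: pos_a; lra.
move=> t /andP[t1 t2]; have a4 : 0 < a / 4 by rewrite divr_gt0.
have t0 := lt_trans a4 t1; have ta : t <= a by move: pos_a; lra.
apply: le_trans (tau_left_ge k1 hS t0 ta); rewrite lerD2r.
exact: powR_le_nonincreasing.
Qed.

Let I := \int[mu]_t (`|tau' t| `^ q).

Let I_gt0 : 0 < I.
Proof.
have [c c0 H] := tau_lower.
apply: (@Rintegral_gt0 R _ (a / 4) (a / 2) (c `^ q)).
- by move: pos_a; lra.
- exact: powR_gt0.
- exact: integrable_tau_pow.
- by move=> t; exact: powR_ge0.
- move=> t /H ct; have t0 := lt_le_trans c0 ct.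
  by rewrite (gtr0_norm t0); apply: ge0_ler_powR => //; rewrite ?nnegrE ltW.
Qed.

(** On []-p, a]] the sign of [tau t] agrees with that of [t], so the integrand [t * T t] is
    nonnegative. *)
Lemma phi_amplitude_gt0 : 0 < M.
Proof.
have [c c0 H] := tau_lower; rewrite /M mulr_gt0 ?invr_gt0//.
rewrite Rintegral_indic; apply: (@Rintegral_gt0 R _ (a / 4) (a / 2) (a / 4 * c `^ (q - 1))).
- by move: pos_a; lra.
- by rewrite mulr_gt0 ?divr_gt0// powR_gt0.
- apply/(integrable_indic (fun t => t * T t) (measurable_itv _)).
  by apply: integrableS (integrable_tT (- p - 1) a) => //; apply: subset_itvr; rewrite bnd_simp; lra.
- move=> t; rewrite indicE; have [|] := boolP (t \in _); rewrite ?mulr0// mulr1 inE/= in_itv/=.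
  move=> /andP[pt ta]; have [t0|t0] := ltP 0 t.
    by rewrite mulr_ge0 ?(ltW t0)// T_ge0// tau_ge0// (le_trans ta).
  by rewrite mulr_le0// T_le0// tau_le0_neg.
- move=> t /[dup] tI /H ct; have /andP[t1 t2] := tI.
  have t0 : 0 < t by rewrite (lt_trans _ t1)// divr_gt0.
  have tau0 := lt_le_trans c0 ct.
  rewrite indicE mem_set ?mulr1; last first.
    by rewrite /= in_itv/=; apply/andP; split; move: pos_a p0 t0; lra.
  rewrite ler_pM ?powR_ge0 ?divr_ge0 ?(ltW t1) ?(ltW pos_a)//.
  rewrite /T /tau_pow /signed_pow (gtr0_sg tau0) mulr1 (gtr0_norm tau0).
  by apply: ge0_ler_powR => //; [rewrite subr_ge0|rewrite nnegrE ltW|rewrite nnegrE ltW].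
Qed.

Lemma tau_pow_Lnorm : exists2 N : R, 0 < N &
  ('N[mu]_s[EFin \o T] = N%:E)%E /\ I = N * tau_norm s k a b p.
Proof.
have [||||N NE IE] := @signed_pow_norm _ s tau' s1 => //.
- exact: measurable_tau hS.
- exact: integrable_tau_pow.
exists N; last by split.
have := I_gt0; rewrite /I /q IE pmulr_lgt0//.
by rewrite lt0r powR_ge0 powR_eq0 negb_and gt_eqF.
Qed.

Section scaled.
Variable c : R.
Hypothesis c0 : 0 < c.
Notation g := (fun x => c * phi' x).
Notation g2 := (derive1n 2 g).

Let is_derive_g (x : R) : is_derive x 1 g (c * F x).
Proof. by have := is_derive_phi x => D; exact: is_deriveZ. Qed.

Let derive1_g : derive1 g = fun x => c * F x.
Proof. by apply/funext => x; have D := is_derive_g x; rewrite derive1E derive_val. Qed.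

(** Off the breakpoints [T] is continuous, so that [F] has the classical derivative [T] there. *)
Let g2_T (x : R) : ~ breakpoints a b p x -> g2 x = c * T x.
Proof.
move=> nE; have cT : {for x, continuous T} by exact: tau_pow_continuous.
have xx : x < x + 1 by rewrite ltrDl.
have iT : mu.-integrable [set` Interval -oo%O (BRight (x + 1))] (EFin \o T).
  exact: integrable_T_on.
have [dF EF] := continuous_FTC1 xx iT (ltNyr x) cT.
by rewrite -EF /derive1n/= derive1_g !derive1E; exact: deriveZ.
Qed.

Let measurable_cT : measurable_fun setT (fun x => c * T x).
Proof. exact: measurable_funM. Qed.

Let measurable_g2 : measurable_fun setT g2.
Proof. exact: measurable_fun_off_finite finite_breakpoints measurable_cT g2_T. Qed.

Let derive1_g_ac : loc_abs_continuous (derive1 g).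
Proof.
apply: (@loc_abs_continuous_integral _ (fun x => c * T x)).
  exact: integrableZl integrable_T.
move=> u v uv; rewrite derive1_g -mulrBr F_sub// RintegralZl//.
exact: integrable_T_on.
Qed.

Lemma phi_scaled_second_primitive : second_primitive g (derive1 g) g2.
Proof.
split.
- by rewrite derive1_g; exact: is_derive_g.
- exact: loc_abs_continuous_continuous.
- exact: measurable_g2.
- move=> u v uv; have [i E] := loc_abs_continuous_FTC uv derive1_g_ac measurable_g2.
  split; first exact: integrable_cc_oc.
  by rewrite E Rintegral_oc_cc//; exact: integrable_cc_oc.
Qed.

Let g2_tau : \int[mu]_t (g2 t * tau' t) = c * I.
Proof.
have mt := @measurable_tau R k a b p hS.
rewrite (@eq_off_finite_Rintegral _ _ (fun t => c * (T t * tau' t)) _ finite_breakpoints).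
- rewrite -RintegralZl//; last exact: integrable_tau_pow.
  by apply: eq_Rintegral => t _; rewrite T_tau.
- exact: measurable_funM.
- by apply: measurable_funM => //; exact: measurable_funM.
- by move=> t /g2_T ->; rewrite mulrA.
Qed.

Notation slopes := (slope1 k a b p - slope2 k b).

Lemma phi_scaled_extremal (N : R) : ('N[mu]_s[EFin \o T] = N%:E)%E ->
  I = N * tau_norm s k a b p ->
  [/\ L2space s g, forall x, `|g x| <= c * M,
    (enorm +oo%E g = (c * M)%:E)%E, enorm s g2 = (c * N)%:E &
    origin_functional k g (derive1 g) = 2 * slopes * (c * M) + c * N * tau_norm s k a b p].
Proof.
move=> NE IN; have cphi : continuous g.
  by move=> x; exact: is_derive_continuous (is_derive_g x).
have gM x : `|g x| <= c * M by rewrite normrM (gtr0_norm c0) ler_wpM2l// ltW.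
have gnorm : (enorm +oo%E g = (c * M)%:E)%E.
  apply/eqP; rewrite eq_le; apply/andP; split.
    by apply/Lnorm_infty_ae; exact: aeW.
  have := @Lnorm_infty_ge R g (- p) (cphi _); rewrite (phi_left (lexx _)).
  by rewrite ger0_norm// mulr_ge0// ltW// phi_amplitude_gt0.
have g2norm : enorm s g2 = (c * N)%:E.
  rewrite /enorm (eq_off_finite_Lnorm s1 finite_breakpoints measurable_g2 measurable_cT g2_T).
  rewrite Lnorm_scale//; first by rewrite NE (gtr0_norm c0).
  by apply/LfunP'; split => //; rewrite NE ltry.
split => //.
  split.
  - apply/LfunP'; split; first exact: continuous_measurable_fun.
    by rewrite -/(enorm +oo%E g) gnorm ltry.
  - by move=> x; have := is_derive_g x => D; exact: ex_derive.
  - exact: derive1_g_ac.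
  - by apply/LfunP'; split => //; rewrite -/(enorm s g2) g2norm ltry.
have g2_le : norm_le s g2 (c * N) by split => //; rewrite -/(enorm s g2) g2norm.
have k0 : 0 < k := lt_trans ltr01 k1; have [ip Ep] := integral_powRy k0.
(* With the values [c M] at [- p], at 1 and throughout the tail, and [- c M] at [a], every estimate
   behind [origin_bound] becomes an equality. *)
rewrite /origin_functional (origin_representation s1 hk hS phi_scaled_second_primitive gM g2_le).
rewrite g2_tau IN (phi_left (lexx _)) phi_a (phi_right (lexx 1)).
have -> : \int[mu]_(t in `]1, +oo[) (g t * t `^ (- k - 1)) = c * M * k^-1.
  rewrite -Ep -RintegralZl//; apply: eq_Rintegral => t.
  by rewrite inE/= in_itv/= andbT => /ltW t1; rewrite phi_right.
by field; rewrite gt_eqF.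
Qed.

End scaled.

(** The scale [c] is free because two values are needed: [c = 1] computes the norm that normalizes
    [Phi], and [c = N^-1] gives [Phi] itself. *)
Lemma phi_extremal : exists M N : R, [/\ 0 < M, 0 < N & forall c, 0 < c ->
  let g := fun x => c * phi' x in
  [/\ L2space s g, forall x, `|g x| <= c * M,
    (enorm +oo%E g = (c * M)%:E)%E, enorm s (derive1n 2 g) = (c * N)%:E &
    origin_functional k g (derive1 g) =
      2 * (slope1 k a b p - slope2 k b) * (c * M) + c * N * tau_norm s k a b p]].
Proof.
have [N N0 [NE IN]] := tau_pow_Lnorm; exists M, N; split => //.
  exact: phi_amplitude_gt0.
by move=> c c0; exact: phi_scaled_extremal.
Qed.

End extremal_function.

(** * Sharp bounds *)

Section marchaud_bound.
Context {R : realType}.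
Notation mu := (@lebesgue_measure R).

Lemma powR_root (y r : R) : 0 < y -> r != 0 -> (y `^ r^-1) `^ r = y.
Proof. by move=> y0 r0; rewrite -powRrM mulVf// powRr1// ltW. Qed.

(** Replaces a limit in [h], at +oo for [r < 0] and at 0 for [r > 0]: a positive [v] would be
    violated at one explicit [h]. *)
Lemma le_powR_le0 (v c r : R) : r != 0 -> (forall h, 0 < h -> v <= c * h `^ r) -> v <= 0.
Proof.
move=> r0 H; rewrite leNgt; apply/negP => v0.
pose y := v / (`|c| + 1); have c1 : 0 < `|c| + 1 by rewrite ltr_pwDr.
have y0 : 0 < y by rewrite divr_gt0.
have := H (y `^ r^-1) (powR_gt0 _ y0); rewrite powR_root//; apply/negP; rewrite -ltNge.
apply: (@le_lt_trans _ _ (`|c| * y)); first by rewrite ler_wpM2r ?ler_norm ?ltW.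
by rewrite /y mulrCA -[ltRHS]mulr1 ltr_pM2l// ltr_pdivrMr// mul1r ltrDl.
Qed.

Variables (s : \bar R) (k : R) (n : nat) (a b p : R).
Hypothesis s1 : (1 < s)%E.
Hypothesis hk : 1 < k < 2 - inv_exp s.
Hypothesis hn : k < n%:R.
Hypothesis hS : in_S a b p.

Let A := 2 * (slope1 k a b p - slope2 k b).
Let B := tau_norm s k a b p.
Let e := 2 - inv_exp s.
Let lam := k / e.

Let k1 : 1 < k := k_gt1 hk.
Let k0 : 0 < k := lt_trans ltr01 k1.
Let ke : k < e. Proof. by case/andP: hk. Qed.
Let e0 : 0 < e := lt_trans k0 ke.

Let A0 : 0 < A.
Proof.
by rewrite mulr_gt0// subr_gt0 (lt_trans (slope2_lt0 k1 hS)) ?slope1_gt0.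
Qed.

Let B0 : 0 <= B. Proof. exact: powR_ge0. Qed.

Section single_function.
Variables (f f1 f2 : R -> R) (M N : R).
Hypothesis prim : second_primitive f f1 f2.
Hypothesis fM : forall x, `|f x| <= M.
Hypothesis f2N : norm_le s f2 N.

Let M0 : 0 <= M := le_trans (normr_ge0 _) (fM 0).

Lemma marchaud_le (x h : R) : 0 < h ->
  `|marchaud n k f x| <= `|marchaud_factor k n| * h `^ (- k) * (A * M + h `^ e * N * B).
Proof.
move=> h0; rewrite (marchaud_scaled s1 hk hn x prim fM f2N h0).
rewrite 2!normrM (ger0_norm (powR_ge0 _ _)) ler_wpM2l ?mulr_ge0 ?powR_ge0//.
exact: (origin_bound s1 hk hS (second_primitive_affine x h0 prim) (fun=> fM _)
  (norm_le_affine s1 x h0 f2N)).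
Qed.

(* In the scaled representation the second derivative of [f (x + h t) - f (z + h t)]
   contributes [O(h^(e-k))] uniformly in [z], and for fixed [h] the Lipschitz
   condition controls the rest. *)
Lemma marchaud_continuous (K : R) : (forall x y, `|f x - f y| <= K * `|x - y|) ->
  continuous (marchaud n k f).
Proof.
move=> fK x; apply/cvgrPdist_lt => ep ep0.
have K0 : 0 <= K.
  by have := fK 1 0; rewrite subr0 normr1 mulr1; apply: le_trans.
pose c := `|marchaud_factor k n| * (N + N) * B.
have ek : e - k != 0 by rewrite subr_eq0 gt_eqF.
(* [h] is chosen so that [h^(-k) h^e = y], which keeps the part due to the second derivatives below
   [ep / 2]; adding 1 avoids division by 0. *)
pose y := ep / (2 * (`|c| + 1)).
have c1 : 0 < `|c| + 1 by rewrite ltr_pwDr.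
have y0 : 0 < y by rewrite divr_gt0// mulr_gt0.
pose h := y `^ (e - k)^-1; have h0 : 0 < h by rewrite powR_gt0.
have hE : h `^ (- k) * h `^ e = y.
  by rewrite -powRD ?(gt_eqF h0) ?implybT// addrC powR_root.
have cy : c * y < ep / 2.
  apply: (@le_lt_trans _ _ (`|c| * y)); first by rewrite ler_wpM2r ?ler_norm ?ltW.
  rewrite /y invfM [ep * _]mulrA mulrCA -[ltRHS]mulr1 ltr_pM2l ?divr_gt0//.
  by rewrite ltr_pdivrMr// mul1r ltrDl.
pose d := `|marchaud_factor k n| * h `^ (- k) * (A * K).
have d0 : 0 <= d.
  by apply: mulr_ge0; apply: mulr_ge0; rewrite ?powR_ge0 ?(ltW A0).
have key z : `|marchaud n k f x - marchaud n k f z| <= d * `|x - z| + c * y.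
  rewrite (marchaud_scaled s1 hk hn x prim fM f2N h0) (marchaud_scaled s1 hk hn z prim fM f2N h0).
  have px := second_primitive_affine x h0 prim; have pz := second_primitive_affine z h0 prim.
  have nx := norm_le_affine s1 x h0 f2N; have nz := norm_le_affine s1 z h0 f2N.
  rewrite -mulrBr (origin_functional_sub s1 hk px (fun=> fM _) nx pz (fun=> fM _) nz).
  rewrite 2!normrM (ger0_norm (powR_ge0 _ _)).
  have D t : `|f (x + h * t) - f (z + h * t)| <= K * `|x - z|.
    by rewrite (_ : x - z = x + h * t - (z + h * t)) ?fK//; ring.
  have bound := origin_bound s1 hk hS (second_primitive_sub px pz) D (norm_le_sub s1 nx nz).
  have C0 : 0 <= `|marchaud_factor k n| * h `^ (- k) by rewrite mulr_ge0 ?powR_ge0.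
  apply: le_trans (ler_wpM2l C0 bound) _.
  rewrite le_eqVlt; apply/orP; left; apply/eqP.
  by rewrite -hE /d /c /A /B /e; ring.
have d1 : 0 < d + 1 by rewrite ltr_pwDr.
near=> z; apply: (le_lt_trans (key z)); rewrite (splitr ep) ltrD//.
apply: (@le_lt_trans _ _ ((d + 1) * `|x - z|)).
  by rewrite ler_wpM2r// lerDl.
rewrite mulrC -ltr_pdivlMr//; near: z.
have : 0 < ep / 2 / (d + 1) by rewrite !divr_gt0.
by move=> H; exact: (nbhsx_ballx x _ H).
Unshelve. all: by end_near. Qed.

Lemma marchaud_optimal (m x : R) : 0 < m -> 0 <= N ->
  `|marchaud n k f x| <=
  `|marchaud_factor k n| * (A * m + B) / m `^ (1 - lam) * M `^ (1 - lam) * N `^ lam.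
Proof.
move=> m0 N0; have lam0 : lam != 0 by rewrite mulf_neq0 ?invr_eq0 ?gt_eqF.
have rhs0 : 0 <= `|marchaud_factor k n| * (A * m + B) / m `^ (1 - lam) * M `^ (1 - lam) * N `^ lam.
  by rewrite !mulr_ge0 ?invr_ge0 ?powR_ge0// addr_ge0// mulr_ge0// ltW.
have H := marchaud_le x.
move: N0; rewrite le_eqVlt => /orP[/eqP N0|N0].
  apply: le_trans rhs0; apply: (@le_powR_le0 _ (`|marchaud_factor k n| * (A * M)) (- k)).
    by rewrite oppr_eq0 gt_eqF.
  by move=> h /H; rewrite -N0 mulr0 mul0r addr0 mulrAC.
move: (M0); rewrite le_eqVlt => /orP[/eqP Mz|Mp].
  apply: le_trans rhs0; apply: (@le_powR_le0 _ (`|marchaud_factor k n| * (N * B)) (e - k)).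
    by rewrite subr_eq0 gt_eqF.
  move=> h h0; apply: le_trans (H h h0) _; rewrite -Mz mulr0 add0r.
  have -> : h `^ (e - k) = h `^ (- k) * h `^ e.
    by rewrite -powRD ?(gt_eqF h0) ?implybT// addrC.
  by rewrite le_eqVlt; apply/orP; left; apply/eqP; ring.
(* The choice [h^e = M / (m N)] makes equality hold for the extremal function,
   for which [h = 1]. *)
pose y := M / (m * N); have y0 : 0 < y by rewrite divr_gt0// mulr_gt0.
pose h := y `^ e^-1; have h0 : 0 < h by exact: powR_gt0.
apply: le_trans (H h h0) _; rewrite powR_root ?gt_eqF//.
have -> : h `^ (- k) = y `^ (- lam).
  by rewrite -powRrM; congr (_ `^ _); rewrite /lam; ring.
have -> : A * M + y * N * B = (A * m + B) * (M / m).
  by rewrite /y; field; rewrite !gt_eqF.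
have yl : y `^ (- lam) * (M / m) = (m `^ (1 - lam))^-1 * M `^ (1 - lam) * N `^ lam.
  have -> : M / m = y * N by rewrite /y; field; rewrite !gt_eqF.
  rewrite mulrA -{2}[y]powRr1 ?(ltW y0)// -powRD ?(gt_eqF y0) ?implybT//.
  rewrite /y powRM ?invr_ge0 ?(ltW Mp) ?mulr_ge0 ?(ltW m0) ?(ltW N0)//.
  rewrite -powR_inv1 ?mulr_ge0 ?(ltW m0) ?(ltW N0)// -powRrM mulN1r.
  rewrite powRM ?(ltW m0) ?(ltW N0)// (addrC (- lam)) powRN.
  rewrite -[X in _ * X = _]powRr1 ?(ltW N0)// -!mulrA -powRD ?(gt_eqF N0) ?implybT//.
  rewrite mulrCA; congr (_ * (_ * (_ `^ _))); ring.
rewrite le_eqVlt; apply/orP; left; apply/eqP.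
transitivity (`|marchaud_factor k n| * (A * m + B) * (y `^ (- lam) * (M / m))); first by ring.
by rewrite yl; ring.
Qed.

End single_function.
End marchaud_bound.

(** Continuity of [f] upgrades the essential bound to a bound at every point, which the values at
    [- p], [a] and 1 in [origin_representation] demand. *)
Lemma L2space_second_primitive (R : realType) (s : \bar R) (f : R -> R) : L2space s f ->
  [/\ second_primitive f (derive1 f) (derive1n 2 f),
      forall x, `|f x| <= rnorm +oo%E f &
      norm_le s (derive1n 2 f) (rnorm s (derive1n 2 f))].
Proof.
move=> [/LfunP'[mf fN] df acf /LfunP'[mf2 f2N]].
have isdf (x : R) : is_derive x 1 f (derive1 f x).
  by apply: DeriveDef; rewrite ?derive1E.
have fin (t : \bar R) (g : R -> R) : (enorm t g < +oo)%E -> enorm t g = (rnorm t g)%:E.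
  by move=> gN; rewrite /rnorm fineK// ge0_fin_numE// Lnorm_ge0.
split.
- split => //; first exact: loc_abs_continuous_continuous.
  move=> u v uv; have [i E] := loc_abs_continuous_FTC uv acf mf2.
  split; first exact: integrable_cc_oc.
  by rewrite E Rintegral_oc_cc//; exact: integrable_cc_oc.
- move=> x; rewrite -lee_fin -fin//.
  by apply: Lnorm_infty_ge; exact: is_derive_continuous (isdf x).
- by split => //; rewrite -/(enorm s _) fin.
Qed.

Theorem corollary11 (R : realType) (s : \bar R) (k : R) (n : nat) (a b p : R)
    (hs : (1 < s)%E)
    (hk : 1 < k < 2 - inv_exp s)
    (hn : k < n%:R)
    (hS : in_S a b p)
    (hsys : phi_system k (conj_exp s) a b p) :
  let lambda := k / (2 - inv_exp s) in
  let PhiKS := Phi k s a b p in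
  let C := rnorm +oo%E (marchaud n k PhiKS) / rnorm +oo%E PhiKS `^ (1 - lambda) in
  (forall f : R -> R, L2space s f ->
     (enorm +oo%E (marchaud n k f) <=
      (C * rnorm +oo%E f `^ (1 - lambda) * rnorm s (derive1n 2 f) `^ lambda)%:E)%E)
  /\
  (forall C' : R,
     (forall f : R -> R, L2space s f ->
        (enorm +oo%E (marchaud n k f) <=
         (C' * rnorm +oo%E f `^ (1 - lambda) * rnorm s (derive1n 2 f) `^ lambda)%:E)%E) ->
     C <= C').
Proof.
move=> lambda PhiKS C.
have [M [N [M0 N0 ext]]] := phi_extremal hs hk hS hsys.
(* The case [c = 1] identifies the normalizing factor in [Phi]. *)
have rN : rnorm s (derive1n 2 (phi k (conj_exp s) a b p)) = N.
  have [_ _ _ + _] := ext 1 ltr01; rewrite mul1r /rnorm.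
  by under eq_fun do rewrite mul1r; move=> ->.
have Phi_E : PhiKS = fun x => N^-1 * phi k (conj_exp s) a b p x.
  by rewrite /PhiKS /Phi rN.
have Ni0 : 0 < N^-1 by rewrite invr_gt0.
have [] := ext _ Ni0; rewrite -Phi_E mulVf ?gt_eqF// mulrC mul1r => PhiL PhiM Phi_oo Phi_s Phi_0.
set m := M / N in PhiM Phi_oo Phi_0; have m0 : 0 < m by rewrite divr_gt0.
have {}PhiM x : `|PhiKS x| <= m by rewrite Phi_E.
set A := 2 * _ in Phi_0; set B := tau_norm s k a b p in Phi_0.
have [prim _ _] := L2space_second_primitive PhiL.
have Phi_s_le : norm_le s (derive1n 2 PhiKS) 1.
  by have [_ _ _ /LfunP'[mPhi _]] := PhiL; split => //; rewrite -/(enorm s _) Phi_s.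
have DPhi0 : `|marchaud n k PhiKS 0| = `|marchaud_factor k n| * (A * m + B).
  rewrite (marchaud_scaled hs hk hn 0 prim PhiM Phi_s_le ltr01) powR1 mulr1.
  rewrite (_ : (fun t => PhiKS (0 + 1 * t)) = PhiKS); last first.
    by apply/funext => t; rewrite add0r mul1r.
  rewrite (_ : (fun t => 1 * derive1 PhiKS (0 + 1 * t)) = derive1 PhiKS); last first.
    by apply/funext => t; rewrite add0r !mul1r.
  rewrite Phi_0 normrM [X in _ * X]ger0_norm// addr_ge0 ?powR_ge0//.
  have s1 := slope1_gt0 (k_gt1 hk) hS; have s2 := slope2_lt0 (k_gt1 hk) hS.
  by rewrite mulr_ge0 ?(ltW m0)// mulr_ge0// subr_ge0 ltW// (lt_trans s2).
have DPhi : enorm +oo%E (marchaud n k PhiKS) = (`|marchaud_factor k n| * (A * m + B))%:E.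
  apply/eqP; rewrite eq_le; apply/andP; split.
    (* At [h = 1] the general bound coincides with the value attained at 0. *)
    apply/Lnorm_infty_ae; apply: aeW => x.
    have := marchaud_le hs hk hn hS prim PhiM Phi_s_le x ltr01.
    by rewrite !powR1 !mulr1 !mul1r.
  rewrite -DPhi0; apply: Lnorm_infty_ge.
  have [K K0 phiK] := phi_lipschitz hs hk hS.
  have PhiK x y : `|PhiKS x - PhiKS y| <= (N^-1 * K) * `|x - y|.
    by rewrite Phi_E -mulrBr normrM (gtr0_norm Ni0) -mulrA ler_wpM2l// ltW.
  exact: (marchaud_continuous hs hk hn hS prim PhiM Phi_s_le PhiK).
have CE : C = `|marchaud_factor k n| * (A * m + B) / m `^ (1 - lambda).
  by rewrite /C /rnorm DPhi Phi_oo.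
split.
  move=> f fL; have [primf fM f2N] := L2space_second_primitive fL.
  apply/Lnorm_infty_ae; apply: aeW => x; rewrite CE.
  apply: (marchaud_optimal hs hk hn hS primf fM f2N x m0).
  exact/fine_ge0/Lnorm_ge0.
(* [Phi] is the test function; its second derivative has norm 1, so only the power of [m] remains to
   be divided out. *)
move=> C' /(_ _ PhiL); rewrite DPhi /rnorm Phi_oo Phi_s powR1 mulr1 lee_fin CE.
by rewrite ler_pdivrMr ?powR_gt0.
Qed.
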